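(* Let $U,V$ be real separable Hilbert spaces, let $\alpha\in(0,\tfrac12)$, let $B=(B_t,t\in\mathbb{R})$ be a $U$-cylindrical $\alpha$-regular Volterra process, let $A$ be the infinitesimal generator of a strongly continuous semigroup $(S(t),t\ge 0)$ of bounded linear operators on $V$, and let $\varPhi\in\mathcal{L}(U,V)$. Assume that $B$ has stationary and reflexive increments, that $S(u)\varPhi\in\mathcal{L}_2(U,V)$ for every $u>0$, and that $$\int_0^\infty \|S(r)\varPhi\|_{\mathcal{L}_2(U,V)}^{\frac{2}{1+2\alpha}}\,\mathrm{d}r<\infty .$$ For $t\ge 0$ let $\mu_t^0$ be the probability law on $V$ of $X_t^0=\int_0^tS(t-r)\varPhi\,\mathrm{d}B_r$ (the mild solution at time $t$ of $\mathrm{d}X_t=AX_t\,\mathrm{d}t+\varPhi\,\mathrm{d}B_t$ with $X_0=0$). Then there is a measure $\mu_\infty$ on $V$ such that $\mu_t^0\to\mu_\infty$ weakly as $t\to\infty$.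
   Context: **Kernels.** For $\alpha\in(0,\frac12)$, an $\alpha$-regular Volterra kernel is a (Borel measurable) function $K:\mathbb{R}^2\to\mathbb{R}$ such that: $K(t,r)=0$ whenever $t<r$ and $\lim_{t\to r+}K(t,r)=0$ for every $r\in\mathbb{R}$; $K(\cdot,r)$ is continuously differentiable on $(r,\infty)$ for every $r$; there is a finite constant $C>0$ with $\left|\frac{\partial K}{\partial u}(u,r)\right|\le C(u-r)^{\alpha-1}$ for all $r<u$ (here $\frac{\partial K}{\partial u}$ is the derivative in the first variable). Put $$R(s_1,t_1,s_2,t_2):=\int_{\mathbb{R}}(K(t_1,r)-K(s_1,r))(K(t_2,r)-K(s_2,r))\,\mathrm{d}r .$$ **Scalar processes and integral.** A real process $b=(b_t,t\in\mathbb{R})$ is an $\alpha$-regular Volterra process (with kernel $K$) if it is centred, $b_0=0$, and $\mathbb{E}(b_{t_1}-b_{s_1})(b_{t_2}-b_{s_2})=R(s_1,t_1,s_2,t_2)$ for all $s_1,t_1,s_2,t_2\in\mathbb{R}$; its continuous version is always used. Let $\mathcal{E}(\mathbb{R};V)$ be the $V$-valued step functions $f=\sum_{j=1}^nf_j\mathbf{1}_{[t_{j-1},t_j)}$ ($f_j\in V$, $-\infty<t_0<\dots<t_n<\infty$), $i(f):=\sum_jf_j(b_{t_j}-b_{t_{j-1}})$ and $(\mathcal{K}^*f)(r):=\int_r^\infty f(u)\frac{\partial K}{\partial u}(u,r)\,\mathrm{d}u$. Then $\|i(f)\|_{L^2(\Omega;V)}=\|\mathcal{K}^*f\|_{L^2(\mathbb{R};V)}$.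 $\mathcal{D}(\mathbb{R};V)$ is the completion of $\mathcal{E}(\mathbb{R};V)$ under $\langle f,g\rangle_{\mathcal{D}}:=\langle\mathcal{K}^*f,\mathcal{K}^*g\rangle_{L^2(\mathbb{R};V)}$ ($\mathcal{K}^*$ is assumed injective, otherwise one passes to the quotient by $\ker\mathcal{K}^*$), and $i$ is extended to an isometry $\mathcal{D}(\mathbb{R};V)\to L^2(\Omega;V)$, written $\int f\,\mathrm{d}b:=i(f)$. Functions in $L^{\frac{2}{1+2\alpha}}(\mathbb{R};V)$ are viewed as elements of $\mathcal{D}(\mathbb{R};V)$ via the continuous extension of $\mathcal{E}(\mathbb{R};V)\to\mathcal{D}(\mathbb{R};V)$. **Cylindrical processes and integral.** A $U$-cylindrical $\alpha$-regular Volterra process is a collection $B=(B_t,t\in\mathbb{R})$ of bounded linear operators $B_t:U\to L^2(\Omega)$ such that for every $u\in U$, $B(u)=(B_t(u))_t$ is a centred real process with $B_0(u)=0$, and, for some $\alpha$-regular Volterra kernel $K$ with associated $R$, $\mathbb{E}(B_{t_1}(u_1)-B_{s_1}(u_1))(B_{t_2}(u_2)-B_{s_2}(u_2))=R(s_1,t_1,s_2,t_2)\langle u_1,u_2\rangle_U$ for all times and all $u_1,u_2\in U$. $\mathcal{L}_2$ denotes Hilbert–Schmidt operators. For a complete orthonormal basis $\{e_k\}$ of $U$ and an elementary operator $Gu=\sum_{k=1}^{N}g_k\langle u,e_k\rangle_U$ with $g_k\in\mathcal{D}(\mathbb{R};V)$, set $I(G):=\sum_{k=1}^{N}\int g_k\,\mathrm{d}b^{(k)}$,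 $b^{(k)}=B(e_k)$; $I$ extends to a linear isometry $\mathcal{L}_2(U,\mathcal{D}(\mathbb{R};V))\to L^2(\Omega;V)$. A function $G:\mathbb{R}\to\mathcal{L}_2(U,V)$ is identified with the operator $u\mapsto G(\cdot)u$, and $\int_s^tG(r)\,\mathrm{d}B_r:=I(\mathbf{1}_{[s,t)}G)$, which is defined whenever $G\in L^{\frac{2}{1+2\alpha}}(s,t;\mathcal{L}_2(U,V))$. **Increments.** An $\mathbb{R}^d$-valued process $Y=(Y_t,t\in\mathbb{R})$ has stationary increments if for all $n$, all $s_i<t_i$ ($i=1,\dots,n$) and all $h\in\mathbb{R}$ the vectors $(Y_{t_i}-Y_{s_i})_{i=1}^n$ and $(Y_{t_i+h}-Y_{s_i+h})_{i=1}^n$ have the same law; it has reflexive increments if for all $n$ and all $s_i<t_i$ the vectors $(Y_{t_i}-Y_{s_i})_{i=1}^n$ and $(Y_{-s_i}-Y_{-t_i})_{i=1}^n$ have the same law. $B$ has stationary (reflexive) increments if for every $n$ and $u_1,\dots,u_n\in U$ the $\mathbb{R}^n$-valued process $(B(u_1),\dots,B(u_n))$ does. *)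

(* Defs.v *)
From HB Require Import structures.
From mathcomp Require Import all_boot all_order all_algebra.
From mathcomp Require Import all_classical all_reals all_analysis.

Set Implicit Arguments.
Unset Strict Implicit.
Unset Printing Implicit Defensive.

Import Order.TTheory GRing.Theory Num.Theory.
Import numFieldNormedType.Exports.

Local Open Scope classical_set_scope.
Local Open Scope ring_scope.

Notation borel V := (g_sigma_algebraType (@open V)).

Section hilbert.
Context {R : realType}.

(* [V : completeNormedModType R] with [induces_norm ip] is a real Hilbert
   space with inner product [ip]. *)
Definition induces_norm (V : normedModType R) (ip : {dot V for idfun}) :=
  forall v : V, ip v v = `|v| ^+ 2.

Definition separable (V : topologicalType) :=
  exists2 D : set V, countable D & dense D.

(* The basis is [e k] for [k \in J]; the index set [J] is finite when the space
   is finite-dimensional, and [e k] is irrelevant outside [J]. *)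
Definition orthonormal_basis (U : normedModType R) (ip : {dot U for idfun})
    (J : set nat) (e : nat -> U) :=
  (forall i j, J i -> J j -> ip (e i) (e j) = (i == j)%:R) /\
  (forall u, (forall k, J k -> ip u (e k) = 0) -> u = 0).

Definition hs_norm (U V : normedModType R) (J : set nat) (e : nat -> U)
    (L : U -> V) : \bar R :=
  ((\esum_(k in J) (`|L (e k)| ^+ 2)%:E) `^ 2^-1)%E.

Definition c0_semigroup (V : normedModType R) (S : R -> {linear V -> V}) :=
  [/\ forall t, 0 <= t -> continuous (S t),
      forall v, S 0 v = v,
      forall s t v, 0 <= s -> 0 <= t -> S (s + t) v = S s (S t v) &
      forall v, S t v @[t --> 0^'+] --> v].

Definition is_generator (V : normedModType R) (S : R -> {linear V -> V})
    (domA : set V) (A : V -> V) :=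
  forall v w, (domA v /\ A v = w) <->
    h^-1 *: (S h v - v) @[h --> 0^'+] --> w.

(* The norm of L^p(T, mu; V). *)
Definition Vnorm d (T : measurableType d) (mu : {measure set T -> \bar R})
    (V : normedModType R) (p : R) (f : T -> V) : \bar R :=
  'N[mu]_(p%:E)[(fun x => `|f x|%:E)]%E.

Definition inLp d (T : measurableType d) (mu : {measure set T -> \bar R})
    (V : normedModType R) (p : R) (f : T -> V) :=
  measurable_fun setT (f : T -> borel V) /\ (Vnorm mu p f < +oo)%E.

Definition law d (T : measurableType d) (P : probability T R)
    (V : normedModType R) (X : T -> V) : set (borel V) -> \bar R :=
  pushforward P (X : T -> borel V).

Definition weak_cvg (V : normedModType R) (mu : R -> set (borel V) -> \bar R)
    (nu : set (borel V) -> \bar R) :=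
  forall f : V -> R, continuous f -> (exists M, forall v, `|f v| <= M) ->
    (\int[mu t]_v (f v)%:E)%E @[t --> +oo] --> (\int[nu]_v (f v)%:E)%E.

End hilbert.

Section volterra_kernel.
Context {R : realType}.
Implicit Types K : R -> R -> R.

Definition regular_kernel (alpha : R) K :=
  [/\ measurable_fun setT (fun x : R * R => K x.1 x.2),
      forall t r, t < r -> K t r = 0,
      forall r, K t r @[t --> r^'+] --> 0,
      forall r u, r < u -> derivable (K ^~ r) u 1 /\
        {for u, continuous (partial1of2 K ^~ r)} &
      exists2 C, 0 < C & forall r u, r < u ->
        `|partial1of2 K u r| <= C * (u - r) `^ (alpha - 1)].

Definition kernel_cov K (s1 t1 s2 t2 : R) : \bar R :=
  (\int[lebesgue_measure]_r
     ((K t1 r - K s1 r) * (K t2 r - K s2 r))%:E)%E.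

End volterra_kernel.

Section increments.
Context {R : realType} d (Omega : measurableType d) (P : probability Omega R).

Definition same_law d' (T : measurableType d') (X Y : Omega -> T) :=
  forall A, measurable A -> P (X @^-1` A) = P (Y @^-1` A).

Definition increments m (Y : R -> Omega -> m.-tuple R) n (s t : 'I_n -> R)
    (w : Omega) : n.-tuple (m.-tuple R) :=
  [tuple [tuple tnth (Y (t i) w) k - tnth (Y (s i) w) k | k < m] | i < n].

Definition stationary_increments m (Y : R -> Omega -> m.-tuple R) :=
  forall n (s t : 'I_n -> R) (h : R), (forall i, s i < t i) ->
    same_law (increments Y s t)
             (increments Y (fun i => s i + h) (fun i => t i + h)).

Definition reflexive_increments m (Y : R -> Omega -> m.-tuple R) :=
  forall n (s t : 'I_n -> R), (forall i, s i < t i) ->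
    same_law (increments Y s t)
             (increments Y (fun i => - t i) (fun i => - s i)).

End increments.

Section cylindrical_process.
Context {R : realType} d (Omega : measurableType d) (P : probability Omega R).
Context (U : normedModType R) (ip : {dot U for idfun}).
Implicit Types (K : R -> R -> R) (B : R -> U -> Omega -> R).

(* An element of L^2(Omega) is given by a representative, so that linearity of
   [B t] and [B 0 u = 0] hold almost surely. *)
Definition cylindrical_volterra (alpha : R) K B :=
  regular_kernel alpha K /\
  [/\ forall t u, B t u \in Lfun P 2%:E,
      forall t a u v,
        {ae P, forall w, B t (a *: u + v) w = a * B t u w + B t v w},
      forall t, exists C, forall u,
        ('N[P]_(2%:E)[EFin \o B t u] <= (C * `|u|)%:E)%E,
      forall u, (forall t, 'E_P[B t u] = 0)%E /\
        {ae P, forall w, B 0 u w = 0} &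
      forall s1 t1 s2 t2 u1 u2,
        ('E_P[fun w => ((B t1 u1 w - B s1 u1 w) * (B t2 u2 w - B s2 u2 w))%R] =
         kernel_cov K s1 t1 s2 t2 * (ip u1 u2)%:E)%E].

Definition cyl_vec B n (u : 'I_n -> U) (t : R) (w : Omega) : n.-tuple R :=
  [tuple B t (u k) w | k < n].

Definition cyl_stationary B :=
  forall n (u : 'I_n -> U), stationary_increments P (cyl_vec B u).

Definition cyl_reflexive B :=
  forall n (u : 'I_n -> U), reflexive_increments P (cyl_vec B u).

End cylindrical_process.

Section step_functions.
Context {R : realType} (V : normedModType R).

(* The step function sum_(j < n) v_j 1_[t_j, t_(j+1)). *)
Record stepfun := StepFun {
  step_size : nat;
  step_time : nat -> R;
  step_coef : nat -> V;
  step_incr : forall j, (j < step_size)%N -> step_time j < step_time j.+1 }.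

Definition step_val (f : stepfun) (r : R) : V :=
  \sum_(j < step_size f)
    \1_(`[step_time f j, step_time f j.+1[%classic) r *: step_coef f j.

Definition step_int d (Omega : measurableType d) (b : R -> Omega -> R)
    (f : stepfun) (w : Omega) : V :=
  \sum_(j < step_size f)
    (b (step_time f j.+1) w - b (step_time f j) w) *: step_coef f j.

(* (K^* f)(r) = int_r^oo f(u) dK/du(u, r) du; for a step function the V-valued
   integral is a finite combination of scalar ones. *)
Definition Kstar (K : R -> R -> R) (f : stepfun) (r : R) : V :=
  \sum_(j < step_size f)
    (\int[lebesgue_measure]_(u in `[step_time f j, step_time f j.+1[ `&`
        `]r, +oo[) partial1of2 K u r) *: step_coef f j.

Program Definition step0 := @StepFun 0 (fun=> 0) (fun=> 0) _.
Next Obligation. by []. Qed.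

(* The norm of f - g induced by <f, g>_D = <K^* f, K^* g>_(L^2(R; V)), as K^* is
   linear. *)
Definition step_dist (K : R -> R -> R) (f g : stepfun) : \bar R :=
  Vnorm lebesgue_measure 2 (fun r => Kstar K f r - Kstar K g r).

Lemma step_distxx K f : step_dist K f f = 0%E.
Proof.
rewrite /step_dist /Vnorm (_ : (fun x => _) = cst 0%E) ?Lnorm0//.
by apply/funext => r; rewrite subrr normr0.
Qed.

End step_functions.

(* The completion D(R; V) of the step functions, an element being represented by
   a Cauchy sequence; elements at distance 0 are identified, which also accounts
   for the quotient by the kernel of K^* . *)
Section completion.
Context {R : realType} (V : normedModType R) (K : R -> R -> R).

Record Dspace := DSpace {
  Dseq :> nat -> stepfun V;
  Dseq_cauchy : forall eps : R, 0 < eps -> exists N, forall m n,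
    (N <= m)%N -> (N <= n)%N -> (step_dist K (Dseq m) (Dseq n) < eps%:E)%E }.

HB.instance Definition _ := gen_eqMixin Dspace.
HB.instance Definition _ := gen_choiceMixin Dspace.

Definition Ddist (F G : Dspace) : \bar R :=
  limn (fun n => step_dist K (F n) (G n)).

Program Definition Dstep (f : stepfun V) : Dspace := @DSpace (fun=> f) _.
Next Obligation. by exists 0%N => m n _ _; rewrite step_distxx lte_fin. Qed.

Definition D0 : Dspace := Dstep (step0 V).

(* The continuous extension L^p(R; V) -> D(R; V) of the inclusion of the step
   functions. *)
Definition D_of_fun (p : R) (f : R -> V) : Dspace :=
  xget D0 [set F : Dspace | inLp lebesgue_measure p f /\
    exists h : nat -> stepfun V,
      Vnorm lebesgue_measure p (fun r => step_val (h n) r - f r)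
        @[n --> \oo] --> 0%E /\
      Ddist (Dstep (h n)) F @[n --> \oo] --> 0%E].

Context d (Omega : measurableType d) (P : probability Omega R).

(* The continuous extension of [step_int b] to D(R; V). *)
Definition wiener_int (b : R -> Omega -> R) (F : Dspace) : Omega -> V :=
  xget (cst 0) [set X : Omega -> V | inLp P 2 X /\
    exists h : nat -> stepfun V,
      Ddist (Dstep (h n)) F @[n --> \oo] --> 0%E /\
      Vnorm P 2 (fun w => step_int b (h n) w - X w) @[n --> \oo] --> 0%E].

Context (U : normedModType R) (J : set nat) (e : nat -> U).

(* The elementary operator u |-> sum_(k < N) <u, e_k> g_k from U to D(R; V) is
   given by [N] and [g]; it maps e_k to g_k if k < N and to 0 otherwise. *)
Definition elem_int (B : R -> U -> Omega -> R) (N : nat) (g : nat -> Dspace)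
    (w : Omega) : V :=
  \sum_(k < N | (k : nat) \in J) wiener_int (fun t => B t (e k)) (g k) w.

Definition elem_hs_dist (N : nat) (g : nat -> Dspace) (G : U -> Dspace) :
    \bar R :=
  ((\esum_(k in J) (Ddist (if (k < N)%N then g k else D0) (G (e k)) `^ 2))
     `^ 2^-1)%E.

(* The continuous extension of [elem_int B] to L_2(U, D(R; V)). *)
Definition cyl_int (B : R -> U -> Omega -> R) (G : U -> Dspace) : Omega -> V :=
  xget (cst 0) [set X : Omega -> V | inLp P 2 X /\
    exists (N : nat -> nat) (g : nat -> nat -> Dspace),
      elem_hs_dist (N n) (g n) G @[n --> \oo] --> 0%E /\
      Vnorm P 2 (fun w => elem_int B (N n) (g n) w - X w)
        @[n --> \oo] --> 0%E].

End completion.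

(* int_s^t G(r) dB_r *)
Definition stoch_int {R : realType} (U V : normedModType R) (alpha : R)
    (K : R -> R -> R) d (Omega : measurableType d) (P : probability Omega R)
    (J : set nat) (e : nat -> U) (B : R -> U -> Omega -> R) (s t : R)
    (G : R -> U -> V) : Omega -> V :=
  cyl_int P J e B (fun u =>
    D_of_fun K (2 / (1 + 2 * alpha))
      (fun r => \1_(`[s, t[%classic) r *: G r u)).

(* Main.v *)
Require Import Defs.
From HB Require Import structures.
From mathcomp Require Import all_boot all_order all_algebra.
From mathcomp Require Import all_classical all_reals all_analysis.
From mathcomp Require Import measurable_realfun ring lra.

Set Implicit Arguments.
Unset Strict Implicit.
Unset Printing Implicit Defensive.

Import Order.TTheory GRing.Theory Num.Theory.
Import numFieldNormedType.Exports.

Local Open Scope classical_set_scope.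
Local Open Scope ring_scope.

(**
The times are reversed: because the increments are stationary and reflexive, the
increments of [B] over [(s_i, t_i]] and over [(t - t_i, t - s_i]] have the same
joint law, so [X_t = int_0^t S(t - r) Phi dB_r] has the same law as
[Y_t = int_0^t S(r) Phi dB_r]. This is shown on step integrands and passes to the
limit, since both integrals are limits in [L^2(Omega; V)] of integrals of step
functions. The [Y_t] converge in [L^2], hence in law, to
[Y_oo = int_0^oo S(r) Phi dB_r], whose law is the limit.

The bounds in [L^2] come from the isometry of the integral, from the
Hardy-Littlewood-Sobolev inequality [|K^* f|_(L^2) <= C |f|_(L^p)] with
[p = 2 / (1 + 2 alpha)], and from the reverse Minkowski inequality
[sum_k |S(.) Phi e_k|_(L^p)^2 <= | |S(.) Phi|_(L_2(U, V)) |_(L^p)^2], which applies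
as [p < 2].
*)

(** * Hardy-Littlewood-Sobolev inequality *)

(** The integrand of [X_t] slides with [t], so the [X_t] themselves cannot be expected to converge
    in L^2, whereas the integrands of the [Y_t] are nested. Equality of laws is given for finitely
    many increments only; moreover the embedding of L^p into D and both integrals are picked by
    choice among limits, so all that is known of them is that they are limits. The link is therefore
    made on step functions that serve twice: one approximates the integrand of [X_t] along a basis
    vector, its reversal that of [Y_oo]. Closeness is measured in L^p, where reflection is visibly
    an isometry, then carried over to D, where the integral is an isometry. The tail after [t] must
    be small once summed over the basis, uniformly in the number of coordinates kept: this is the
    purpose of the reverse Minkowski inequality. The limit lives on the given probability space, so
    no tightness argument occurs. Two facts shape the definitions: [K] is arbitrary on the diagonal,
    and [S 0 Phi] is not assumed Hilbert-Schmidt, so orbits are cut off at time 0. *)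

Section lebesgue_reflection.
Context {R : realType}.
Local Notation mu := (@lebesgue_measure R).

(** The preimage of ]a, b] is [c - b, c - a[, so the image measure gives half-open intervals their
    length, which characterises Lebesgue measure. *)
Lemma lebesgue_measure_reflection (c : R) (A : set R) : measurable A ->
  pushforward mu ((fun r => c - r) : R -> measurableTypeR R) A = mu A.
Proof.
move=> mA; have mf : measurable_fun [set: R] (fun r : R => c - r : measurableTypeR R).
  by apply: measurable_funD => //; exact: measurableT_comp.
pose g : {mfun R >-> measurableTypeR R} := HB.pack (fun r : R => c - r : measurableTypeR R)
  (isMeasurableFun.Build _ _ _ _ _ mf).
apply/esym; apply: (@lebesgue_measure_unique R (pushforward mu g)) => //= _ [[a b]] _ <-.
rewrite /pushforward /=.
rewrite (_ : _ @^-1` _ = `[c - b, c - a[%classic :> set R); last first.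
  by apply/seteqP; split=> x; rewrite /preimage/= !in_itv/= => /andP[h1 h2]; apply/andP; split; lra.
rewrite !lebesgue_measure_itv/= !lte_fin ltrD2l ltrN2; case: ifPn => // ab.
by rewrite -!EFinB; congr EFin; lra.
Qed.

Lemma ge0_integral_reflection (c : R) (f : R -> \bar R) :
  measurable_fun [set: R] f -> (forall r, 0 <= f r)%E ->
  (\int[mu]_r f (c - r)%R = \int[mu]_r f r)%E.
Proof.
move=> mf f0; have mg : measurable_fun [set: R] (fun r : R => c - r : measurableTypeR R).
  by apply: measurable_funD => //; exact: measurableT_comp.
pose g : {mfun R >-> measurableTypeR R} := HB.pack (fun r : R => c - r : measurableTypeR R)
  (isMeasurableFun.Build _ _ _ _ _ mg).
transitivity (\int[pushforward mu g]_r f r)%E.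
  by rewrite ge0_integral_pushforward.
by apply: eq_measure_integral => //= A mA _; exact: lebesgue_measure_reflection.
Qed.

End lebesgue_reflection.

Section power_integrals.
Context {R : realType}.
Local Notation mu := (@lebesgue_measure R).
Implicit Types a b : R.

Lemma is_derive_powR_div (a x : R) : 0 < x -> a != 0 ->
  derivable (fun x => x `^ a / a) x 1 /\ (fun x => x `^ a / a)^`()%classic x = x `^ (a - 1).
Proof.
move=> x0 a0; have xI : x \in `]0, +oo[ by rewrite in_itv/= x0.
have D := @derivable_powR R 1 a x xI.
rewrite (_ : (fun _ => _) = a^-1 *: (@powR R ^~ a)); last first.
  by apply/funext => y /=; rewrite mulrC.
split; first exact: derivableZ.
rewrite derive1E  deriveZ// -derive1E powR_derive1// /GRing.scale/= mulrA mulVf ?mul1r//.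
Qed.

Lemma continuous_powR (a x : R) : 0 < x -> {for x, continuous (fun x : R => x `^ a)}.
Proof.
move=> x0; apply/differentiable_continuous/derivable1_diffP.
by apply: derivable_powR; rewrite in_itv/= x0.
Qed.

Lemma integral_powR_itvcc (a c d : R) : a != 0 -> 0 < c -> c < d ->
  (\int[mu]_(x in `[c, d]) (x `^ (a - 1))%:E = (d `^ a / a - c `^ a / a)%:E)%E.
Proof.
move=> a0 c0 cd; rewrite EFinB.
have d0 := lt_trans c0 cd.
have dF x : 0 < x -> {for x, continuous (fun x : R => x `^ a / a)}.
  move=> x0; apply/differentiable_continuous/derivable1_diffP.
  by have [] := is_derive_powR_div x0 a0.
rewrite (@continuous_FTC2 _ _ (fun x => x `^ a / a))//.
- apply: continuous_in_subspaceT => x; rewrite inE/= in_itv/= => /andP[cx _].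
  exact/continuous_powR/(lt_le_trans c0).
- split.
  + move=> x; rewrite in_itv/= => /andP[cx _].
    by have [] := is_derive_powR_div (lt_trans c0 cx) a0.
  + exact/cvg_at_right_filter/dF.
  + exact/cvg_at_left_filter/dF.
- move=> x; rewrite in_itv/= => /andP[cx _].
  by have [] := is_derive_powR_div (lt_trans c0 cx) a0.
Qed.

(** The fundamental theorem of calculus must stay away from the singularity at 0: ]0, d] is
    exhausted by closed intervals and monotone convergence concludes. *)
Lemma integral_powR_0d (a d : R) : 0 < a -> 0 < d ->
  (\int[mu]_(x in `]0%R, d]) (x `^ (a - 1))%:E <= (d `^ a / a)%:E)%E.
Proof.
move=> a0 d0.
(* [n.+2] keeps the left endpoint strictly below [d] already for [n = 0], as [integral_powR_itvcc]
   requires. *)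
pose F n := `[d / n.+2%:R, d]%classic : set R.
have Fd n : 0 < d / n.+2%:R by rewrite divr_gt0.
have FU : `]0%R, d]%classic = \bigcup_n F n.
  apply/seteqP; split => x /=; rewrite in_itv/=.
    move=> /andP[x0 xd]; exists (Num.truncn (d / x)) => //; rewrite /F/= in_itv/= xd andbT.
    rewrite ler_pdivrMr// mulrC -ler_pdivrMr//.
    by have /ltW/le_trans := truncnS_gt (d / x); apply; rewrite ler_nat.
  move=> [n _]; rewrite /F/= in_itv/= => /andP[x0 ->]; rewrite andbT.
  exact: lt_le_trans x0.
have mf (D : set R) : measurable_fun D (fun x => (x `^ (a - 1))%:E).
  by apply/measurable_EFinP/measurable_funTS.
have ndF : nondecreasing_seq F.
  move=> m n mn; apply/subsetPset => x; rewrite /F/= !in_itv/= => /andP[mx ->]; rewrite andbT.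
  by rewrite (le_trans _ mx)// ler_pM2l// lef_pV2 ?posrE// ler_nat ltnS.
have H : (\int[mu]_(x in F n) (x `^ (a - 1))%:E @[n --> \oo] -->
    \int[mu]_(x in \bigcup_n F n) (x `^ (a - 1))%:E)%E.
  apply: ge0_nondecreasing_set_cvg_integral => [//|n|n|n x _].
  - exact: measurable_itv.
  - exact: mf.
  - by rewrite lee_fin powR_ge0.
rewrite FU -(cvg_lim _ H)//; apply: lime_le; first exact: cvgP H.
apply: nearW => n; rewrite integral_powR_itvcc ?gt_eqF//; last first.
  by rewrite ltr_pdivrMr// ltr_pMr// ltr1n.
by rewrite lee_fin gerBl// divr_ge0// ?powR_ge0// ltW.
Qed.

Lemma integral_powR_dy (a d : R) : a < 0 -> 0 < d ->
  (\int[mu]_(x in `[d, +oo[) (x `^ (a - 1))%:E = (d `^ a / - a)%:E)%E.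
Proof.
move=> a0 d0; have an0 : a != 0 by rewrite lt_eqF.
have dF x : 0 < x -> {for x, continuous (fun x : R => x `^ a / a)}.
  move=> x0; apply/differentiable_continuous/derivable1_diffP.
  by have [] := is_derive_powR_div x0 an0.
rewrite (@ge0_continuous_FTC2y _ _ (fun x => x `^ a / a) _ 0)//.
- by rewrite sub0e -EFinN invrN mulrN.
- by move=> x _; rewrite powR_ge0.
- apply: continuous_in_subspaceT => x; rewrite inE/= in_itv/= andbT => dx.
  exact/continuous_powR/(lt_le_trans d0).
- rewrite -[X in _ --> X](mul0r a^-1); apply: cvgM; last exact: cvg_cst.
  apply/cvgrPdist_lt => e e0; near=> x.
  rewrite sub0r normrN ger0_norm ?powR_ge0//.
  have x0 : 0 < x by near: x; exact: nbhs_pinfty_gt.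
  have ea : e = (e `^ a^-1) `^ a by rewrite -powRrM mulVf// powRr1// ltW.
  rewrite {}ea -(opprK a) 2!(powRN _ (- a)) opprK ltf_pV2 ?posrE ?powR_gt0//.
  apply: gt0_ltr_powR; rewrite ?oppr_gt0// ?nnegrE ?powR_ge0// ?(ltW x0)//.
- by move=> x dx; have [] := is_derive_powR_div (lt_trans d0 dx) an0.
- exact/cvg_at_right_filter/dF.
- move=> x; rewrite in_itv/= andbT => dx.
  by have [] := is_derive_powR_div (lt_trans d0 dx) an0.
Unshelve. all: by end_near. Qed.

End power_integrals.

Lemma powR_expR {R : realType} (x r : R) : expR x `^ r = expR (r * x).
Proof. by rewrite /powR gt_eqF ?expR_gt0// expRK. Qed.

Lemma measurable_fun_powR d (T : measurableType d) (R : realType) (D : set T) (f : T -> R) (c : R) :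
  measurable_fun D f -> measurable_fun D (fun x => f x `^ c).
Proof.
by move=> mf; apply: (@measurableT_comp _ _ _ _ _ _ (fun x : R => x `^ c)) => //;
  exact: measurable_powR.
Qed.

Section riesz.
Context {R : realType}.
Local Notation mu := (@lebesgue_measure R).
Implicit Types (a : R) (phi : R -> R).

(** The one-sided Riesz kernel. With [a = alpha] and [x = u - r] it is, up to the constant [C], the
    bound on the derivative of the Volterra kernel, extended by 0 to [u <= r]. *)
Definition riesz a (x : R) := if 0 < x then x `^ (a - 1) else 0.

Lemma riesz_ge0 a x : 0 <= riesz a x.
Proof. by rewrite /riesz; case: ifP => // _; exact: powR_ge0. Qed.

Lemma measurable_riesz a : measurable_fun [set: R] (riesz a).
Proof.
apply: measurable_fun_ifT => //.
exact: measurable_fun_ltr.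
Qed.

Lemma ge0_integral_norm_reflection (g : R -> R) (u : R) :
  measurable_fun [set: R] g -> (forall x, 0 <= g x) -> g 0 = 0 ->
  (\int[mu]_v (g `|u - v|)%:E = 2%:E * \int[mu]_(x in `]0%R, +oo[) (g x)%:E)%E.
Proof.
move=> mg g0 g00.
have mgp : measurable_fun [set: R] ((fun x : R => (g x)%:E) \_ `]0%R, +oo[)%E.
  by apply/(measurable_restrictT _ _).1 => //; exact/measurable_EFinP/measurable_funTS.
have gp0 x : (0 <= ((fun x : R => (g x)%:E) \_ `]0%R, +oo[) x)%E.
  by apply: erestrict_ge0 => y _; rewrite lee_fin.
rewrite (@ge0_integral_reflection _ u (fun x => (g `|x|)%:E)); last 2 first.
- by apply/measurable_EFinP/measurableT_comp => //; exact: measurableT_comp.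
- by move=> r; rewrite lee_fin.
rewrite [in RHS]integral_mkcond mule_natl mule2n.
rewrite -[X in (_ = X + _)%E](@ge0_integral_reflection _ 0)// -ge0_integralD//; last first.
  by apply: measurableT_comp => //; apply: measurable_funD => //; exact: measurableT_comp.
apply: eq_integral => x _; rewrite !patchE !mem_setE !in_itv/= !andbT sub0r oppr_gt0.
case: (ltgtP x 0) => [x0|x0|->]; rewrite ?adde0 ?add0e//.
- by rewrite ltr0_norm.
- by rewrite gtr0_norm.
- by rewrite normr0 g00.
Qed.

(** The condition [a != 1] concerns the point [v = u]: a power of 0 with nonzero exponent is 0 by
    convention. *)
Lemma integral_norm_powR_le a (u d : R) : 0 < a -> a != 1 -> 0 < d ->
  (\int[mu]_v (if (`|u - v| <= d)%R then `|u - v| `^ (a - 1) else 0)%:E <=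
    (2 * (d `^ a / a))%:E)%E.
Proof.
move=> a0 a1 d0.
pose g x : R := if x <= d then x `^ (a - 1) else 0.
rewrite (@ge0_integral_norm_reflection g)/g; last 3 first.
- by apply: measurable_fun_ifT => //; exact: measurable_fun_ler.
- by move=> x; case: ifP => // _; exact: powR_ge0.
- by rewrite ltW// powR0// subr_eq0.
rewrite EFinM lee_pmul2l//; apply: le_trans (integral_powR_0d a0 d0).
rewrite integral_mkcond [leRHS]integral_mkcond; apply: ge0_le_integral => //.
- move=> x _; apply: erestrict_ge0 => y _; rewrite lee_fin; case: ifP => // _; exact: powR_ge0.
- apply/(measurable_restrictT _ _).1 => //; apply/measurable_EFinP/measurable_funTS.
  by apply: measurable_fun_ifT => //; exact: measurable_fun_ler.
- by apply/(measurable_restrictT _ _).1 => //; apply/measurable_EFinP/measurable_funTS.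
- move=> x _; rewrite !patchE !mem_setE !in_itv/= andbT.
  by case: ltP => //= x0; case: ifP.
Qed.

Lemma integral_norm_powR_ge (a u d : R) : a < 0 -> 0 < d ->
  (\int[mu]_v (if (d <= `|u - v|)%R then `|u - v| `^ (a - 1) else 0)%:E <=
    (2 * (d `^ a / - a))%:E)%E.
Proof.
move=> a0 d0.
pose g x : R := if d <= x then x `^ (a - 1) else 0.
have mg : measurable_fun [set: R] g.
  by apply: measurable_fun_ifT => //; exact: measurable_fun_ler.
have g0 x : 0 <= g x by rewrite /g; case: ifP => // _; exact: powR_ge0.
rewrite (@ge0_integral_norm_reflection g)//; last by rewrite /g leNgt d0.
rewrite EFinM lee_pmul2l//; rewrite -(integral_powR_dy a0 d0).
rewrite integral_mkcond [leRHS]integral_mkcond; apply: ge0_le_integral => //.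
- by move=> x _; apply: erestrict_ge0 => y _; rewrite lee_fin.
- by apply/(measurable_restrictT _ _).1 => //; apply/measurable_EFinP/measurable_funTS.
- by apply/(measurable_restrictT _ _).1 => //; apply/measurable_EFinP/measurable_funTS.
- move=> x _; rewrite !patchE !mem_setE !in_itv/= !andbT /g.
  have [x0|x0] := ltP 0 x; last by case: ifPn => // _; rewrite lee_fin powR_ge0.
  by case: ifP.
Qed.

Lemma le_integral_restrictD (D1 D2 : set R) (f f1 f2 : R -> R) :
  measurable D1 -> measurable D2 -> measurable_fun [set: R] f ->
  measurable_fun [set: R] f1 -> measurable_fun [set: R] f2 ->
  (forall x, 0 <= f x) -> (forall x, 0 <= f1 x) -> (forall x, 0 <= f2 x) ->
  (forall x, f x <= (f1 \_ D1) x + (f2 \_ D2) x) ->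
  (\int[mu]_x (f x)%:E <= \int[mu]_(x in D1) (f1 x)%:E + \int[mu]_(x in D2) (f2 x)%:E)%E.
Proof.
move=> mD1 mD2 mf mf1 mf2 f0 f10 f20 ff.
rewrite [X in (_ <= X + _)%E]integral_mkcond [X in (_ <= _ + X)%E]integral_mkcond.
have mr (D : set R) (g : R -> R) : measurable D -> measurable_fun [set: R] g ->
    measurable_fun [set: R] ((fun x => (g x)%:E) \_ D)%E.
  move=> mD mg; apply/(measurable_restrictT _ _).1 => //.
  exact/measurable_EFinP/measurable_funTS.
rewrite -ge0_integralD//; last 4 first.
- by move=> x _; apply: erestrict_ge0 => y _; rewrite lee_fin.
- exact: mr.
- by move=> x _; apply: erestrict_ge0 => y _; rewrite lee_fin.
- exact: mr.
apply: ge0_le_integral => //.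
- by move=> x _; rewrite lee_fin.
- exact/measurable_EFinP.
- by apply: emeasurable_funD; exact: mr.
- by move=> x _; have := ff x; rewrite -lee_fin EFinD !patchE; do 2 case: ifP.
Qed.

(** With [d = u - v > 0] and [r = v - x] the integrand is (d + x)^(a-1) x^(a-1) on x > 0. Bounding
    the first factor by d^(a-1) for x <= d gives the term in 1/a; bounding it by x^(a-1) for x > d
    gives the term in 1/(1 - 2a), where integrability at infinity is exactly a < 1/2. *)
Lemma integral_rieszM_le a (u v : R) : 0 < a -> a < 2^-1 -> u != v ->
  (\int[mu]_r (riesz a (u - r) * riesz a (v - r))%:E <=
    ((a^-1 + (1 - 2 * a)^-1) * `|u - v| `^ (2 * a - 1))%:E)%E.
Proof.
move=> a0 ah; wlog uv : u v / v < u.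
  move=> H uv; case: (ltgtP u v) => [lt|lt|e]; last by rewrite e eqxx in uv.
    under eq_integral do rewrite mulrC.
    by rewrite distrC; apply: H => //; rewrite eq_sym.
  exact: H.
move=> _; rewrite gtr0_norm ?subr_gt0//; set d := u - v.
have d0 : 0 < d by rewrite subr_gt0.
have mr w : measurable_fun [set: R] (fun r => riesz a (w + r)).
  by apply: measurableT_comp; [exact: measurable_riesz|exact: measurable_funD].
have mr2 w : measurable_fun [set: R] (fun r => riesz a (w - r)).
  apply: measurableT_comp; first exact: measurable_riesz.
  by apply: measurable_funD => //; exact: measurableT_comp.
rewrite -(@ge0_integral_reflection _ v); last 2 first.
- by apply/measurable_EFinP/measurable_funM.
- by move=> r; rewrite lee_fin mulr_ge0// riesz_ge0.
under eq_integral => x _ do rewrite subKr opprB addrA addrAC -/d.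
apply: le_trans.
  apply: (@le_integral_restrictD `]0, d] `[d, +oo[ _ (fun x => d `^ (a - 1) * x `^ (a - 1))
    (fun x => x `^ ((2 * a - 1) - 1))) => //.
  - by apply: measurable_funM => //; exact: measurable_riesz.
  - exact: measurable_funM.
  - by move=> x; rewrite mulr_ge0// riesz_ge0.
  - by move=> x; rewrite mulr_ge0// powR_ge0.
  - by move=> x; rewrite powR_ge0.
  - move=> x; rewrite !patchE !mem_setE !in_itv/= andbT /riesz.
    (* Outside its domain a restricted function takes the value [point]. *)
    have point0 : (point : R) = 0 by [].
    rewrite !point0 {point0}; have [x0|x0] := ltP 0 x; last by rewrite mulr0 add0r; case: ifP; rewrite ?powR_ge0.
    have dx0 : 0 < d + x by rewrite addr_gt0.
    rewrite dx0; have dec y : 0 < y -> y <= d + x -> (d + x) `^ (a - 1) <= y `^ (a - 1).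
      move=> y0 yd; rewrite -(opprB 1 a) !powRN lef_pV2 ?posrE ?powR_gt0//.
      by apply: ge0_ler_powR; rewrite ?nnegrE//; lra.
    have [xd|dx] := leP x d.
      rewrite -[leLHS]addr0 lerD// ?ler_wpM2r ?powR_ge0//; last by case: ifP; rewrite ?powR_ge0.
      by rewrite dec// lerDl ltW.
    rewrite (ltW dx) add0r (_ : 2 * a - 1 - 1 = (a - 1) + (a - 1)); last by ring.
    rewrite (@powRD _ x (a - 1) (a - 1)) ?(gt_eqF x0) ?implybT//.
    by rewrite ler_wpM2r ?powR_ge0// dec// lerDr ltW.
under eq_integral do rewrite EFinM.
rewrite ge0_integralZl_EFin ?powR_ge0//; last 2 first.
- by move=> x _; rewrite lee_fin powR_ge0.
- exact/measurable_EFinP/measurable_funTS.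
rewrite [in leRHS]mulrDl EFinD; apply: leeD.
  apply: le_trans.
    by apply: lee_wpmul2l; [rewrite lee_fin powR_ge0|exact: integral_powR_0d].
  rewrite -EFinM lee_fin mulrA mulrC -(@powRD _ d (a - 1) a); last first.
    by rewrite (gt_eqF d0) implybT.
  by rewrite (_ : a - 1 + a = 2 * a - 1)//; ring.
rewrite integral_powR_dy//; last by lra.
by rewrite opprB mulrC.
Qed.



(** Up to the factor Gamma(a), the Weyl fractional integral of order [a] of [phi]; for [phi = |f|]
    it dominates the norm of [K^* f]. *)
Definition riesz_potential a phi r : \bar R := (\int[mu]_u (phi u * riesz a (u - r))%:E)%E.

(** The kernel of the quadratic form that sends [phi] to the squared L^2 norm of its potential. *)
Definition riesz_energy a (u v : R) : \bar R :=
  (\int[mu]_r (riesz a (u - r) * riesz a (v - r))%:E)%E.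

Lemma riesz_potential_ge0 a phi r : (forall x, 0 <= phi x) ->
  (0 <= riesz_potential a phi r)%E.
Proof. by move=> p0; apply: integral_ge0 => u _; rewrite lee_fin mulr_ge0// riesz_ge0. Qed.

Lemma riesz_energy_ge0 a u v : (0 <= riesz_energy a u v)%E.
Proof. by apply: integral_ge0 => r _; rewrite lee_fin mulr_ge0// riesz_ge0. Qed.

Lemma measurable_rieszB d (T : measurableType d) a (f g : T -> R) :
  measurable_fun setT f -> measurable_fun setT g ->
  measurable_fun setT (fun x => riesz a (f x - g x)).
Proof.
move=> mf mg; apply: measurableT_comp; first exact: measurable_riesz.
by apply: measurable_funD => //; exact: measurableT_comp.
Qed.

Lemma measurable_riesz_energy a :
  measurable_fun setT (fun z : R * R => riesz_energy a z.1 z.2).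
Proof.
pose f (y : (R * R) * R) := (riesz a (y.1.1 - y.2) * riesz a (y.1.2 - y.2))%:E.
have mf : measurable_fun setT f.
  apply/measurable_EFinP/measurable_funM; apply: measurable_rieszB => //.
  - exact: measurableT_comp measurable_fst measurable_fst.
  - exact: measurableT_comp measurable_snd measurable_fst.
apply: (@measurable_fun_fubini_tonelli_F _ _ _ _ _ mu f mf) => y.
by rewrite lee_fin mulr_ge0// riesz_ge0.
Qed.

(** The square is expanded into an integral over pairs (u, v), and Tonelli's theorem, applied once
    for each variable, moves the integral in [r] innermost. *)
Lemma integral_riesz_potentialM a phi : measurable_fun [set: R] phi -> (forall x, 0 <= phi x) ->
  (\int[mu]_r (riesz_potential a phi r * riesz_potential a phi r) =
   \int[mu]_u \int[mu]_v ((phi u * phi v)%:E * riesz_energy a u v))%E.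
Proof.
move=> mphi phi0.
pose h (r u : R) := phi u * riesz a (u - r).
have h0 r u : 0 <= h r u by rewrite mulr_ge0// riesz_ge0.
have mh r : measurable_fun [set: R] (h r).
  by apply: measurable_funM => //; exact: measurable_rieszB.
pose H (y : (R * R) * R) := (h y.1.1 y.1.2 * h y.1.1 y.2)%:E.
have mH : measurable_fun setT H.
  have m1 : measurable_fun setT (fun y : (R * R) * R => y.1.1).
    exact: measurableT_comp measurable_fst measurable_fst.
  have m2 : measurable_fun setT (fun y : (R * R) * R => y.1.2).
    exact: measurableT_comp measurable_snd measurable_fst.
  apply/measurable_EFinP/measurable_funM; apply: measurable_funM.
  - exact: measurableT_comp m2.
  - exact: measurable_rieszB.
  - exact: measurableT_comp.
  - exact: measurable_rieszB.
have H0 y : (0 <= H y)%E by rewrite lee_fin mulr_ge0.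
pose G (z : R * R) := (\int[mu]_v H (z, v))%E.
have mG : measurable_fun setT G by exact: measurable_fun_fubini_tonelli_F.
have G0 z : (0 <= G z)%E by exact: integral_ge0.
transitivity (\int[mu]_r \int[mu]_u G (r, u))%E.
  apply: eq_integral => r _.
  rewrite -ge0_integralZr//; last 3 first.
  - apply/measurable_EFinP; exact: mh.
  - by move=> u _; rewrite lee_fin; exact: h0.
  - exact: riesz_potential_ge0.
  apply: eq_integral => u _; rewrite -ge0_integralZl_EFin//.
  - by move=> v _; rewrite lee_fin; exact: h0.
  - apply/measurable_EFinP; exact: mh.
  - exact: h0.
rewrite (@fubini_tonelli _ _ _ _ _ mu mu G mG G0).
apply: eq_integral => u _.
pose Hu (z : R * R) := H ((z.1, u), z.2).
have mHu : measurable_fun setT Hu.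
  apply: measurableT_comp => //; apply: measurable_fun_pair => //.
  exact: measurable_fun_pair.
have Hu0 z : (0 <= Hu z)%E by exact: H0.
rewrite (@fubini_tonelli _ _ _ _ _ mu mu Hu mHu Hu0).
apply: eq_integral => v _; rewrite -ge0_integralZl_EFin ?mulr_ge0//.
- by apply: eq_integral => r _; rewrite /Hu/H/h/= -EFinM mulrACA.
- by move=> r _; rewrite lee_fin mulr_ge0// riesz_ge0.
- by apply/measurable_EFinP/measurable_funM; exact: measurable_rieszB.
Qed.

(** One summand alone suffices. If th f >= x^-(1+2a), raise this to the power p - 1 and use (1 +
    2a)(p - 1) = 1 - 2a; otherwise f < x^-(1+2a) / th. The point is that x^-2, unlike x^(2a-1), is
    integrable at infinity. *)
Lemma young_powR a (p x f th : R) : 0 < a -> a < 2^-1 -> p = 2 / (1 + 2 * a) ->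
  0 < x -> 0 <= f -> 0 < th ->
  f * x `^ (2 * a - 1) <= th `^ (p - 1) * f `^ p + th^-1 * x `^ (- 2).
Proof.
move=> a0 ah pE x0 f0 th0.
have d0 : 0 < 1 + 2 * a by lra.
have p0 : 0 < p by rewrite pE divr_gt0.
have p1 : 1 < p by rewrite pE ltr_pdivlMr// mul1r; lra.
have [h|h] := leP (x `^ (- (1 + 2 * a))) (th * f).
  rewrite -[leLHS]addr0 lerD ?mulr_ge0 ?invr_ge0 ?powR_ge0 ?(ltW th0)//.
  rewrite -(@mulr_powRB1 _ f p)// mulrCA -powRM ?(ltW th0)//.
  rewrite ler_wpM2l//.
  rewrite (_ : 2 * a - 1 = - (1 + 2 * a) * (p - 1)); last by rewrite pE; field; rewrite gt_eqF.
  rewrite powRrM ge0_ler_powR ?nnegrE ?powR_ge0 ?mulr_ge0 ?(ltW th0)//; lra.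
rewrite -[leLHS]add0r lerD ?mulr_ge0 ?powR_ge0//.
have -> : x `^ (- 2) = x `^ (- (1 + 2 * a)) * x `^ (2 * a - 1).
  rewrite -powRD; last by rewrite (gt_eqF x0) implybT.
  by congr (_ `^ _); ring.
rewrite mulrA ler_wpM2r ?powR_ge0//.
by rewrite ler_pdivlMl// ltW.
Qed.

Section fixed_exponent.
Variables (a p : R) (phi : R -> R) (A : R).
Hypotheses (a0 : 0 < a) (ah : a < 2^-1) (A0 : 0 < A) (pE : p = 2 / (1 + 2 * a)).
Hypotheses (mphi : measurable_fun [set: R] phi) (phi0 : forall x, 0 <= phi x).
Hypothesis phiA : (\int[mu]_x (phi x `^ p)%:E <= (A `^ p)%:E)%E.

Let d0 : 0 < 1 + 2 * a. Proof. by rewrite addr_gt0// mulr_gt0. Qed.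
Let p0 : 0 < p. Proof. by rewrite pE divr_gt0. Qed.
Let pa : p * (2 * a) = 2 - p. Proof. by rewrite pE; field; rewrite gt_eqF. Qed.

(** Close to [u] the bound phi <= s is used, far from [u] Young's inequality and the L^p bound. The
    right-hand side is such that, for [s = phi u], one more factor phi(u) gives phi(u)^p, which can
    be integrated again. *)
Lemma integral_truncated_le (s u : R) : 0 < s ->
  (\int[mu]_v (if (phi v <= s)%R then phi v * `|u - v| `^ (2 * a - 1) else 0)%:E
    <= ((a^-1 + 3) * (s `^ (p - 1) * A `^ (2 - p)))%:E)%E.
Proof.
move=> s0.
(* The radius and the weight in Young's inequality are chosen so that the three
   contributions below are all multiples of [T]. *)
pose T := s `^ (p - 1) * A `^ (2 - p).
pose dl := (A / s) `^ p; have dl0 : 0 < dl by rewrite powR_gt0// divr_gt0.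
pose th := s / A ^+ 2; have th0 : 0 < th by rewrite divr_gt0// exprn_gt0.
(* In logarithmic coordinates the three identities below become polynomial identities between
   exponents, which [ring] decides. *)
have [[x Ax] [y sy]] : (exists x, A = expR x) /\ (exists y, s = expR y).
  by split; [exists (ln A)|exists (ln s)]; rewrite lnK ?posrE.
have e1 : s * dl `^ (2 * a) = T.
  rewrite /dl -powRrM pa /T Ax sy -expRN -!expRD !powR_expR -!expRD; congr expR; ring.
have e2 : th `^ (p - 1) * A `^ p = T.
  rewrite /th /T Ax sy -expRM_natl -expRN -!expRD !powR_expR -!expRD; congr expR; ring.
have e3 : th^-1 * dl^-1 = T.
  rewrite /th /dl /T Ax sy -expRM_natl -!expRN -!expRD !powR_expR -!expRN -!expRD; congr expR; ring.
have mn : measurable_fun [set: R] (fun v => `|u - v|).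
  by apply: measurableT_comp => //; apply: measurable_funD => //; exact: measurableT_comp.
have mnp (c : R) : measurable_fun [set: R] (fun v => `|u - v| `^ c) by exact: measurable_fun_powR.
pose F1 v := if `|u - v| <= dl then `|u - v| `^ (2 * a - 1) else 0.
pose F2 v := if dl <= `|u - v| then `|u - v| `^ (- 1 - 1) else 0.
have mF1 : measurable_fun [set: R] F1 by apply: measurable_fun_ifT => //; exact: measurable_fun_ler.
have mF2 : measurable_fun [set: R] F2 by apply: measurable_fun_ifT => //; exact: measurable_fun_ler.
have F10 v : 0 <= F1 v by rewrite /F1; case: ifP => // _; exact: powR_ge0.
have F20 v : 0 <= F2 v by rewrite /F2; case: ifP => // _; exact: powR_ge0.
have mpp : measurable_fun [set: R] (fun v => phi v `^ p) by exact: measurable_fun_powR.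
have th' : 0 <= th `^ (p - 1) by exact: powR_ge0.
have thV : 0 <= th^-1 by rewrite invr_ge0 ltW.
apply: (@le_trans _ _ (\int[mu]_v (s%:E * (F1 v)%:E +
    ((th `^ (p - 1))%:E * (phi v `^ p)%:E + (th^-1)%:E * (F2 v)%:E)))%E).
  apply: ge0_le_integral => //.
  - by move=> v _; rewrite lee_fin; case: ifP => // _; rewrite mulr_ge0 ?powR_ge0.
  - apply/measurable_EFinP; apply: measurable_fun_ifT => //; first exact: measurable_fun_ler.
    by apply: measurable_funM; [exact: mphi|exact: mnp].
  - by do 2 ?apply: emeasurable_funD; apply: emeasurable_funM => //; exact/measurable_EFinP.
  - move=> v _; rewrite -!EFinM -!EFinD lee_fin.
    have h0 : 0 <= s * F1 v + (th `^ (p - 1) * phi v `^ p + th^-1 * F2 v).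
      by rewrite !addr_ge0 ?mulr_ge0 ?powR_ge0// ltW.
    case: ifPn => // phis.
    have [le|gt] := leP `|u - v| dl.
      rewrite -[leLHS]addr0 lerD//; last by rewrite addr_ge0 ?mulr_ge0 ?powR_ge0.
      by rewrite /F1 le ler_wpM2r ?powR_ge0.
    rewrite -[leLHS]add0r lerD ?mulr_ge0 ?(ltW s0)// /F2 (ltW gt).
    rewrite (_ : - 1 - 1 = - 2); last by ring.
    exact: (young_powR a0 ah pE (lt_trans dl0 gt)).
rewrite ge0_integralD//; last 4 first.
- by move=> v _; rewrite mule_ge0 ?lee_fin// ltW.
- by apply: emeasurable_funM => //; exact/measurable_EFinP.
- by move=> v _; rewrite adde_ge0 ?mule_ge0 ?lee_fin ?powR_ge0.
- by apply: emeasurable_funD; apply: emeasurable_funM => //; exact/measurable_EFinP.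
rewrite ge0_integralD//; last 4 first.
- by move=> v _; rewrite mule_ge0 ?lee_fin ?powR_ge0.
- by apply: emeasurable_funM => //; exact/measurable_EFinP.
- by move=> v _; rewrite mule_ge0 ?lee_fin.
- by apply: emeasurable_funM => //; exact/measurable_EFinP.
rewrite !ge0_integralZl_EFin//; try by [exact/measurable_EFinP|move=> v _; rewrite lee_fin ?powR_ge0|exact: ltW].
have i1 : (\int[mu]_v (F1 v)%:E <= (2 * (dl `^ (2 * a) / (2 * a)))%:E)%E.
  apply: integral_norm_powR_le => //; first by rewrite mulr_gt0.
  by apply/eqP => h; move: ah; lra.
have i2 : (\int[mu]_v (F2 v)%:E <= (2 * (dl `^ (- 1) / - - 1))%:E)%E.
  by apply: integral_norm_powR_ge => //; rewrite oppr_lt0.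
apply: le_trans.
  apply: leeD; first by apply: lee_wpmul2l i1; rewrite lee_fin ltW.
  by apply: leeD; [apply: lee_wpmul2l phiA|apply: lee_wpmul2l i2]; rewrite lee_fin.
(* The near part contributes T / a, the term in phi^p contributes T and the term in x^-2 contributes
   2 T, whence the constant 1/a + 3. *)
rewrite -!EFinM -!EFinD lee_fin e2 powR_inv1 ?(ltW dl0)//.
rewrite (_ : s * _ = a^-1 * (s * dl `^ (2 * a))); last by field; rewrite gt_eqF.
rewrite e1 (_ : th^-1 * _ = 2 * (th^-1 * dl^-1)); last by rewrite opprK divr1; ring.
by rewrite e3 -/T -subr_ge0 le_eqVlt; apply/orP; left; apply/eqP; ring.
Qed.

(** By the bound on the energy it remains to estimate the double integral of phi(u) phi(v) |u -
    v|^(2a-1). By symmetry, at the cost of a factor 2, only the pairs with phi(v) <= phi(u) count,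
    and for fixed [u] these are covered by [integral_truncated_le] with s = phi(u). *)
Lemma riesz_potential_L2 :
  (\int[mu]_r (riesz_potential a phi r * riesz_potential a phi r) <=
   (2 * (a^-1 + (1 - 2 * a)^-1) * (a^-1 + 3) * A ^+ 2)%:E)%E.
Proof.
set c := a^-1 + _; set c' := a^-1 + 3.
have a2 : 0 < 1 - 2 * a by move: ah; lra.
have c0 : 0 <= c by rewrite addr_ge0// invr_ge0 ltW.
rewrite integral_riesz_potentialM//.
pose W (z : R * R) := phi z.1 * phi z.2 * `|z.1 - z.2| `^ (2 * a - 1).
(* [M] keeps the pairs on which the first point carries the larger value; its mirror image [M']
   covers the others, and both have the same integral by Tonelli's theorem. *)
pose M (z : R * R) := if phi z.2 <= phi z.1 then W z else 0.
have W0 z : 0 <= W z by rewrite !mulr_ge0// powR_ge0.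
have M0 z : 0 <= M z by rewrite /M; case: ifP.
have mphi1 : measurable_fun setT (fun z : R * R => phi z.1) by exact: measurableT_comp.
have mphi2 : measurable_fun setT (fun z : R * R => phi z.2) by exact: measurableT_comp.
have mW : measurable_fun setT W.
  apply: measurable_funM; first exact: measurable_funM.
  apply: measurable_fun_powR; apply: measurableT_comp => //.
  by apply: measurable_funD => //; exact: measurableT_comp.
have mM : measurable_fun setT M.
  by apply: measurable_fun_ifT => //; exact: measurable_fun_ler.
pose M' (z : R * R) := M (z.2, z.1).
have mM' : measurable_fun setT M'.
  by apply: measurableT_comp => //; exact: measurable_fun_pair.
have M'0 z : 0 <= M' z by exact: M0.
have WM z : W z <= M z + M' z.
  rewrite /M' /M /=; have We : W (z.2, z.1) = W z.
    by rewrite /W/= distrC (mulrC (phi z.2)).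
  by rewrite We; case: (leP (phi z.2) (phi z.1)) => [le|/ltW ->]; rewrite ?add0r// lerDl; case: ifP.
have Msec (F : R * R -> R) u : measurable_fun setT F -> measurable_fun [set: R] (fun v => F (u, v)).
  by move=> mF; apply: measurableT_comp => //; exact: pair1_measurable.
have mRE u : measurable_fun [set: R] (riesz_energy a u).
  by apply: measurableT_comp (measurable_riesz_energy a) (pair1_measurable u).
have mE (F : R * R -> R) : measurable_fun setT F -> (forall z, 0 <= F z) ->
    measurable_fun [set: R] (fun u => \int[mu]_v (F (u, v))%:E)%E.
  move=> mF F0; apply: (@measurable_fun_fubini_tonelli_F _ _ _ _ _ mu (EFin \o F)).
    exact/measurable_EFinP.
  by move=> z; rewrite lee_fin.
apply: (@le_trans _ _ (\int[mu]_u \int[mu]_v (c * (M (u, v) + M' (u, v)))%:E)%E).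
  apply: ge0_le_integral => //.
  - move=> u _; apply: integral_ge0 => v _.
    by rewrite mule_ge0// ?lee_fin ?mulr_ge0// riesz_energy_ge0.
  - apply: (@measurable_fun_fubini_tonelli_F _ _ _ _ _ mu
      (fun z : R * R => (phi z.1 * phi z.2)%:E * riesz_energy a z.1 z.2)%E).
      apply: emeasurable_funM; last exact: measurable_riesz_energy.
      exact/measurable_EFinP/measurable_funM.
    by move=> z; rewrite mule_ge0// ?lee_fin ?mulr_ge0// riesz_energy_ge0.
  - apply: (mE (fun z => c * (M z + M' z))).
      by apply: measurable_funM => //; exact: measurable_funD.
    by move=> z; rewrite mulr_ge0// addr_ge0.
  - move=> u _; apply: ae_ge0_le_integral => //.
    + by move=> v _; rewrite mule_ge0// ?lee_fin ?mulr_ge0// riesz_energy_ge0.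
    + apply: emeasurable_funM; first by apply/measurable_EFinP; exact: measurable_funM.
      exact: mRE.
    + by move=> v _; rewrite lee_fin mulr_ge0// addr_ge0.
    + apply/measurable_EFinP; apply: measurable_funM => //.
      by apply: measurable_funD; [exact: (Msec M)|exact: (Msec M')].
    (* The bound on the energy is available for [v] different from [u], that is, off a null set. *)
    + exists [set u]; split; [exact: measurable_set1|exact: lebesgue_measure_set1|].
      move=> v /= /not_implyP[_]; apply: contra_notP => uv.
      apply: le_trans.
        apply: lee_wpmul2l; first by rewrite lee_fin mulr_ge0.
        by apply: integral_rieszM_le => //; apply/eqP => /esym.
      by rewrite -EFinM lee_fin mulrCA ler_wpM2l// -/(W (u, v)).
have Eu (u : R) : (\int[mu]_v (c * (M (u, v) + M' (u, v)))%:E =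
    c%:E * (\int[mu]_v (M (u, v))%:E + \int[mu]_v (M' (u, v))%:E))%E.
  rewrite -ge0_integralD//; last 4 first.
  - by move=> v _; rewrite lee_fin.
  - by apply/measurable_EFinP; exact: (Msec M).
  - by move=> v _; rewrite lee_fin.
  - by apply/measurable_EFinP; exact: (Msec M').
  rewrite -ge0_integralZl_EFin//.
  - by move=> v _; rewrite adde_ge0// lee_fin.
  - by apply: emeasurable_funD; apply/measurable_EFinP; [exact: (Msec M)|exact: (Msec M')].
under eq_integral do rewrite Eu.
have IM F : (forall z : R * R, 0 <= F z) -> forall u : R, (0 <= \int[mu]_v (F (u, v))%:E)%E.
  by move=> F0 u; apply: integral_ge0 => v _; rewrite lee_fin.
rewrite ge0_integralZl_EFin//; last 2 first.
  by move=> u _; rewrite adde_ge0//; exact: IM.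
  by apply: emeasurable_funD; exact: mE.
rewrite ge0_integralD//; last 4 first.
- by move=> u _; exact: IM.
- exact: mE.
- by move=> u _; exact: IM.
- exact: mE.
have IMle : (\int[mu]_u \int[mu]_v (M (u, v))%:E <= (c' * A ^+ 2)%:E)%E.
  apply: (@le_trans _ _ (\int[mu]_u ((c' * A `^ (2 - p))%:E * (phi u `^ p)%:E))%E).
    apply: ge0_le_integral => //.
    - by move=> u _; exact: IM.
    - exact: mE.
    - apply: emeasurable_funM => //; apply/measurable_EFinP; exact: measurable_fun_powR.
    - move=> u _; have [s0|s0] := ltP 0 (phi u); last first.
        rewrite integral0_eq ?mule_ge0// ?lee_fin ?mulr_ge0 ?powR_ge0//.
          by rewrite addr_ge0 ?invr_ge0 ?(ltW a0).
        move=> v _; rewrite /M/W/=; have -> : phi u = 0 by apply/le_anti; rewrite s0 phi0.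
        by rewrite !mul0r if_same.
      have {1}-> : (fun v => (M (u, v))%:E) = (fun v => (phi u)%:E *
          (if (phi v <= phi u)%R then phi v * `|u - v| `^ (2 * a - 1) else 0)%:E)%E.
        by apply/funext => v; rewrite /M/W/= -EFinM; case: ifP; rewrite ?mulr0// mulrA.
      rewrite ge0_integralZl_EFin//; last 2 first.
      + by move=> v _; rewrite lee_fin; case: ifP => // _; rewrite mulr_ge0 ?powR_ge0.
      + apply/measurable_EFinP; apply: measurable_fun_ifT => //; first exact: measurable_fun_ler.
        apply: measurable_funM; first exact: mphi.
        apply: measurable_fun_powR; apply: measurableT_comp => //.
        by apply: measurable_funD => //; exact: measurableT_comp.
      apply: le_trans; first by apply: lee_wpmul2l (integral_truncated_le u s0); rewrite lee_fin.
      rewrite -!EFinM lee_fin -(@mulr_powRB1 _ (phi u) p)// -subr_ge0 le_eqVlt.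
      by apply/orP; left; apply/eqP; rewrite /c'; ring.
  rewrite ge0_integralZl_EFin//; last 3 first.
  - by move=> u _; rewrite lee_fin powR_ge0.
  - by apply/measurable_EFinP; exact: measurable_fun_powR.
  - by rewrite mulr_ge0 ?powR_ge0// addr_ge0 ?invr_ge0 ?(ltW a0).
  apply: le_trans; first apply: lee_wpmul2l phiA.
    by rewrite lee_fin mulr_ge0 ?powR_ge0// addr_ge0 ?invr_ge0 ?(ltW a0).
  rewrite -EFinM -mulrA -powRD; last by rewrite (gt_eqF A0) implybT.
  by rewrite subrK powR_mulrn// ltW.
have IM'le : (\int[mu]_u \int[mu]_v (M' (u, v))%:E <= (c' * A ^+ 2)%:E)%E.
  have mEM' : measurable_fun setT (EFin \o M') by exact/measurable_EFinP.
  have EM'0 z : (0 <= (EFin \o M') z)%E by rewrite lee_fin.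
  apply: le_trans IMle; rewrite le_eqVlt; apply/orP; left; apply/eqP.
  exact: (@fubini_tonelli _ _ _ _ _ mu mu (EFin \o M') mEM' EM'0).
apply: le_trans; first by apply: lee_wpmul2l (leeD IMle IM'le); rewrite lee_fin.
rewrite -EFinD -EFinM lee_fin -subr_ge0 le_eqVlt.
by apply/orP; left; apply/eqP; ring.
Qed.

End fixed_exponent.

End riesz.

(** * Square integrable random vectors *)

Section borel_measurability.
Context {R : realType} d (T : measurableType d) (V : normedModType R).
Implicit Types (f g : T -> V).

Lemma measurable_fun_borelP (W : ptopologicalType) (f : T -> W) :
  (forall O, open O -> measurable (f @^-1` O)) -> measurable_fun setT (f : T -> borel W).
Proof.
move=> fO; apply: (@measurability _ _ _ (borel W) setT f (@open W)) => //.
by move=> _ [A oA <-]; rewrite setTI; exact: fO.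
Qed.

Lemma measurable_fun_borel_open (W : ptopologicalType) (f : T -> W) O :
  measurable_fun setT (f : T -> borel W) -> open O -> measurable (f @^-1` O).
Proof.
move=> mf oO; rewrite -[X in measurable X]setTI; apply: mf => //.
exact: sub_sigma_algebra.
Qed.

Lemma measurable_fun_continuous_comp (W W' : ptopologicalType) (h : W -> W') (f : T -> W) :
  continuous h -> measurable_fun setT (f : T -> borel W) ->
  measurable_fun setT (h \o f : T -> borel W').
Proof.
move=> ch mf; apply: measurable_fun_borelP => O oO.
rewrite comp_preimage; apply: (measurable_fun_borel_open mf).
by apply: open_comp => // x _; exact: ch.
Qed.

Lemma measurable_fun_real_comp (W : ptopologicalType) (h : W -> R) (f : T -> W) :
  continuous h -> measurable_fun setT (f : T -> borel W) ->
  measurable_fun setT (h \o f : T -> R).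
Proof.
move=> ch mf; apply: (@measurability _ _ _ (measurableTypeR R) setT (h \o f) _ (RGenOInfty.measurableE R)) => _ [_ [x ->] <-].
rewrite setTI comp_preimage; apply: (measurable_fun_borel_open mf).
by apply: open_comp => [y _|]; [exact: ch|rewrite set_itvoy; exact: open_gt].
Qed.

Lemma measurable_fun_vnorm f : measurable_fun setT (f : T -> borel V) ->
  measurable_fun setT (fun x => `|f x|).
Proof. by apply: measurable_fun_real_comp; exact: norm_continuous. Qed.

Lemma measurable_fun_scaler (a : T -> R) (v : V) : measurable_fun setT a ->
  measurable_fun setT (fun x => a x *: v : borel V).
Proof.
move=> ma; apply: measurable_fun_borelP => O oO.
rewrite (_ : _ @^-1` _ = a @^-1` ((fun r => r *: v) @^-1` O)) //.
rewrite -[X in measurable X]setTI; apply: ma => //; apply: open_measurable.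
by apply: open_comp => // r _; exact: scalel_continuous.
Qed.

Hypothesis sepV : separable V.

Lemma separable_dense_seq : exists D : nat -> V, forall v e, 0 < e -> exists n, `|v - D n| < e.
Proof.
have [D cD dD] := sepV.
have /countable_injP[i inji] := cD.
pose F n := xget 0 [set v | D v /\ i v = n].
exists F => v e e0.
have [w [vw Dw]] : ball v e `&` D !=set0.
  by apply: dD; [exists v; exact: ballxx|exact: ball_open].
exists (i w); suff -> : F (i w) = w by move: vw; rewrite -ball_normE.
rewrite /F; case: xgetP => [x _ [Dx ix]|/(_ w)]; last by case.
by apply: inji => //; rewrite inE.
Qed.

(** An open set is the countable union of the balls it contains that have a centre [D n] and a
    radius 1/(m + 1). This reduces Borel measurability in [V] to that of real functions, and hence
    to the real theorem for pointwise limits. *)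
Lemma measurable_fun_borel_dist (D : nat -> V) f :
  (forall v e, 0 < e -> exists n, `|v - D n| < e) ->
  (forall n, measurable_fun setT (fun x => `|f x - D n|)) ->
  measurable_fun setT (f : T -> borel V).
Proof.
move=> Dd mf; apply: measurable_fun_borelP => O oO.
pose B n m := [set v : V | `|v - D n| < m.+1%:R^-1].
rewrite (_ : f @^-1` O = \bigcup_n \bigcup_(m in [set m | B n m `<=` O]) f @^-1` B n m).
  apply: bigcupT_measurable => n; apply: bigcup_measurable => m _.
  rewrite (_ : _ @^-1` _ = (fun x => `|f x - D n|) @^-1` `]-oo, m.+1%:R^-1[); last first.
    by apply/seteqP; split => x /=; rewrite /B/= in_itv.
  by rewrite -[X in measurable X]setTI; exact: mf.
apply/seteqP; split => [x Ofx|x [n _ [m Bm fx]]]; last exact: Bm fx.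
have /nbhs_ballP[e e0 eO] : nbhs (f x) O by exact: open_nbhs_nbhs.
pose m := Num.truncn (2 / e).
have m0 : 0 < m.+1%:R^-1 :> R by rewrite invr_gt0.
have me : 2 * m.+1%:R^-1 < e.
  by rewrite ltr_pdivrMr// mulrC -ltr_pdivrMr//; exact: truncnS_gt.
have [n fn] := Dd (f x) _ m0.
exists n => //; exists m => //= v; rewrite /B/= => vn; apply: eO.
rewrite -ball_normE/= -(subrK (D n) (f x)) -addrA (le_lt_trans (ler_normD _ _))//.
by rewrite (lt_trans _ me)// mulr2n mulrDl mul1r ltrD// distrC.
Qed.

Lemma measurable_fun_vnormB f (v : V) : measurable_fun setT (f : T -> borel V) ->
  measurable_fun setT (fun x => `|f x - v|).
Proof.
move=> mf; apply: (@measurable_fun_real_comp _ (fun w => `|w - v|)) => // w.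
by apply: cvg_norm; apply: cvgB; [exact: cvg_id|exact: cvg_cst].
Qed.

Lemma measurable_fun_borel_cvg (f_ : nat -> T -> V) f :
  (forall n, measurable_fun setT (f_ n : T -> borel V)) ->
  (forall x, f_ n x @[n --> \oo] --> f x) ->
  measurable_fun setT (f : T -> borel V).
Proof.
move=> mf cf; have [D Dd] := separable_dense_seq.
apply: (measurable_fun_borel_dist Dd) => n.
apply: (measurable_fun_cvg (fun m => measurable_fun_vnormB (D n) (mf m))) => x _.
by apply: cvg_norm; apply: cvgB => //; exact: cvg_cst.
Qed.

(** Addition is continuous on V x V, but the pair (f, g) is controlled on rectangles only.
    Separability writes the preimage of an open set as a countable union of intersections of
    preimages of balls. *)
Lemma measurable_fun_vectorD f g : measurable_fun setT (f : T -> borel V) ->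
  measurable_fun setT (g : T -> borel V) ->
  measurable_fun setT (fun x => f x + g x : borel V).
Proof.
move=> mf mg; have [D Dd] := separable_dense_seq.
apply: measurable_fun_borelP => O oO.
pose B n m := [set v : V | `|v - D n| < m.+1%:R^-1].
have oB n m : open (B n m).
  rewrite (_ : B n m = ball (D n) m.+1%:R^-1); first exact: ball_open.
  by rewrite -ball_normE; apply/seteqP; split => v /=; rewrite /B/= distrC.
rewrite (_ : _ @^-1` O = \bigcup_n \bigcup_k \bigcup_(m in
    [set m | forall v w, B n m v -> B k m w -> O (v + w)]) (f @^-1` B n m `&` g @^-1` B k m)).
  apply: bigcupT_measurable => n; apply: bigcupT_measurable => k; apply: bigcup_measurable => m _.
  by apply: measurableI; exact: measurable_fun_borel_open.
apply/seteqP; split => [x Ofx|x [n _ [k _ [m Bm [fx gx]]]]]; last exact: Bm.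
have /nbhs_ballP[e e0 eO] : nbhs (f x + g x) O by exact: open_nbhs_nbhs.
(* Four radii: from [f x] and [g x] to the two centres, and from the centres to [v] and [w]. *)
pose m := Num.truncn (4 / e).
have m0 : 0 < m.+1%:R^-1 :> R by rewrite invr_gt0.
have me : 4 * m.+1%:R^-1 < e.
  by rewrite ltr_pdivrMr// mulrC -ltr_pdivrMr//; exact: truncnS_gt.
have [n fn] := Dd (f x) _ m0; have [k gk] := Dd (g x) _ m0.
exists n => //; exists k => //; exists m => //= v w; rewrite /B/= => vn wk; apply: eO.
rewrite -ball_normE/=.
rewrite (_ : _ - _ = (f x - D n) + (g x - D k) + ((D n - v) + (D k - w))); last first.
  by rewrite addrACA !subrKA addrACA opprD.
rewrite (lt_trans _ me)// (_ : 4 = (1 + 1) + (1 + 1)); last by ring.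
rewrite !mulrDl !mul1r (le_lt_trans (ler_normD _ _))//.
by rewrite ltrD// (le_lt_trans (ler_normD _ _))// ltrD// distrC.
Qed.

Lemma measurable_fun_vectorN f : measurable_fun setT (f : T -> borel V) ->
  measurable_fun setT (fun x => - f x : borel V).
Proof. by apply: measurable_fun_continuous_comp; exact: opp_continuous. Qed.

Lemma measurable_fun_vectorB f g : measurable_fun setT (f : T -> borel V) ->
  measurable_fun setT (g : T -> borel V) ->
  measurable_fun setT (fun x => f x - g x : borel V).
Proof. by move=> mf mg; apply: measurable_fun_vectorD => //; exact: measurable_fun_vectorN. Qed.

Lemma measurable_fun_vector_sum I (s : seq I) (P : pred I) (h : I -> T -> V) :
  (forall i, P i -> measurable_fun setT (h i : T -> borel V)) ->
  measurable_fun setT (fun x => \sum_(i <- s | P i) h i x : borel V).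
Proof.
move=> mh; elim: s => [|i s ih].
  by under eq_fun do rewrite big_nil; exact: measurable_cst.
have [Pi|Pi] := boolP (P i); last by under eq_fun do rewrite big_cons (negPf Pi).
under eq_fun do rewrite big_cons Pi; by apply: measurable_fun_vectorD => //; exact: mh.
Qed.

End borel_measurability.

Section Vnorm.
Context {R : realType} d (T : measurableType d) (mu : {measure set T -> \bar R}).

Lemma VnormE (V : normedModType R) p (f : T -> V) : p != 0 ->
  Vnorm mu p f = ((\int[mu]_x (`|f x| `^ p)%:E) `^ p^-1)%E.
Proof.
move=> p0; have E x : (`|(`|f x|)%:E| `^ p)%E = (`|f x| `^ p)%:E.
  by rewrite abse_EFin normr_id poweR_EFin.
rewrite /Vnorm Lnorm.unlock /=; congr (_ `^ _)%E.
by apply: eq_integral => x _; exact: E.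
Qed.

Context (V : normedModType R).
Implicit Types (f g h : T -> V) (p c : R).

Lemma Vnorm_ge0 p f : (0 <= Vnorm mu p f)%E.
Proof. exact: Lnorm_ge0. Qed.

Lemma Vnorm_le p f c : 0 < p -> 0 <= c ->
  (Vnorm mu p f <= c%:E)%E = (\int[mu]_x (`|f x| `^ p)%:E <= (c `^ p)%:E)%E.
Proof.
move=> p0 c0; rewrite VnormE ?gt_eqF//.
set I := (\int[mu]_x _)%E; have I0 : (0 <= I)%E.
  by apply: integral_ge0 => x _; rewrite lee_fin powR_ge0.
have pV : 0 < p^-1 by rewrite invr_gt0.
apply/idP/idP => h.
  have := @gt0_ler_poweR _ p (ltW p0) (I `^ p^-1)%E c%:E.
  rewrite -poweRrM mulVf ?gt_eqF// poweRe1// poweR_EFin; apply => //.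
  by rewrite in_itv/= leey poweR_ge0.
  by rewrite in_itv/= leey lee_fin c0.
have := @gt0_ler_poweR _ p^-1 (ltW pV) I (c `^ p)%:E.
rewrite poweR_EFin -powRrM mulfV ?gt_eqF// powRr1//; apply => //.
by rewrite in_itv/= leey I0.
by rewrite in_itv/= leey lee_fin powR_ge0.
Qed.

Lemma Vnorm2_le f c : 0 <= c ->
  (Vnorm mu 2 f <= c%:E)%E = (\int[mu]_x (`|f x| ^+ 2)%:E <= (c ^+ 2)%:E)%E.
Proof.
move=> c0; rewrite Vnorm_le// powR_mulrn//.
by congr (_ <= _)%E; apply: eq_integral => x _; rewrite powR_mulrn.
Qed.

Lemma eq_Vnorm (W : normedModType R) p (f : T -> V) (g : T -> W) :
  (forall x, `|f x| = `|g x|) -> Vnorm mu p f = Vnorm mu p g.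
Proof. by move=> fg; rewrite /Vnorm; apply: eq_Lnorm => x; rewrite fg. Qed.

Lemma Vnorm0 p : p != 0 -> Vnorm mu p (fun=> 0 : V) = 0%E.
Proof.
by move=> p0; rewrite /Vnorm (_ : (fun=> _) = cst 0%E) ?Lnorm0//; apply/funext => x; rewrite normr0.
Qed.

Lemma le_Vnorm (W : normedModType R) p (f : T -> V) (g : T -> W) : 0 < p ->
  measurable_fun setT (fun x => `|f x|) -> measurable_fun setT (fun x => `|g x|) ->
  (forall x, `|f x| <= `|g x|) -> (Vnorm mu p f <= Vnorm mu p g)%E.
Proof.
move=> p0 mf mg fg; have pn0 : p != 0 by rewrite gt_eqF.
have pV : 0 <= p^-1 by rewrite invr_ge0 ltW.
have I0 (h : T -> R) : ((\int[mu]_x (h x `^ p)%:E)%E \in `[0%E, +oo%E]).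
  by rewrite in_itv/= leey andbT; apply: integral_ge0 => x _; rewrite lee_fin powR_ge0.
rewrite (VnormE f pn0) (VnormE g pn0).
apply: (gt0_ler_poweR pV (I0 _) (I0 _)).
apply: ge0_le_integral; first exact: measurableT.
- by move=> x _; rewrite lee_fin powR_ge0.
- by apply/measurable_EFinP; exact: measurable_fun_powR.
- by apply/measurable_EFinP; exact: measurable_fun_powR.
- by move=> x _; rewrite lee_fin ge0_ler_powR ?nnegrE// ltW.
Qed.

(** The hypothesis is a pointwise bound between norms, so only real functions have to be measurable;
    this form also gives the triangle inequality for the distances between values of [K^*] below. *)
Lemma Vnorm_triangle p f g h : 1 <= p ->
  measurable_fun setT (fun x => `|f x|) -> measurable_fun setT (fun x => `|g x|) ->
  measurable_fun setT (fun x => `|h x|) ->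
  (forall x, `|h x| <= `|f x| + `|g x|) -> (Vnorm mu p h <= Vnorm mu p f + Vnorm mu p g)%E.
Proof.
move=> p1 mf mg mh hfg; have p0 : 0 < p by exact: lt_le_trans p1.
apply: le_trans (minkowski_EFin mu mf mg p1).
pose k := (fun x => `|f x|) \+ (fun x => `|g x|).
rewrite -[leRHS]/('N[mu]_p%:E[EFin \o k])%E.
have -> : ('N[mu]_p%:E[EFin \o k] = Vnorm mu p (k : T -> R^o))%E.
  by rewrite /Vnorm; apply: eq_Lnorm => x /=; rewrite ger0_norm// addr_ge0.
apply: le_Vnorm => //; first exact: measurableT_comp (measurable_funD mf mg).
by move=> x; rewrite /= [leRHS]ger0_norm// addr_ge0.
Qed.

End Vnorm.

Section L2_convergence.
Context {R : realType} d (T : measurableType d) (P : probability T R).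
Context (V : completeNormedModType R) (sepV : separable V).
Implicit Types (f g h : T -> V).

(* A sequence whose squared norms decay like 16^-n in mean decays like 4^-n
   almost surely. *)
Lemma ae_le_geometric (D : nat -> T -> V) :
  (forall n, measurable_fun setT (fun x => `|D n x|)) ->
  (forall n, (\int[P]_x (`|D n x| ^+ 2)%:E <= (16^-1 ^+ n)%:E)%E) ->
  {ae P, forall x, exists M : R, forall n, `|D n x| <= M * 2^-1 ^+ n}.
Proof.
move=> mD D16.
(* The sum of the [h n] has mean at most the sum of the 4^-n, hence is finite almost surely, and the
   square root of its value serves as [M]. *)
pose h n x := (4 ^+ n * `|D n x| ^+ 2)%:E : \bar R.
have mh n : measurable_fun setT (h n).
  by apply/measurable_EFinP; apply: measurable_funM => //; exact: measurable_funX.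
have h0 n x : (0 <= h n x)%E by rewrite lee_fin mulr_ge0.
pose S x := (\sum_(n <oo) h n x)%E.
have S0 x : (0 <= S x)%E by apply: nneseries_ge0.
have mS : measurable_fun setT S by apply: ge0_emeasurable_sum.
have iS : P.-integrable setT S.
  apply/integrableP; split => //.
  under eq_integral do rewrite gee0_abs//.
  rewrite integral_nneseries//.
  apply: (@le_lt_trans _ _ (\sum_(n <oo) (4^-1 ^+ n)%:E)%E).
    apply: lee_nneseries => [n _ _|n _].
      exact: integral_ge0.
    rewrite /h; under eq_integral do rewrite EFinM.
    rewrite ge0_integralZl_EFin ?exprn_ge0//; last first.
      by apply/measurable_EFinP; exact: measurable_funX.
    apply: le_trans; first by apply: lee_wpmul2l (D16 n); rewrite lee_fin exprn_ge0.
    by rewrite -EFinM lee_fin -exprMn (_ : 4 * 16^-1 = 4^-1 :> R)//; field.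
  have := @cvg_geometric_series R 1 4^-1.
  rewrite ger0_norm// => /(_ _) cg.
  rewrite (_ : (\sum_(n <oo) _)%E = (1 * (1 - 4^-1)^-1)%:E) ?ltry//.
  apply/cvg_lim => //.
  rewrite (_ : (fun n => _) = EFin \o series (geometric 1 4^-1)); last first.
    apply/funext => n /=; rewrite sumEFin; congr EFin.
    by rewrite /series/=; apply: eq_bigr => i _; rewrite mul1r.
  by apply: cvg_EFin; [exact: nearW|apply: cg; lra].
apply: filterS (integrable_ae measurableT iS) => x /(_ Logic.I) Sfin.
exists (Num.sqrt (fine (S x))) => n.
have hS : (h n x <= S x)%E.
  apply: le_trans (nneseries_lim_ge n.+1 (fun k _ _ => h0 k x)).
  by rewrite big_nat_recr//= leeDr// sume_ge0.
have Sx0 : 0 <= fine (S x) by rewrite fine_ge0.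
rewrite -(@ler_pXn2r _ 2)// ?nnegrE ?mulr_ge0 ?sqrtr_ge0 ?exprn_ge0//.
rewrite exprMn sqr_sqrtr// -exprM mulnC exprM (_ : 2^-1 ^+ 2 = 4^-1 :> R); last by field.
rewrite exprVn ler_pdivlMr ?exprn_gt0// mulrC.
by rewrite -lee_fin fineK.
Qed.

Lemma ae_cvg_geometric (D : nat -> T -> V) :
  (forall n, measurable_fun setT (fun x => `|D n x|)) ->
  (forall n, (\int[P]_x (`|D n x| ^+ 2)%:E <= (16^-1 ^+ n)%:E)%E) ->
  {ae P, forall x, D n x @[n --> \oo] --> (0 : V)}.
Proof.
move=> mD D16; apply: filterS (ae_le_geometric mD D16) => x [M DM].
apply: norm_cvg0; apply: (squeeze_cvgr (f := fun=> 0) (h := geometric M 2^-1)).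
- by apply: nearW => n; rewrite normr_ge0/= DM.
- exact: cvg_cst.
- by apply: cvg_geometric; rewrite ger0_norm//; lra.
Qed.

Lemma ae_is_cvg_geometric (X : nat -> T -> V) :
  (forall n, measurable_fun setT (X n : T -> borel V)) ->
  (forall n, (\int[P]_x (`|X n.+1 x - X n x| ^+ 2)%:E <= (16^-1 ^+ n)%:E)%E) ->
  {ae P, forall x, cvgn (X ^~ x)}.
Proof.
move=> mX X16.
have mD n : measurable_fun setT (fun x => `|X n.+1 x - X n x|).
  by apply: measurable_fun_vnorm; exact: measurable_fun_vectorB.
apply: filterS (ae_le_geometric mD X16) => x [M DM].
have cs : cvgn (series (fun n => X n.+1 x - X n x)).
  apply: normed_cvg; apply: (@series_le_cvg _ _ (geometric M 2^-1)) => [n|n|n|].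
  - exact: normr_ge0.
  - exact: le_trans (normr_ge0 _) (DM n).
  - exact: DM.
  by apply: is_cvg_geometric_series; rewrite ger0_norm//; lra.
have -> : X ^~ x = (fun n => X 0%N x + series (fun n => X n.+1 x - X n x) n).
  apply/funext => n; rewrite /series/= telescope_sumr//.
  by rewrite addrC subrK.
by apply: is_cvgD => //; exact: is_cvg_cst.
Qed.


(** The Riesz-Fischer argument: a subsequence with increments at most 4^-k converges almost surely
    because [V] is complete, and Fatou's lemma along it turns the Cauchy bound into a bound on the
    distance to the limit. *)
Lemma L2_complete (X : nat -> T -> V) :
  (forall n, inLp P 2 (X n)) ->
  (forall e, 0 < e -> exists N, forall m n, (N <= m)%N -> (N <= n)%N ->
    (Vnorm P 2 (fun w => X m w - X n w)%R <= e%:E)%E) ->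
  exists Y, inLp P 2 Y /\
    (forall e, 0 < e -> exists N, forall n, (N <= n)%N ->
      (Vnorm P 2 (fun w => X n w - Y w)%R <= e%:E)%E).
Proof.
move=> LX CX.
have mX n := (LX n).1.
have /choice[N0 HN0] : forall k : nat, exists N, forall m n, (N <= m)%N -> (N <= n)%N ->
    (Vnorm P 2 (fun w => X m w - X n w)%R <= (4^-1 ^+ k)%:E)%E.
  by move=> k; apply: CX; rewrite exprn_gt0.
(* The summation makes the ranks strictly increasing while keeping [phi k] above [N0 k]. *)
pose phi k := (\sum_(i < k.+1) (N0 i + 1))%N.
have phiS k : (phi k < phi k.+1)%N by rewrite /phi [in X in (_ < X)%N]big_ord_recr/= addn1 -addSnnS ltn_addr.
have phiN k : (N0 k <= phi k)%N by rewrite /phi big_ord_recr/= addnCA leq_addr.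
have phik k : (k <= phi k)%N.
  by elim: k => // k ih; exact: leq_ltn_trans ih (phiS k).
have mXB m n : measurable_fun setT (fun x => `|X m x - X n x|).
  by apply: measurable_fun_vnorm; exact: measurable_fun_vectorB.
have [N [mN PN cN]] : {ae P, forall x, cvgn ((fun k => X (phi k)) ^~ x)}.
  apply: ae_is_cvg_geometric => // k.
  have := HN0 k (phi k.+1) (phi k) (leq_trans (phiN k) (ltnW (phiS k))) (phiN k).
  rewrite Vnorm2_le ?exprn_ge0// => /le_trans; apply.
  by rewrite lee_fin -exprM mulnC exprM (_ : 4^-1 ^+ 2 = 16^-1 :> R)//; field.
(* The subsequence is set to 0 on the exceptional null set, so that it converges everywhere and its
   limit is Borel measurable. *)
pose Z k x := if x \in N then 0 else X (phi k) x.
have cZ x : cvgn (Z ^~ x).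
  have [xN|xN] := boolP (x \in N).
    by rewrite (_ : Z ^~ x = fun=> 0); [exact: is_cvg_cst|apply/funext => k; rewrite /Z xN].
  rewrite (_ : Z ^~ x = fun k => X (phi k) x); last by apply/funext => k; rewrite /Z (negPf xN).
  by apply: contrapT => nc; move/negP: xN; apply; rewrite inE; exact: cN.
have mZ k : measurable_fun setT (Z k : T -> borel V).
  apply: measurable_fun_ifT; [|exact: measurable_cst|exact: mX].
  apply: (measurable_fun_bool true); rewrite setTI.
  by rewrite (_ : _ @^-1` _ = N)//; apply/seteqP; split => x xN; [exact: set_mem|exact: mem_set].
pose Y x := lim (Z n x @[n --> \oo]).
have mY : measurable_fun setT (Y : T -> borel V).
  by apply: (measurable_fun_borel_cvg sepV mZ) => x; exact: cZ.
have mXY n : measurable_fun setT (fun x => `|X n x - Y x|).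
  by apply: measurable_fun_vnorm; exact: measurable_fun_vectorB.
have XY e : 0 < e -> exists N, forall n, (N <= n)%N ->
    (Vnorm P 2 (fun w => X n w - Y w)%R <= e%:E)%E.
  move=> e0; have [M HM] := CX e e0; exists M => n Mn.
  rewrite Vnorm2_le ?(ltW e0)//.
  have fZ k : measurable_fun setT (fun x => (`|X n x - Z k x| ^+ 2)%:E).
    apply/measurable_EFinP; apply: measurable_funX; apply: measurable_fun_vnorm.
    exact: measurable_fun_vectorB.
  have einfE x : limn_einf (fun k => (`|X n x - Z k x| ^+ 2)%:E) = (`|X n x - Y x| ^+ 2)%:E.
    apply: (cvg_limn_einf_sup _).1; apply: cvg_EFin; first exact: nearW.
    rewrite expr2; under eq_cvg do rewrite /= expr2.
    by apply: cvgM; apply: cvg_norm; apply: cvgB; [exact: cvg_cst|exact: cZ|exact: cvg_cst|exact: cZ].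
  apply: (@le_trans _ _ (\int[P]_x limn_einf (fun k => (`|X n x - Z k x| ^+ 2)%:E))%E).
    apply: ge0_le_integral => //.
    - by apply/measurable_EFinP; exact: measurable_funX.
    - rewrite (_ : (fun x => limn_einf _) = (fun x => (`|X n x - Y x| ^+ 2)%:E)).
        by apply/measurable_EFinP; exact: measurable_funX.
      by apply/funext => x; exact: einfE.
    - by move=> x _; rewrite einfE.
  apply: le_trans; first by apply: fatou => // k x _; rewrite lee_fin exprn_ge0.
  rewrite limn_einf_lim; apply: lime_le; first exact: is_cvg_einfs.
  (* The infimum over the ranks from [k] on is at most its term of rank [j], which lies past [M],
     where the Cauchy bound holds. *)
  apply: nearW => k; pose j := maxn M k.
  apply: (@le_trans _ _ (\int[P]_x (`|X n x - Z j x| ^+ 2)%:E)%E).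
    by apply: ereal_inf_lbound; exists j => //=; rewrite leq_maxr.
  apply: (@le_trans _ _ (\int[P]_x (`|X n x - X (phi j) x| ^+ 2)%:E)%E); last first.
    by rewrite -Vnorm2_le ?(ltW e0)// HM// (leq_trans _ (phik j))// leq_maxl.
  apply: ae_ge0_le_integral => //.
  - by apply/measurable_EFinP; exact: measurable_funX.
  - exists N; split => // x /= /not_implyP[_]; apply: contra_notP => xN.
    by rewrite /Z memNset.
have [N1 HN1] := XY 1 ltr01.
exists Y; split => //; split => //.
apply: (@le_lt_trans _ _ (Vnorm P 2 (X N1) + Vnorm P 2 (fun w => X N1 w - Y w)%R)%E).
  apply: Vnorm_triangle => //.
  - by rewrite ler1n.
  - exact: measurable_fun_vnorm.
  - exact: measurable_fun_vnorm.
  - by move=> x; rewrite -{1}(subKr (X N1 x) (Y x)) ler_normB.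
rewrite lte_add_pinfty//; first exact: (LX N1).2.
by apply: le_lt_trans (HN1 N1 (leqnn _)) _; rewrite ltry.
Qed.

(** If no [dl] worked, there would be variables within 4^-n of [Y] with a gap larger than [e]; they
    converge to [Y] almost surely, and dominated convergence with the constant [M] contradicts the
    gap. As [dl] does not depend on [Z], it can be fixed before the approximation is built. *)
Lemma L2_cvg_expectation (f : V -> R) (Y : T -> V) (M : R) : continuous f ->
  (forall v, `|f v| <= M) -> measurable_fun setT (Y : T -> borel V) ->
  forall e : R, 0 < e -> exists2 dl : R, 0 < dl & forall Z, measurable_fun setT (Z : T -> borel V) ->
    (Vnorm P 2 (fun w => Z w - Y w)%R <= dl%:E)%E ->
    `|\int[P]_w (f (Z w)) - \int[P]_w (f (Y w))| <= e.
Proof.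
move=> cf fM mY e e0; apply: contrapT => H.
have {}H n : exists Z : T -> V, [/\ measurable_fun setT (Z : T -> borel V),
    (Vnorm P 2 (fun w => Z w - Y w)%R <= (4^-1 ^+ n)%:E)%E &
    e < `|\int[P]_w (f (Z w)) - \int[P]_w (f (Y w))|].
  apply: contrapT => nZ; apply: H; exists (4^-1 ^+ n); first by rewrite exprn_gt0.
  move=> Z mZ ZY; rewrite leNgt; apply/negP => lt; apply: nZ; by exists Z.
have {H}[Z HZ] := choice H.
have mZ n : measurable_fun setT (Z n : T -> borel V) by have [] := HZ n.
have Zae : {ae P, forall x, (Z n x - Y x) @[n --> \oo] --> (0 : V)}.
  apply: (ae_cvg_geometric (D := fun n x => Z n x - Y x)) => n.
    by apply: measurable_fun_vnorm; exact: measurable_fun_vectorB.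
  have [_ + _] := HZ n; rewrite Vnorm2_le ?exprn_ge0// => /le_trans; apply.
  by rewrite lee_fin -exprM mulnC exprM (_ : 4^-1 ^+ 2 = 16^-1 :> R)//; field.
have mfZ (W : T -> V) : measurable_fun setT (W : T -> borel V) ->
    measurable_fun setT (fun w => (f (W w))%:E).
  by move=> mW; apply/measurable_EFinP; exact: measurable_fun_real_comp cf mW.
have intM : P.-integrable setT (cst M%:E).
  by apply: finite_measure_integrable_cst.
have cvgE : (\int[P]_x (f (Z n x))%:E @[n --> \oo] --> \int[P]_x (f (Y x))%:E)%E.
  have [] // := @dominated_convergence _ _ _ P setT measurableT
    (fun n x => (f (Z n x))%:E) (fun x => (f (Y x))%:E) (cst M%:E).
  - by move=> n; exact: mfZ.
  - exact: mfZ.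
  - apply: filterS Zae => x cx _; apply: cvg_EFin; first exact: nearW.
    apply: (continuous_cvg _ (cf (Y x))).
    rewrite (_ : Z ^~ x = fun n => (Z n x - Y x) + Y x); last first.
      by apply/funext => n; rewrite subrK.
    by rewrite -[X in _ --> X]add0r; apply: cvgD => //; exact: cvg_cst.
  - by apply: aeW => x n _; rewrite lee_fin.
have iW (W : T -> V) : measurable_fun setT (W : T -> borel V) ->
    (\int[P]_w (f (W w))%:E)%E \is a fin_num.
  move=> mW; apply: integrable_fin_num => //.
  apply: le_integrable intM => //; first exact: mfZ.
  by move=> x _; rewrite lee_fin/= (le_trans (fM _))// ler_norm.
have /fine_cvgP[_ /cvgrPdist_lt /(_ e e0)[N _ HN]] : 
    (\int[P]_x (f (Z n x))%:E @[n --> \oo] --> (fine (\int[P]_x (f (Y x))%:E))%:E)%E.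
  by rewrite fineK//; exact: iW.
have := HN N (leqnn N); rewrite /= distrC => /(lt_trans _).
by have [_ _ lt] := HZ N => /(_ _ lt); rewrite ltxx.
Qed.

End L2_convergence.

(** * Isometry for step functions *)

Section inner_product.
Context {R : realType} (V : normedModType R) (ip : {dot V for idfun}).
Hypothesis hV : induces_norm ip.

Lemma dotC u v : ip u v = ip v u.
Proof. by rewrite hermC expr0 mul1r. Qed.

Lemma dot_suml I (s : seq I) (P : pred I) (c : I -> R) (f : I -> V) (w : V) :
  ip (\sum_(i <- s | P i) c i *: f i) w = \sum_(i <- s | P i) c i * ip (f i) w.
Proof. by rewrite linear_sumlz; apply: eq_bigr => i _; rewrite linearZl. Qed.

Lemma dot_sumr I (s : seq I) (P : pred I) (c : I -> R) (f : I -> V) (w : V) :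
  ip w (\sum_(i <- s | P i) c i *: f i) = \sum_(i <- s | P i) c i * ip w (f i).
Proof. by rewrite dotC dot_suml; apply: eq_bigr => i _; rewrite dotC. Qed.

Lemma dot_le_norm u v : `|ip u v| <= `|u| * `|v|.
Proof.
have [->|v0] := eqVneq v 0; first by rewrite linear0r normr0 normr0 mulr0.
have vv : 0 < `|v| ^+ 2 by rewrite exprn_gt0// normr_gt0.
(* A multiple of the component of [u] orthogonal to [v], scaled to avoid division. *)
pose w := `|v| ^+ 2 *: u - ip u v *: v.
have ww : ip w w = `|v| ^+ 2 * ((`|u| * `|v|) ^+ 2 - ip u v ^+ 2).
  set X := RHS; rewrite /w linearBl !linearBr !linearZl !linearZr/= !hV (dotC v u).
  by rewrite /X; ring.
have : 0 <= `|w| ^+ 2 by rewrite exprn_ge0.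
rewrite -hV ww pmulr_rge0// subr_ge0 => h.
rewrite -(@ler_pXn2r _ 2)// ?nnegrE ?mulr_ge0//.
by rewrite (le_trans _ h)// real_normK// num_real.
Qed.

End inner_product.

Section integrable_sums.
Context d (T : measurableType d) (R : realType) (mu : {measure set T -> \bar R}).
Implicit Types (f g : T -> R).

Lemma integrable_Rsum I (s : seq I) (D : set T) (h : I -> T -> R) : measurable D ->
  (forall i, mu.-integrable D (EFin \o h i)) ->
  mu.-integrable D (EFin \o (fun x => \sum_(i <- s) h i x)).
Proof.
move=> mD ih; rewrite (_ : EFin \o _ = fun x => \sum_(i <- s) (EFin \o h i) x)%E.
  exact: integrable_sum.
by apply/funext => x /=; rewrite sumEFin.
Qed.

Lemma Rintegral_sum I (s : seq I) (D : set T) (h : I -> T -> R) : measurable D ->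
  (forall i, mu.-integrable D (EFin \o h i)) ->
  \int[mu]_(x in D) (\sum_(i <- s) h i x) = \sum_(i <- s) \int[mu]_(x in D) h i x.
Proof.
move=> mD ih; elim: s => [|i s IH].
  under eq_Rintegral do rewrite big_nil.
  by rewrite big_nil Rintegral_cst// mul0r.
under eq_Rintegral do rewrite big_cons.
by rewrite big_cons RintegralD// ?IH//; exact: integrable_Rsum.
Qed.

Definition sq_integrable f :=
  measurable_fun setT f /\ mu.-integrable setT (fun x => (f x ^+ 2)%:E).

Lemma sq_integrableB f g : sq_integrable f -> sq_integrable g ->
  sq_integrable (fun x => f x - g x).
Proof.
move=> [mf i_f] [mg ig]; split; first exact: measurable_funB.
apply: (@le_integrable _ _ _ mu setT measurableT _
  (fun x => 2%:E * (f x ^+ 2)%:E + 2%:E * (g x ^+ 2)%:E)%E).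
- by apply/measurable_EFinP; apply: measurable_funX; exact: measurable_funB.
- move=> x _; rewrite -!EFinM -EFinD lee_fin (ger0_norm (sqr_ge0 _)) ger0_norm; last first.
    by have := sqr_ge0 (f x); have := sqr_ge0 (g x); lra.
  rewrite -subr_ge0 (_ : _ - _ = (f x + g x) ^+ 2) ?sqr_ge0//; ring.
- by apply: integrableD => //; exact: integrableZl.
Qed.

Lemma integrable_sqM f g : sq_integrable f -> sq_integrable g ->
  mu.-integrable setT (fun x => (f x * g x)%:E).
Proof.
move=> [mf i_f] [mg ig].
apply: (@le_integrable _ _ _ mu setT measurableT _ (fun x => (f x ^+ 2)%:E + (g x ^+ 2)%:E)%E).
- by apply/measurable_EFinP; exact: measurable_funM.
- move=> x _; rewrite -!EFinD lee_fin normrM [leRHS]ger0_norm ?addr_ge0 ?sqr_ge0//.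
  have h : 0 <= (`|f x| - `|g x|) ^+ 2 by exact: sqr_ge0.
  have hm : 0 <= `|f x| * `|g x| by rewrite mulr_ge0.
  have : (`|f x| - `|g x|) ^+ 2 = f x ^+ 2 + g x ^+ 2 - 2 * (`|f x| * `|g x|).
    by rewrite -(real_normK (num_real (f x))) -(real_normK (num_real (g x))); ring.
  lra.
- exact: integrableD.
Qed.

End integrable_sums.

(** * The Volterra kernel and the operator K^* on step functions *)

Section kernel.
Context {R : realType}.
Local Notation mu := (@lebesgue_measure R).
Variables (alpha : R) (K : R -> R -> R) (C : R).
Hypotheses (alpha0 : 0 < alpha) (alpha_half : alpha < 2^-1) (regK : regular_kernel alpha K).
Hypothesis C0 : 0 < C.
Hypothesis KC : forall r u, r < u -> `|partial1of2 K u r| <= C * (u - r) `^ (alpha - 1).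

(* The values of [K] on the diagonal are arbitrary; they are set to [0] here. *)
Definition offdiag (t r : R) := if r < t then K t r else 0.

Lemma measurable_offdiag t : measurable_fun [set: R] (offdiag t).
Proof.
have [mK _ _ _ _] := regK.
apply: measurable_fun_ifT; [exact: measurable_fun_ltr| |exact: measurable_cst].
by apply: measurableT_comp mK (pair1_measurable t).
Qed.

Lemma measurable_partial1 r : measurable_fun (`]r, +oo[%classic : set R) (partial1of2 K ^~ r).
Proof.
have [_ _ _ dK _] := regK.
apply: open_continuous_measurable_fun => // u; rewrite inE/= in_itv/= andbT => ru.
by have [] := dK r u ru.
Qed.

Lemma ge0_integral_translation (c : R) (f : R -> \bar R) :
  measurable_fun [set: R] f -> (forall r, 0 <= f r)%E ->
  (\int[mu]_r f (r + c)%R = \int[mu]_r f r)%E.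
Proof.
move=> mf f0; pose g r := f (- r).
have mg : measurable_fun [set: R] g by exact: measurableT_comp.
have g0 r : (0 <= g r)%E by exact: f0.
transitivity (\int[mu]_r g (- c - r)%R)%E.
  by apply: eq_integral => r _; rewrite /g opprB opprK.
rewrite (ge0_integral_reflection (- c) mg g0) -(ge0_integral_reflection 0 mf f0).
by apply: eq_integral => r _; rewrite /g sub0r.
Qed.

Lemma integral_riesz_le (r x : R) : r < x ->
  (\int[mu]_(u in `]r, x]) (riesz alpha (u - r))%:E <= ((x - r) `^ alpha / alpha)%:E)%E.
Proof.
move=> rx; apply: le_trans (integral_powR_0d alpha0 _); last by rewrite subr_gt0.
rewrite integral_mkcond [leRHS]integral_mkcond.
pose f := ((fun u => (u `^ (alpha - 1))%:E) \_ `]0%R, (x - r)%R])%E : R -> \bar R.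
have mf : measurable_fun [set: R] f.
  by apply/(measurable_restrictT _ _).1 => //; apply/measurable_EFinP/measurable_funTS.
have f0 u : (0 <= f u)%E by apply: erestrict_ge0 => y _; rewrite lee_fin powR_ge0.
rewrite -/f -(ge0_integral_translation (- r) mf f0) le_eqVlt; apply/orP; left; apply/eqP.
apply: eq_integral => u _; rewrite /f !patchE !mem_setE !in_itv/= subr_gt0 lerD2r /riesz subr_gt0.
by case: ifP => // /andP[-> _].
Qed.

Lemma measurable_partial1_itv r x : measurable_fun (`]r, x]%classic : set R) (partial1of2 K ^~ r).
Proof.
apply: measurable_funS; last exact: (@measurable_partial1 r); first exact: measurable_itv.
move=> u /=.
by rewrite !in_itv/= andbT => /andP[].
Qed.

Lemma integral_norm_partial1_le r x : r < x ->
  (\int[mu]_(u in `]r, x]) `|partial1of2 K u r|%:E <= (C * ((x - r) `^ alpha / alpha))%:E)%E.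
Proof.
move=> rx; have mR (D : set R) : measurable_fun D (fun u => riesz alpha (u - r)).
  by apply: measurable_funTS; exact: measurable_rieszB.
have mCR (D : set R) : measurable_fun D (fun u => (C%:E * (riesz alpha (u - r))%:E)%E).
  by apply/measurable_EFinP; apply: measurable_funM.
have mp := @measurable_partial1_itv r x.
have mnp : measurable_fun (`]r, x]%classic : set R) (fun u => (`|partial1of2 K u r|)%:E).
  by apply/measurable_EFinP; exact: measurableT_comp.
apply: (@le_trans _ _ (\int[mu]_(u in `]r, x]) (C%:E * (riesz alpha (u - r))%:E))%E).
  apply: ge0_le_integral; [exact: measurable_itv|by []|exact: mnp|exact: mCR|].
  move=> u /=; rewrite in_itv/= => /andP[ru _].
  by rewrite -EFinM lee_fin /riesz subr_gt0 ru KC.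
rewrite ge0_integralZl_EFin; last 4 first.
- exact: measurable_itv.
- by move=> u _; rewrite lee_fin riesz_ge0.
- by apply/measurable_EFinP; exact: mR.
- exact: ltW.
by rewrite EFinM; apply: lee_wpmul2l (integral_riesz_le rx); rewrite lee_fin ltW.
Qed.

Lemma integrable_partial1 r x : r < x ->
  mu.-integrable `]r, x] (fun u => (partial1of2 K u r)%:E).
Proof.
move=> rx; apply/integrableP; split.
  by apply/measurable_EFinP; exact: measurable_partial1_itv.
by apply: le_lt_trans (integral_norm_partial1_le rx) _; rewrite ltry.
Qed.

Lemma integral_partial1_le r x : r < x ->
  `|\int[mu]_(u in `]r, x]) partial1of2 K u r| <= C * ((x - r) `^ alpha / alpha).
Proof.
move=> rx; have ip := integrable_partial1 rx.
rewrite -lee_fin (EFin_normr_Rintegral _ ip); last exact: measurable_itv.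
apply: le_trans (integral_norm_partial1_le rx); apply: le_abse_integral.
  exact: measurable_itv.
by apply/measurable_EFinP; exact: measurable_partial1_itv.
Qed.

Lemma integral_partial1_FTC r s t : r < s -> s < t ->
  \int[mu]_(u in `[s, t]) partial1of2 K u r = K t r - K s r.
Proof.
move=> rs st; have [_ _ _ dK _] := regK.
have cK u : r < u -> {for u, continuous (K ^~ r)}.
  by move=> ru; apply/differentiable_continuous/derivable1_diffP; exact: (dK r u ru).1.
rewrite /Rintegral (@continuous_FTC2 _ _ (K ^~ r))//.
- apply: continuous_in_subspaceT => u; rewrite inE/= in_itv/= => /andP[su _].
  exact: (dK r u (lt_le_trans rs su)).2.
- split.
  + move=> u; rewrite in_itv/= => /andP[su _].
    exact: (dK r u (lt_trans rs su)).1.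
  + exact/cvg_at_right_filter/cK.
  + exact/cvg_at_left_filter/cK/(lt_trans rs).
Qed.

(** This computes [K^*] on the indicator of [s, t[. For r < s it is the fundamental theorem of
    calculus and for r >= t both sides vanish; for s <= r < t the integral reaches the singularity
    at [r], and the assumption that [K] tends to 0 at the diagonal supplies the missing boundary
    value. *)
Lemma integral_partial1_itv r s t : s <= t ->
  \int[mu]_(u in `[s, t[ `&` `]r, +oo[) partial1of2 K u r = offdiag t r - offdiag s r.
Proof.
rewrite le_eqVlt => /predU1P[->|st].
  by rewrite subrr set_itvco0// set0I Rintegral_set0.
have [_ _ K0r _ _] := regK.
have [tr|rt] := leP t r.
  rewrite /offdiag !ltNge tr (le_trans (ltW st) tr)/= subrr.
  rewrite (_ : _ `&` _ = set0) ?Rintegral_set0//.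
  by rewrite -subset0 => u []; rewrite /= !in_itv/= andbT => /andP[_ ut] ru; move: (lt_trans ut (le_lt_trans tr ru)); rewrite ltxx.
rewrite {1}/offdiag rt.
have [rs|sr] := ltP r s.
  rewrite /offdiag rs (_ : _ `&` _ = `[s, t[%classic); last first.
    apply/seteqP; split => u /=; rewrite !in_itv/= andbT; first by case.
    by move=> /andP[su ->]; rewrite su (lt_le_trans rs su).
  rewrite -(integral_partial1_FTC rs st) Rintegral_itv_bndo_bndc//.
  apply: integrableS (integrable_partial1 (lt_trans rs st)) => // u /=.
  by rewrite !in_itv/= => /andP[su /ltW ->]; rewrite (lt_le_trans rs su).
rewrite /offdiag ltNge sr/= subr0 (_ : _ `&` _ = `]r, t[%classic); last first.
  apply/seteqP; split => u /=; rewrite !in_itv/= andbT; first by case=> /andP[_ ->] ->.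
  by move=> /andP[ru ->]; rewrite ru (le_trans sr (ltW ru)).
rewrite Rintegral_itv_bndo_bndc; last first.
  apply: integrableS (integrable_partial1 rt) => // u /=.
  by rewrite !in_itv/= => /andP[-> /ltW ->].
apply/eqP; rewrite -subr_eq0; apply/eqP.
(* The difference between the two sides is the same with [t] replaced by any [x] in ]r, t[, and each
   of its terms tends to 0 as [x] decreases to [r]. *)
have H x : r < x -> x < t -> (\int[mu]_(u in `]r, t]) partial1of2 K u r) - K t r =
    \int[mu]_(u in `]r, x]) partial1of2 K u r - K x r.
  move=> rx xt; rewrite (@itv_bndbnd_setU _ _ _ (BRight x)); [|by rewrite bnd_simp ltW|by rewrite bnd_simp ltW].
  have ixt : mu.-integrable (`]x, t]%classic : set R) (fun u => (partial1of2 K u r)%:E).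
    apply: integrableS (integrable_partial1 rt) => // u /=; rewrite !in_itv/=.
    by move=> /andP[xu ->]; rewrite (lt_trans rx xu).
  rewrite Rintegral_setU; last 4 first.
  - exact: measurable_itv.
  - exact: measurable_itv.
  - rewrite -itv_bndbnd_setU; [exact: integrable_partial1| |]; by rewrite bnd_simp ltW.
  - apply/disj_setPS => u []; rewrite /= !in_itv/= => /andP[_ ux] /andP[/lt_le_trans/(_ ux)].
    by rewrite ltxx.
  rewrite (@Rintegral_itv_obnd_cbnd _ x (BRight t))// integral_partial1_FTC//; lra.
apply/eqP; rewrite -normr_le0; apply/ler_addgt0Pl => e e0; rewrite addr0.
have Ka : \forall x \near r^'+, `|K x r| < e / 2.
  have /cvgrPdist_lt/(_ (e / 2)) := K0r r; rewrite divr_gt0// => /(_ isT).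
  by apply: filterS => x; rewrite sub0r normrN.
have pa : \forall x \near r^'+, C * ((x - r) `^ alpha / alpha) < e / 2.
  (* The solution of C dl^alpha / alpha = e / 2. *)
  pose dl := (e / 2 * alpha / C) `^ alpha^-1.
  have dl0 : 0 < dl by rewrite powR_gt0// divr_gt0// mulr_gt0// divr_gt0.
  near=> x; rewrite mulrA ltr_pdivrMr// -ltr_pdivlMl// mulrC.
  rewrite (_ : _ / C = dl `^ alpha); last first.
    by rewrite /dl -powRrM mulVf ?gt_eqF// powRr1// ltW// divr_gt0// mulr_gt0// divr_gt0.
  apply: gt0_ltr_powR => //; rewrite ?nnegrE ?(ltW dl0)//.
    by rewrite subr_ge0 ltW//; near: x; exact: nbhs_right_gt.
  rewrite ltrBlDl; near: x; apply: nbhs_right_lt; by rewrite ltrDl.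
near r^'+ => x.
have rx : r < x by near: x; exact: nbhs_right_gt.
rewrite (H x)//.
rewrite (le_trans (ler_normB _ _))// (splitr e) lerD//.
  by rewrite (le_trans (integral_partial1_le rx))// ltW//; near: x.
by rewrite ltW//; near: x.
Unshelve. all: by end_near. Qed.

(** The difference is the integral of the derivative of [K] over [a, b[, and this derivative is
    bounded by [C] times the Riesz kernel. *)
Lemma norm_offdiagB_le (a b r : R) : a <= b ->
  (`|offdiag b r - offdiag a r|%:E <= C%:E * riesz_potential alpha \1_(`[a, b[) r)%E.
Proof.
move=> ab; have mD : measurable (`[a, b[ `&` `]r, +oo[ : set R) by exact: measurableI.
have mp : measurable_fun (`[a, b[ `&` `]r, +oo[ : set R) (partial1of2 K ^~ r).
  by apply: measurable_funS; last exact: (@measurable_partial1 r).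
have mR : measurable_fun [set: R] (fun u => \1_(`[a, b[) u * riesz alpha (u - r)).
  by apply: measurable_funM => //; exact: measurable_rieszB.
rewrite /riesz_potential -ge0_integralZl_EFin ?(ltW C0)//; last 2 first.
- by move=> u _; rewrite lee_fin mulr_ge0// riesz_ge0.
- exact/measurable_EFinP.
rewrite -integral_partial1_itv//.
have [le|lt] := leP b r.
  rewrite (_ : _ `&` _ = set0) ?Rintegral_set0 ?normr0.
    by apply: integral_ge0 => u _; rewrite -EFinM lee_fin !mulr_ge0 ?(ltW C0)// riesz_ge0.
  rewrite -subset0 => u []; rewrite /= !in_itv/= andbT => /andP[_ ub] ru.
  by move: (lt_trans ub (le_lt_trans le ru)); rewrite ltxx.
have ip : mu.-integrable (`[a, b[ `&` `]r, +oo[ : set R) (fun u => (partial1of2 K u r)%:E).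
  apply: integrableS (integrable_partial1 lt) => // u [] /=; rewrite !in_itv/= andbT.
  by move=> /andP[_ /ltW ->] ->.
rewrite (EFin_normr_Rintegral _ ip); last exact: mD.
apply: le_trans; first by apply: le_abse_integral => //; exact/measurable_EFinP.
rewrite [leLHS]integral_mkcond; apply: ge0_le_integral => //.
- by move=> u _; apply: erestrict_ge0 => y _; rewrite lee_fin.
- apply/(measurable_restrictT _ _).1 => //; apply/measurable_EFinP.
  exact: measurableT_comp.
- by apply/measurable_EFinP; exact: measurable_funM.
- move=> u _; rewrite patchE -EFinM; case: ifPn => [/set_mem[]|_]; last first.
    by rewrite lee_fin !mulr_ge0 ?(ltW C0)// riesz_ge0.
  move=> uab; rewrite /= in_itv/= andbT => ru.
  by rewrite indicE mem_set// mul1r lee_fin /riesz subr_gt0 ru KC.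
Qed.

(** The Hardy-Littlewood-Sobolev inequality for the indicator of [a, b[. It makes the covariances of
    the increments finite real integrals. *)
Lemma sq_integrable_offdiagB (a b : R) :
  sq_integrable mu (fun r => offdiag b r - offdiag a r).
Proof.
wlog ab : a b / a <= b.
  move=> H; case: (leP a b) => [/H//|/ltW/H[_ iba]]; split.
    by apply: measurable_funB; exact: measurable_offdiag.
  rewrite (_ : (fun x => _) = (fun x => ((offdiag a x - offdiag b x) ^+ 2)%:E))//.
  by apply/funext => x; rewrite -sqrrN opprB.
have mo : measurable_fun [set: R] (fun r => offdiag b r - offdiag a r).
  by apply: measurable_funB; exact: measurable_offdiag.
split => //; apply/integrableP; split.
  by apply/measurable_EFinP; exact: measurable_funX.
pose p := 2 / (1 + 2 * alpha); have p0 : 0 < p by rewrite divr_gt0// addr_gt0// mulr_gt0.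
pose phi : R -> R := \1_(`[a, b[).
have mphi : measurable_fun [set: R] phi by exact: measurable_indic.
have phi0 u : 0 <= phi u by [].
(* The summand 1 keeps [A] positive when [a = b]. *)
pose A := (b - a + 1) `^ p^-1.
have A0 : 0 < A by rewrite powR_gt0// ltr_pwDr// subr_ge0.
have phiA : (\int[mu]_x (phi x `^ p)%:E <= (A `^ p)%:E)%E.
  rewrite (_ : (fun x => _) = fun x => (\1_(`[a, b[) x)%:E); last first.
    apply/funext => x; rewrite /phi indicE; case: (x \in _); rewrite ?powR1//.
    by rewrite powR0// gt_eqF.
  rewrite integral_indic// setIT [X in (X <= _)%E](lebesgue_measure_itv `[a, b[)/= lte_fin /A -powRrM mulVf ?gt_eqF//.
  have A1 : 0 <= b - a + 1 by rewrite addr_ge0// subr_ge0.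
  by rewrite powRr1//; case: ifPn => _; rewrite lee_fin ?lerDl.
have mP : measurable_fun [set: R] (riesz_potential alpha phi).
  apply: (@measurable_fun_fubini_tonelli_F _ _ _ _ _ mu
    (fun z : R * R => (phi z.2 * riesz alpha (z.2 - z.1))%:E)).
    apply/measurable_EFinP/measurable_funM; first exact: measurableT_comp.
    exact: measurable_rieszB.
  by move=> z; rewrite lee_fin mulr_ge0// riesz_ge0.
apply: (@le_lt_trans _ _ (\int[mu]_r ((C ^+ 2)%:E *
    (riesz_potential alpha phi r * riesz_potential alpha phi r)))%E).
  apply: ge0_le_integral => //.
  - apply: measurableT_comp => //; apply/measurable_EFinP; exact: measurable_funX.
  - by apply: emeasurable_funM => //; exact: emeasurable_funM.
  - move=> r _; rewrite gee0_abs ?lee_fin ?sqr_ge0//.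
    rewrite -(real_normK (num_real _)) !expr2 EFinM [(C * C)%:E]EFinM muleACA.
    by apply: lee_pmul; rewrite ?lee_fin//; exact: norm_offdiagB_le.
rewrite ge0_integralZl_EFin ?sqr_ge0//; last 2 first.
- by move=> r _; rewrite mule_ge0// riesz_potential_ge0.
- exact: emeasurable_funM.
apply: le_lt_trans.
  apply: lee_wpmul2l; first by rewrite lee_fin sqr_ge0.
  exact: (riesz_potential_L2 alpha0 alpha_half A0 (erefl p) mphi phi0 phiA).
by rewrite -EFinM ltry.
Qed.


Section elementary.
Context (V : normedModType R) (ip : {dot V for idfun}).
Hypotheses (hV : induces_norm ip) (sepV : separable V).
Implicit Types s : seq (R * R * V).

(* The list of triples [(a, b, v)] stands for the step function which is the sum
   of the functions [v 1_[a, b)]; the intervals may overlap. *)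
Definition step_sum s (r : R) : V := \sum_(x <- s) \1_(`[x.1.1, x.1.2[%classic) r *: x.2.

(** For an ordered list this is [K^*] of [step_sum s], by [integral_partial1_itv]. *)
Definition kernel_sum s (r : R) : V := \sum_(x <- s) (offdiag x.1.2 r - offdiag x.1.1 r) *: x.2.

Definition ordered s := all (fun x => x.1.1 <= x.1.2) s.

Lemma measurable_step_sum s : measurable_fun [set: R] (step_sum s : R -> borel V).
Proof.
apply: (measurable_fun_vector_sum sepV) => x _; apply: measurable_fun_scaler.
exact: measurable_indic.
Qed.

Lemma measurable_kernel_sum s : measurable_fun [set: R] (kernel_sum s : R -> borel V).
Proof.
apply: (measurable_fun_vector_sum sepV) => x _; apply: measurable_fun_scaler.
by apply: measurable_funB; exact: measurable_offdiag.
Qed.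

(** Everything is paired with the value x = K^* f (r) itself: |x|^2 is the scalar integral of
    dK/du(u, r) times the inner product of f(u) and x. The Cauchy-Schwarz inequality bounds it by
    |x| times the claimed potential, and |x| is cancelled. *)
Lemma norm_kernel_sum_le s r : ordered s ->
  (`|kernel_sum s r|%:E <= C%:E * riesz_potential alpha (fun u => `|step_sum s u|)%R r)%E.
Proof.
move=> os; set x := kernel_sum s r; have [x0|x0] := eqVneq x 0.
  by rewrite x0 normr0 mule_ge0// ?lee_fin ?(ltW C0)// riesz_potential_ge0.
have nx : 0 < `|x| by rewrite normr_gt0.
pose D := (`]r, +oo[%classic : set R).
have mD : measurable (D : set R) by exact: measurable_itv.
pose g u := partial1of2 K u r.
pose h (y : R * R * V) u := ((g \_ `[y.1.1, y.1.2[) u * ip y.2 x).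
have mhy (y : R * R * V) : measurable (`[y.1.1, y.1.2[%classic : set R) by exact: measurable_itv.
have ig y : mu.-integrable D (EFin \o (g \_ `[y.1.1, y.1.2[)).
  rewrite -restrict_EFin; apply/integrable_restrict => //.
  have [le|lt] := leP y.1.2 r.
    rewrite (_ : _ `&` _ = set0); first exact: integrable_set0.
    rewrite -subset0 => u []; rewrite /D /= !in_itv/= => /andP[ru _] /andP[_ uy].
    by move: ru; rewrite ltNge (le_trans (ltW uy) le).
  apply: integrableS (integrable_partial1 lt) => //; first exact: measurableI.
  by move=> u [] /=; rewrite /D/= !in_itv/= andbT => -> /andP[_ /ltW ->].
have ih y : mu.-integrable D (EFin \o h y).
  rewrite (_ : EFin \o _ = fun u => ((ip y.2 x)%:E * (EFin \o (g \_ `[y.1.1, y.1.2[)) u)%E).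
    exact: integrableZl.
  by apply/funext => u; rewrite /h /= mulrC EFinM.
have hE u : \sum_(y <- s) h y u = g u * ip (step_sum s u) x.
  rewrite /step_sum dot_suml mulr_sumr; apply: eq_bigr => y _.
  by rewrite /h patchE indicE; case: ifP => _; rewrite ?mul1r ?mul0r ?mulr0.
have xx : `|x| ^+ 2 = \int[mu]_(u in D) (\sum_(y <- s) h y u).
  rewrite -hV {1}/x /kernel_sum dot_suml Rintegral_sum//.
  rewrite big_seq [RHS]big_seq; apply: eq_bigr => y /(allP os) yo.
  by rewrite -integral_partial1_itv// Rintegral_mkcondl /h RintegralZr.
have iS : mu.-integrable D (EFin \o (fun u => \sum_(y <- s) h y u)) by exact: integrable_Rsum.
have mL : measurable_fun [set: R] (fun u => `|step_sum s u|).
  by apply: measurable_fun_vnorm; exact: measurable_step_sum.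
have mLR : measurable_fun [set: R] (fun u => `|step_sum s u| * riesz alpha (u - r)).
  by apply: measurable_funM => //; exact: measurable_rieszB.
have mLR' : measurable_fun [set: R] (fun u => (C * `|x|) * (`|step_sum s u| * riesz alpha (u - r))).
  exact: measurable_funM.
have Cx : 0 <= C * `|x| by rewrite mulr_ge0// ltW.
rewrite -(@lee_pmul2l _ `|x|%:E)//.
rewrite -EFinM -expr2.
apply: (@le_trans _ _ (\int[mu]_u ((C * `|x|) * (`|step_sum s u| * riesz alpha (u - r)))%:E)%E).
  rewrite -(@ger0_norm _ (`|x| ^+ 2)) ?exprn_ge0// {}xx.
  rewrite (EFin_normr_Rintegral _ iS); last exact: mD.
  have mS := integrableP _ _ _ iS.
  apply: le_trans; first by apply: le_abse_integral => //; exact: mS.1.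
  rewrite [leLHS]integral_mkcond; apply: ge0_le_integral => //.
  - by move=> u _; apply: erestrict_ge0 => y _; exact: abse_ge0.
  - apply/(measurable_restrictT _ _).1 => //; apply: measurableT_comp => //; exact: mS.1.
  - by apply/measurable_EFinP; exact: mLR'.
  - move=> u _; rewrite patchE; case: ifPn => [/set_mem|_]; last first.
      by rewrite lee_fin !mulr_ge0 ?riesz_ge0// ltW.
    rewrite /D /= in_itv/= andbT => ru; rewrite hE lee_fin normrM.
    rewrite mulrAC mulrA -mulrA mulrACA /riesz subr_gt0 ru.
    apply: ler_pM => //; first exact: KC.
    exact: (dot_le_norm hV).
under eq_integral do rewrite EFinM.
rewrite ge0_integralZl_EFin//; last 2 first.
- by move=> u _; rewrite lee_fin mulr_ge0// riesz_ge0.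
- by apply/measurable_EFinP; exact: mLR.
by rewrite [(C * _)%:E]EFinM (muleC C%:E `|x|%:E) -muleA.
Qed.

(** The pointwise domination reduces the vector-valued inequality to [riesz_potential_L2] for the
    scalar function |f|. *)
Lemma kernel_sum_L2 s (A : R) : ordered s -> 0 < A ->
  (\int[mu]_u (`|step_sum s u| `^ (2 / (1 + 2 * alpha)))%:E <= (A `^ (2 / (1 + 2 * alpha)))%:E)%E ->
  (\int[mu]_r (`|kernel_sum s r| ^+ 2)%:E <=
   (C ^+ 2 * (2 * (alpha^-1 + (1 - 2 * alpha)^-1) * (alpha^-1 + 3) * A ^+ 2))%:E)%E.
Proof.
move=> os A0 sA; pose phi u := `|step_sum s u|.
have mphi : measurable_fun [set: R] phi.
  by apply: measurable_fun_vnorm; exact: measurable_step_sum.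
have phi0 u : 0 <= phi u by exact: normr_ge0.
have mP : measurable_fun [set: R] (riesz_potential alpha phi).
  apply: (@measurable_fun_fubini_tonelli_F _ _ _ _ _ mu
    (fun z : R * R => (phi z.2 * riesz alpha (z.2 - z.1))%:E)).
    apply/measurable_EFinP/measurable_funM; first exact: measurableT_comp.
    exact: measurable_rieszB.
  by move=> z; rewrite lee_fin mulr_ge0// riesz_ge0.
have mPP : measurable_fun [set: R] (fun r => riesz_potential alpha phi r * riesz_potential alpha phi r)%E.
  exact: emeasurable_funM.
apply: (@le_trans _ _ (\int[mu]_r ((C ^+ 2)%:E *
    (riesz_potential alpha phi r * riesz_potential alpha phi r)))%E).
  apply: ge0_le_integral => //.
  - apply/measurable_EFinP; apply: measurable_funX; apply: measurable_fun_vnorm.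
    exact: measurable_kernel_sum.
  - by apply: emeasurable_funM => //; exact: mPP.
  - move=> r _; rewrite !expr2 EFinM [(C * C)%:E]EFinM muleACA.
    by apply: lee_pmul; rewrite ?lee_fin//; exact: norm_kernel_sum_le.
rewrite ge0_integralZl_EFin ?sqr_ge0//; last first.
  by move=> r _; rewrite mule_ge0// riesz_potential_ge0.
rewrite [leRHS]EFinM; apply: lee_wpmul2l; first by rewrite lee_fin sqr_ge0.
exact: (riesz_potential_L2 alpha0 alpha_half A0 erefl mphi phi0 sA).
Qed.

End elementary.

End kernel.

Definition step_integral {R : realType} (V : normedModType R) d (Omega : measurableType d)
    (b : R -> Omega -> R) (s : seq (R * R * V)) (w : Omega) : V :=
  \sum_(x <- s) (b x.1.2 w - b x.1.1 w) *: x.2.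

(** * The isometry for sums over the basis of U *)

Section isometry.
Context {R : realType} (U V : completeNormedModType R).
Context (ipU : {dot U for idfun}) (ipV : {dot V for idfun}) (hV : induces_norm ipV).
Context (sepV : separable V) (J : set nat) (e : nat -> U).
Hypothesis he : orthonormal_basis ipU J e.
Context d (Omega : measurableType d) (P : probability Omega R).
Context (alpha : R) (K : R -> R -> R) (B : R -> U -> Omega -> R).
Hypotheses (alpha0 : 0 < alpha) (alpha_half : alpha < 2^-1).
Hypothesis hB : cylindrical_volterra P ipU alpha K B.
Local Notation mu := (@lebesgue_measure R).

Let regK : regular_kernel alpha K := hB.1.

Let sq_offdiagB a b : sq_integrable mu (fun r => offdiag K b r - offdiag K a r).
Proof.
have [_ _ _ _ [C C0 KC]] := regK.
exact: (sq_integrable_offdiagB alpha0 alpha_half regK C0 KC).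
Qed.

Lemma offdiagE t r : r <> t -> K t r = offdiag K t r.
Proof.
have [_ K0 _ _ _] := regK; rewrite /offdiag => rt.
by case: ltP => //; rewrite le_eqVlt => /predU1P[/esym//|/K0].
Qed.

(** The integrands differ at most at the four times, a null set. The right-hand side being a real
    number, the covariance is also seen to be finite. *)
Lemma kernel_cov_offdiag (s1 t1 s2 t2 : R) : kernel_cov K s1 t1 s2 t2 =
  (\int[mu]_r ((offdiag K t1 r - offdiag K s1 r) * (offdiag K t2 r - offdiag K s2 r)))%:E.
Proof.
have mK t : measurable_fun [set: R] (K t).
  by have [mK _ _ _ _] := regK; apply: measurableT_comp mK (pair1_measurable t).
have mO t := measurable_offdiag regK t.
rewrite /Rintegral fineK; last first.
  by apply: integrable_fin_num => //; exact: integrable_sqM.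
have mB (f : R -> R -> R) : (forall t, measurable_fun [set: R] (f t)) ->
    measurable_fun [set: R] (fun r => (f t1 r - f s1 r) * (f t2 r - f s2 r)).
  by move=> mf; apply: measurable_funM; apply: measurable_funB.
apply: ae_eq_integral => //.
- by apply/measurable_EFinP; exact: mB.
- by apply/measurable_EFinP; exact: mB.
- exists ([set s1] `|` [set t1] `|` ([set s2] `|` [set t2])); split.
  + by do 2 ?apply: measurableU.
  + apply: countable_lebesgue_measure0; apply: finite_set_countable.
    by rewrite !finite_setU.
  + move=> r /= nK; apply: contrapT => nr; apply: nK => _.
    by rewrite !offdiagE// => rr; apply: nr; tauto.
Qed.

Lemma measurable_process t u : measurable_fun setT (B t u).
Proof.
have [_ [BL _ _ _ _]] := hB.
by have := BL t u; rewrite inE => /andP[/[!inE]].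
Qed.

Lemma sq_integrable_processB s t u : sq_integrable P (fun w => B t u w - B s u w).
Proof.
have [_ [BL _ _ _ _]] := hB.
apply: sq_integrableB; split; [exact: measurable_process| |exact: measurable_process|];
  exact: Lfun2_integrable_sqr.
Qed.

Lemma process_cov k l (s1 t1 s2 t2 : R) : J k -> J l ->
  \int[P]_w ((B t1 (e k) w - B s1 (e k) w) * (B t2 (e l) w - B s2 (e l) w)) =
  (k == l)%:R * \int[mu]_r ((offdiag K t1 r - offdiag K s1 r) * (offdiag K t2 r - offdiag K s2 r)).
Proof.
move=> Jk Jl; have [_ [_ _ _ _ cov]] := hB.
have := cov s1 t1 s2 t2 (e k) (e l).
rewrite unlock kernel_cov_offdiag he.1// => h.
by rewrite {1}/Rintegral h -EFinM/= mulrC.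
Qed.

Lemma measurable_step_integral (k : nat) (s : seq (R * R * V)) :
  measurable_fun setT (step_integral (fun t => B t (e k)) s : Omega -> borel V).
Proof.
apply: (measurable_fun_vector_sum sepV) => x _; apply: measurable_fun_scaler.
by apply: measurable_funB; exact: measurable_process.
Qed.

Lemma dot_step_integral k l (s1 s2 : seq (R * R * V)) : J k -> J l ->
  P.-integrable setT (fun w => (ipV (step_integral (fun t => B t (e k)) s1 w)
    (step_integral (fun t => B t (e l)) s2 w))%:E) /\
  \int[P]_w ipV (step_integral (fun t => B t (e k)) s1 w)
    (step_integral (fun t => B t (e l)) s2 w) =
  (k == l)%:R * \int[mu]_r ipV (kernel_sum K s1 r) (kernel_sum K s2 r).
Proof.
move=> Jk Jl.
pose c1 (x : R * R * V) w := B x.1.2 (e k) w - B x.1.1 (e k) w.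
pose c2 (x : R * R * V) w := B x.1.2 (e l) w - B x.1.1 (e l) w.
pose o (x : R * R * V) r := offdiag K x.1.2 r - offdiag K x.1.1 r.
have E1 w : ipV (step_integral (fun t => B t (e k)) s1 w) (step_integral (fun t => B t (e l)) s2 w)
    = \sum_(x <- s1) \sum_(y <- s2) c1 x w * c2 y w * ipV x.2 y.2.
  rewrite /step_integral dot_suml; apply: eq_bigr => x _.
  by rewrite dot_sumr mulr_sumr; apply: eq_bigr => y _; rewrite mulrA.
have E2 r : ipV (kernel_sum K s1 r) (kernel_sum K s2 r)
    = \sum_(x <- s1) \sum_(y <- s2) o x r * o y r * ipV x.2 y.2.
  rewrite /kernel_sum dot_suml; apply: eq_bigr => x _.
  by rewrite dot_sumr mulr_sumr; apply: eq_bigr => y _; rewrite mulrA.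
have i1' x y : P.-integrable setT (EFin \o (fun w => c1 x w * c2 y w)).
  by apply: integrable_sqM; exact: sq_integrable_processB.
have i2' x y : mu.-integrable setT (EFin \o (fun w => o x w * o y w)).
  by apply: integrable_sqM; exact: sq_offdiagB.
have i1 x y : P.-integrable setT (EFin \o (fun w => c1 x w * c2 y w * ipV x.2 y.2)).
  rewrite (_ : EFin \o _ = fun w => ((ipV x.2 y.2)%:E * (EFin \o (fun w => (c1 x w * c2 y w)%R)) w)%E).
    exact: integrableZl.
  by apply/funext => w /=; rewrite mulrC EFinM.
have i2 x y : mu.-integrable setT (EFin \o (fun w => o x w * o y w * ipV x.2 y.2)).
  rewrite (_ : EFin \o _ = fun w => ((ipV x.2 y.2)%:E * (EFin \o (fun w => (o x w * o y w)%R)) w)%E).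
    exact: integrableZl.
  by apply/funext => w /=; rewrite mulrC EFinM.
have j1 x : P.-integrable setT (EFin \o (fun w => \sum_(y <- s2) c1 x w * c2 y w * ipV x.2 y.2)).
  exact: integrable_Rsum.
have j2 x : mu.-integrable setT (EFin \o (fun w => \sum_(y <- s2) o x w * o y w * ipV x.2 y.2)).
  exact: integrable_Rsum.
split.
  rewrite (_ : (fun w => _) = EFin \o (fun w => \sum_(x <- s1) \sum_(y <- s2) c1 x w * c2 y w * ipV x.2 y.2)).
    exact: integrable_Rsum.
  by apply/funext => w /=; rewrite E1.
under eq_Rintegral do rewrite E1.
under [in RHS]eq_Rintegral do rewrite E2.
rewrite !Rintegral_sum// mulr_sumr; apply: eq_bigr => x _.
rewrite !Rintegral_sum// mulr_sumr; apply: eq_bigr => y _.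
by rewrite !RintegralZr// process_cov// mulrA.
Qed.

Lemma integrable_kernel_sum (s : seq (R * R * V)) :
  mu.-integrable setT (fun r => (`|kernel_sum K s r| ^+ 2)%:E).
Proof.
pose o (x : R * R * V) r := offdiag K x.1.2 r - offdiag K x.1.1 r.
rewrite (_ : (fun r => _) = EFin \o (fun r => \sum_(x <- s) \sum_(y <- s) o x r * o y r * ipV x.2 y.2)).
  apply: integrable_Rsum => // x; apply: integrable_Rsum => // y.
  rewrite (_ : EFin \o _ = fun w => ((ipV x.2 y.2)%:E * (o x w * o y w)%:E)%E).
    by apply: integrableZl => //; apply: integrable_sqM; exact: sq_offdiagB.
  by apply/funext => w /=; rewrite mulrC EFinM.
apply/funext => r /=; rewrite -hV /kernel_sum dot_suml; congr EFin; apply: eq_bigr => x _.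
by rewrite dot_sumr mulr_sumr; apply: eq_bigr => y _; rewrite mulrA.
Qed.

(** The squared norm is expanded by bilinearity; processes attached to different basis vectors have
    uncorrelated increments, so only the terms with equal indices survive. *)
Lemma step_integral_isometry (ks : seq nat) (s : nat -> seq (R * R * V)) :
  uniq ks -> (forall k, k \in ks -> J k) ->
  (\int[P]_w (`|\sum_(k <- ks) step_integral (fun t => B t (e k)) (s k) w| ^+ 2)%:E =
   \sum_(k <- ks) \int[mu]_r (`|kernel_sum K (s k) r| ^+ 2)%:E)%E.
Proof.
move=> uks Jks.
pose X k := step_integral (fun t => B t (e k)) (s k).
(* The value 0 outside [ks] makes [G k l] integrable for all indices, as [Rintegral_sum] demands. *)
pose G k l w := if (k \in ks) && (l \in ks) then ipV (X k w) (X l w) else 0.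
have E w : `|\sum_(k <- ks) X k w| ^+ 2 = \sum_(k <- ks) \sum_(l <- ks) G k l w.
  rewrite -hV linear_sumlz big_seq [RHS]big_seq; apply: eq_bigr => k kks.
  rewrite linear_sumr big_seq [RHS]big_seq; apply: eq_bigr => l lks.
  by rewrite /G kks lks.
have iG k l : P.-integrable setT (EFin \o G k l).
  rewrite /comp /G; have [/andP[/Jks Jk /Jks Jl]|_] := boolP ((k \in ks) && (l \in ks)); last exact: integrable0.
  by have [] := dot_step_integral (s k) (s l) Jk Jl.
have IG k l : k \in ks -> l \in ks -> \int[P]_w G k l w =
    (k == l)%:R * \int[mu]_r ipV (kernel_sum K (s k) r) (kernel_sum K (s l) r).
  move=> kks lks; rewrite /G kks lks.
  by have [] := dot_step_integral (s k) (s l) (Jks k kks) (Jks l lks).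
have IS : \int[P]_w (\sum_(k <- ks) \sum_(l <- ks) G k l w) =
    \sum_(k <- ks) \int[mu]_r (`|kernel_sum K (s k) r| ^+ 2).
  rewrite Rintegral_sum//; last by move=> k; exact: integrable_Rsum.
  rewrite big_seq [RHS]big_seq; apply: eq_bigr => k kks; rewrite Rintegral_sum//.
  rewrite (bigD1_seq k)//= IG// eqxx mul1r big_seq_cond big1 ?addr0.
    by apply: eq_Rintegral => r _; rewrite hV.
  by move=> l /andP[lks lk]; rewrite IG// eq_sym (negPf lk) mul0r.
have ik k := integrable_kernel_sum (s k).
transitivity ((\int[P]_w (\sum_(k <- ks) \sum_(l <- ks) G k l w))%:E).
  rewrite /Rintegral fineK; last first.
    apply: integrable_fin_num => //.
    by apply: integrable_Rsum => // k; exact: integrable_Rsum.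
  by apply: eq_integral => w _; rewrite -E.
rewrite IS -sumEFin; apply: eq_bigr => k _.
by rewrite /Rintegral fineK//; exact: integrable_fin_num.
Qed.

End isometry.

Section Vnorm2.
Context {R : realType} d (T : measurableType d) (mu : {measure set T -> \bar R}).
Context (V : normedModType R).

Lemma Vnorm2_integral (f : T -> V) (c : R) :
  0 <= c -> (Vnorm mu 2 f = c%:E)%E <-> (\int[mu]_x (`|f x| ^+ 2)%:E = (c ^+ 2)%:E)%E.
Proof.
move=> c0; have I0 : (0 <= \int[mu]_x (`|f x| ^+ 2)%:E)%E.
  by apply: integral_ge0 => x _; rewrite lee_fin sqr_ge0.
have N0 := Vnorm_ge0 mu 2 f.
split=> h.
  have : (Vnorm mu 2 f <= c%:E)%E by rewrite h.
  rewrite Vnorm2_le//; case: (\int[mu]_x _)%E I0 (Vnorm2_le mu f) => [a|//|//] a0 le2.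
  rewrite lee_fin => ac; congr EFin.
  have sa : 0 <= Num.sqrt a by exact: sqrtr_ge0.
  have := le2 _ sa; rewrite sqr_sqrtr// lexx h lee_fin => /idP ca.
  apply/eqP; rewrite eq_le ac/= -(sqr_sqrtr a0).
  by rewrite ler_pXn2r// nnegrE.
have : (\int[mu]_x (`|f x| ^+ 2)%:E <= (c ^+ 2)%:E)%E by rewrite h.
rewrite -Vnorm2_le//; case: (Vnorm mu 2 f) N0 (Vnorm2_le mu f) => [a|//|//] a0 le2.
rewrite lee_fin => ac; congr EFin.
have := le2 _ a0; rewrite lexx h lee_fin ler_pXn2r// ?nnegrE// => /esym ca.
by apply/eqP; rewrite eq_le ac.
Qed.

End Vnorm2.

Section Vnorm_sums.
Context {R : realType} d (T : measurableType d) (mu : {measure set T -> \bar R}).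
Context (V : normedModType R) (sepV : separable V).

Lemma Vnorm_sub_sym p (f g : T -> V) :
  Vnorm mu p (fun x => f x - g x) = Vnorm mu p (fun x => g x - f x).
Proof. by apply: eq_Vnorm => x; rewrite distrC. Qed.

Lemma Vnorm_add_le p (f g : T -> V) : 1 <= p ->
  measurable_fun setT (f : T -> borel V) -> measurable_fun setT (g : T -> borel V) ->
  (Vnorm mu p (fun x => f x + g x)%R <= Vnorm mu p f + Vnorm mu p g)%E.
Proof.
move=> p1 mf mg; apply: Vnorm_triangle => //.
- exact: measurable_fun_vnorm.
- exact: measurable_fun_vnorm.
- by apply: measurable_fun_vnorm; exact: (measurable_fun_vectorD sepV).
- by move=> x; exact: ler_normD.
Qed.

Lemma Vnorm_dist_triangle p (f g h : T -> V) : 1 <= p ->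
  measurable_fun setT (f : T -> borel V) -> measurable_fun setT (g : T -> borel V) ->
  measurable_fun setT (h : T -> borel V) ->
  (Vnorm mu p (fun x => f x - h x)%R <=
   Vnorm mu p (fun x => f x - g x)%R + Vnorm mu p (fun x => g x - h x)%R)%E.
Proof.
move=> p1 mf mg mh; rewrite (_ : (fun x => f x - h x) = fun x => (f x - g x) + (g x - h x)).
  by apply: Vnorm_add_le => //; exact: (measurable_fun_vectorB sepV).
by apply/funext => x; rewrite subrKA.
Qed.

Lemma Vnorm_sum_le p I (s : seq I) (Q : pred I) (f : I -> T -> V) : 1 <= p ->
  (forall i, Q i -> measurable_fun setT (f i : T -> borel V)) ->
  (Vnorm mu p (fun x => \sum_(i <- s | Q i) f i x)%R <= \sum_(i <- s | Q i) Vnorm mu p (f i))%E.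
Proof.
move=> p1 mf; elim: s => [|i s IH].
  rewrite big_nil (_ : (fun x => _) = (fun=> 0)); last by apply/funext => x; rewrite big_nil.
  by rewrite Vnorm0// gt_eqF// (lt_le_trans _ p1).
rewrite big_cons; have [Qi|nQi] := boolP (Q i); last first.
  rewrite (_ : (fun x => _) = (fun x => \sum_(i <- s | Q i) f i x))//.
  by apply/funext => x; rewrite big_cons (negPf nQi).
rewrite (_ : (fun x => _) = (fun x => f i x + \sum_(i <- s | Q i) f i x)); last first.
  by apply/funext => x; rewrite big_cons Qi.
apply: le_trans (Vnorm_add_le _ _ _) _ => //; first exact: mf.
  exact: (measurable_fun_vector_sum sepV).
by rewrite leeD2l.
Qed.

End Vnorm_sums.

Section step_lists.
Context {R : realType} (V : normedModType R).
Implicit Types f g : stepfun V.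

Definition step_list f : seq (R * R * V) :=
  [seq (step_time f j, step_time f j.+1, step_coef f j) | j <- iota 0 (step_size f)].

(** Two step functions on different grids are subtracted by concatenating their lists of intervals,
    which avoids a common refinement; this is why lists with overlapping intervals are allowed. *)
Definition step_diff f g : seq (R * R * V) :=
  step_list f ++ [seq (x.1, - x.2) | x <- step_list g].

Lemma big_step_list (W : nmodType) (F : R * R * V -> W) f :
  \sum_(x <- step_list f) F x =
  \sum_(j < step_size f) F (step_time f j, step_time f j.+1, step_coef f j).
Proof. by rewrite big_map -[X in iota 0 X]subn0 big_mkord. Qed.

Lemma big_step_diff (W : nmodType) (F : R * R * V -> W) f g :
  \sum_(x <- step_diff f g) F x =
  \sum_(x <- step_list f) F x + \sum_(x <- step_list g) F (x.1, - x.2).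
Proof. by rewrite /step_diff big_cat/= big_map. Qed.

Lemma ordered_step_list f : ordered (step_list f).
Proof.
apply/allP => x /mapP[j]; rewrite mem_iota => /= jn ->/=.
exact/ltW/step_incr.
Qed.

Lemma ordered_step_diff f g : ordered (step_diff f g).
Proof.
rewrite /ordered all_cat; apply/andP; split; first exact: ordered_step_list.
by rewrite all_map; apply: ordered_step_list.
Qed.

Lemma step_valE f r : step_val f r = step_sum (step_list f) r.
Proof. by rewrite /step_sum big_step_list. Qed.

Lemma step_sum_diff f g r : step_sum (step_diff f g) r = step_val f r - step_val g r.
Proof.
rewrite /step_sum big_step_diff !big_step_list -sumrN; congr (_ + _).
by apply: eq_bigr => j _; rewrite scalerN.
Qed.

Lemma step_intE d (Omega : measurableType d) (b : R -> Omega -> R) f w :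
  step_int b f w = step_integral b (step_list f) w.
Proof. by rewrite /step_integral big_step_list. Qed.

Lemma step_integral_diff d (Omega : measurableType d) (b : R -> Omega -> R) f g w :
  step_integral b (step_diff f g) w = step_int b f w - step_int b g w.
Proof.
rewrite /step_integral big_step_diff !big_step_list -sumrN; congr (_ + _).
by apply: eq_bigr => j _; rewrite scalerN.
Qed.

Lemma measurable_step_val (sepV : separable V) f :
  measurable_fun [set: R] (step_val f : R -> borel V).
Proof.
rewrite (_ : step_val f = step_sum (step_list f)); first exact: measurable_step_sum.
by apply/funext => r; rewrite step_valE.
Qed.

End step_lists.

Section step_distance.
Context {R : realType} (U V : completeNormedModType R).
Context (ipU : {dot U for idfun}) (ipV : {dot V for idfun}) (hV : induces_norm ipV).
Context (sepV : separable V) (J : set nat) (e : nat -> U).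
Hypothesis he : orthonormal_basis ipU J e.
Context d (Omega : measurableType d) (P : probability Omega R).
Context (alpha : R) (K : R -> R -> R) (B : R -> U -> Omega -> R).
Hypotheses (alpha0 : 0 < alpha) (alpha_half : alpha < 2^-1).
Hypothesis hB : cylindrical_volterra P ipU alpha K B.
Local Notation mu := (@lebesgue_measure R).
Implicit Types f g h : stepfun V.

Let regK : regular_kernel alpha K := hB.1.

Lemma KstarE f r : Kstar K f r = kernel_sum K (step_list f) r.
Proof.
have [_ _ _ _ [C C0 KC]] := regK.
rewrite /kernel_sum big_step_list; apply: eq_bigr => j _.
by rewrite (integral_partial1_itv alpha0 regK C0 KC)// ltW// step_incr.
Qed.

Lemma kernel_sum_diff f g r :
  kernel_sum K (step_diff f g) r = Kstar K f r - Kstar K g r.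
Proof.
rewrite !KstarE /kernel_sum big_step_diff !big_step_list -sumrN; congr (_ + _).
by apply: eq_bigr => j _; rewrite scalerN.
Qed.

Lemma measurable_KstarB f g :
  measurable_fun [set: R] (fun r => `|Kstar K f r - Kstar K g r|).
Proof.
rewrite (_ : (fun r => _) = fun r => `|kernel_sum K (step_diff f g) r|).
  by apply: measurable_fun_vnorm; exact: (measurable_kernel_sum regK sepV (step_diff f g)).
by apply/funext => r; rewrite kernel_sum_diff.
Qed.

(** The distance is finite by [step_distE], so [fine] loses nothing, and estimates can be carried
    out in the reals. *)
Definition step_dst f g : R := fine (step_dist K f g).

Lemma step_dst_ge0 f g : 0 <= step_dst f g.
Proof. by apply: fine_ge0; exact: Vnorm_ge0. Qed.

Lemma step_distE f g : step_dist K f g = (step_dst f g)%:E.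
Proof.
rewrite /step_dst fineK// ge0_fin_numE; last exact: Vnorm_ge0.
have /integrable_fin_num := integrable_kernel_sum hV alpha0 alpha_half hB (step_diff f g).
move=> /(_ measurableT); set I := (\int[_]_(_ in _) _)%E => If.
have I0 : 0 <= fine I by apply: fine_ge0; apply: integral_ge0 => r _; rewrite lee_fin sqr_ge0.
rewrite /step_dist (_ : Vnorm _ _ _ = (Num.sqrt (fine I))%:E) ?ltry//.
apply/Vnorm2_integral; first exact: sqrtr_ge0.
rewrite sqr_sqrtr// fineK//.
by apply: eq_integral => r _; rewrite kernel_sum_diff.
Qed.

Lemma integral_kernel_sum_diff f g :
  (\int[mu]_r (`|kernel_sum K (step_diff f g) r| ^+ 2)%:E = (step_dst f g ^+ 2)%:E)%E.
Proof.
have /Vnorm2_integral <- := step_distE f g; last exact: step_dst_ge0.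
by apply: eq_integral => r _; rewrite kernel_sum_diff.
Qed.

Lemma step_dstC f g : step_dst f g = step_dst g f.
Proof.
by congr fine; apply: eq_Vnorm => r; rewrite distrC.
Qed.

Lemma step_dst_triangle f g h : step_dst f h <= step_dst f g + step_dst g h.
Proof.
rewrite -lee_fin EFinD -!step_distE; apply: Vnorm_triangle => //; [by lra| | | |].
- exact: measurable_KstarB.
- exact: measurable_KstarB.
- exact: measurable_KstarB.
- by move=> r; exact: ler_distD.
Qed.

(** The Hardy-Littlewood-Sobolev inequality in the form used from here on: the inclusion of step
    functions is Lipschitz from L^p to D. [A] is any positive upper bound of the L^p distance. *)
Lemma step_dst_le_Lp : exists2 C : R, 0 < C & forall f g (A : R), 0 < A ->
  (Vnorm mu (2 / (1 + 2 * alpha)) (fun r => step_val f r - step_val g r)%R <= A%:E)%E ->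
  step_dst f g <= C * A.
Proof.
have [_ _ _ _ [C C0 KC]] := regK.
pose c := 2 * (alpha^-1 + (1 - 2 * alpha)^-1) * (alpha^-1 + 3).
have a20 : 0 < 1 - 2 * alpha by have := alpha_half; lra.
have c0 : 0 < c by rewrite !mulr_gt0// addr_gt0// invr_gt0.
exists (C * Num.sqrt c); first by rewrite mulr_gt0// sqrtr_gt0.
move=> f g A A0; have p0 : 0 < 2 / (1 + 2 * alpha) by rewrite divr_gt0//; have := alpha0; lra.
rewrite Vnorm_le ?(ltW A0)// => fgA.
have := kernel_sum_L2 alpha0 alpha_half regK C0 KC hV sepV (ordered_step_diff f g) A0.
rewrite integral_kernel_sum_diff lee_fin => /(_ _)/wrap[].
  by under eq_integral do rewrite step_sum_diff.
move=> H; rewrite -(@ler_pXn2r _ 2)// ?nnegrE ?step_dst_ge0 ?mulr_ge0 ?sqrtr_ge0 ?(ltW C0) ?(ltW A0)//.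
apply: le_trans H _; rewrite !exprMn sqr_sqrtr ?(ltW c0)// /c; lra.
Qed.

Lemma step_int_isometry (N : nat) (f g : nat -> stepfun V) :
  (Vnorm P 2 (fun w => \sum_(k < N | (k : nat) \in J)
     (step_int (fun t => B t (e k)) (f k) w - step_int (fun t => B t (e k)) (g k) w))%R =
   (Num.sqrt (\sum_(k < N | (k : nat) \in J) step_dst (f k) (g k) ^+ 2))%:E)%E.
Proof.
apply/Vnorm2_integral; first exact: sqrtr_ge0.
rewrite sqr_sqrtr; last by apply: sumr_ge0 => k _; exact: sqr_ge0.
pose ks := [seq k <- index_iota 0 N | k \in J].
have uks : uniq ks by rewrite filter_uniq// iota_uniq.
have Jks k : k \in ks -> J k by rewrite mem_filter => /andP[/set_mem].
transitivity (\int[P]_w (`|\sum_(k <- ks) step_integral (fun t => B t (e k)) (step_diff (f k) (g k)) w| ^+ 2)%:E)%E.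
  apply: eq_integral => w _; rewrite big_filter big_mkord.
  by under [in RHS]eq_bigr do rewrite step_integral_diff.
rewrite (step_integral_isometry hV he alpha0 alpha_half hB)// big_filter big_mkord -sumEFin.
by apply: eq_bigr => k _; exact: integral_kernel_sum_diff.
Qed.

Lemma step_int_isometry1 k f g : J k ->
  (Vnorm P 2 (fun w => step_int (fun t => B t (e k)) f w - step_int (fun t => B t (e k)) g w)%R
   = (step_dst f g)%:E)%E.
Proof.
move=> Jk; apply/Vnorm2_integral; first exact: step_dst_ge0.
have := @step_integral_isometry _ _ _ _ _ hV _ _ he _ _ _ _ _ _ alpha0 alpha_half hB
  [:: k] (fun=> step_diff f g) isT.
move=> /(_ _)/wrap[l|]; first by rewrite inE => /eqP ->.
rewrite big_seq1 integral_kernel_sum_diff => <-.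
by apply: eq_integral => w _; rewrite big_seq1 step_integral_diff.
Qed.

Lemma measurable_step_int k f :
  measurable_fun setT (step_int (fun t => B t (e k)) f : Omega -> borel V).
Proof.
rewrite (_ : step_int _ f = step_integral (fun t => B t (e k)) (step_list f)).
  exact: (measurable_step_integral sepV e hB).
by apply/funext => w; rewrite step_intE.
Qed.

Lemma step_int0 b w : step_int (Omega := Omega) b (step0 V) w = 0.
Proof. by rewrite /step_int big_ord0. Qed.

End step_distance.

(** * Extension of the integral to the completions *)

Lemma ecvg0P {R : realType} (u : nat -> \bar R) : (forall n, 0 <= u n)%E ->
  (u n @[n --> \oo] --> 0%E) <->
  (forall eps : R, 0 < eps -> \forall n \near \oo, (u n <= eps%:E)%E).
Proof.
move=> u0; split=> [/fine_cvgP[ufin uc] eps eps0|uc].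
  move/cvgr0Pnorm_le : uc => /(_ eps eps0).
  apply: filterS2 ufin => n fu /=; rewrite ger0_norm ?fine_ge0// => ue.
  by rewrite -(fineK fu) lee_fin.
apply/fine_cvgP; split.
  by apply: filterS (uc _ ltr01) => n un; rewrite ge0_fin_numE// (le_lt_trans un)// ltry.
apply/cvgr0Pnorm_le => eps eps0; apply: filterS (uc _ eps0) => n /= un.
have fu : u n \is a fin_num by rewrite ge0_fin_numE// (le_lt_trans un)// ltry.
by rewrite ger0_norm ?fine_ge0// -lee_fin fineK.
Qed.

Section esum_nat.
Context {R : realType} (J : set nat).

Lemma esum_nat_le (a : nat -> R) c : (forall k, 0 <= a k) ->
  (\esum_(k in J) (a k)%:E <= c%:E)%E <-> forall M, \sum_(k < M | (k : nat) \in J) a k <= c.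
Proof.
move=> a0; have a0' n : n \in J -> (0 <= (a n)%:E)%E by rewrite lee_fin.
have -> : (\esum_(k in J) (a k)%:E = \sum_(k <oo | k \in J) (a k)%:E)%E.
  rewrite nneseries_esum; last by move=> k _; rewrite lee_fin.
  by congr esum; apply/seteqP; split=> k /=; rewrite inE.
split=> [h M|h].
  have := le_trans (nneseries_lim_ge M (fun n _ => a0' n)) h.
  by rewrite sumEFin lee_fin big_mkord.
apply: lime_le; first by apply: is_cvg_nneseries => n _ /a0'.
by apply: nearW => n; rewrite sumEFin lee_fin big_mkord; exact: h.
Qed.

(** The partial sum up to a suitable [N] is within [eps] of the total; the bound holds for all [M],
    so that finite sums suffice later. *)
Lemma esum_nat_tail (a : nat -> R) : (forall k, 0 <= a k) ->
  (\esum_(k in J) (a k)%:E < +oo)%E -> forall eps, 0 < eps -> exists N, forall M,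
  \sum_(k < M | ((k : nat) \in J) && (N <= k)%N) a k <= eps.
Proof.
move=> a0 aoo eps eps0; set S := (\esum_(_ in _) _)%E in aoo.
have S0 : (0 <= S)%E by apply: esum_ge0 => k _; rewrite lee_fin.
have fS : S \is a fin_num by rewrite ge0_fin_numE.
have [N SN] : exists N, fine S - eps <= \sum_(k < N | (k : nat) \in J) a k.
  apply: contrapT => /forallNP h.
  have : (S <= (fine S - eps)%:E)%E.
    by apply/esum_nat_le => // M; have /negP := h M; rewrite -ltNge => /ltW.
  by rewrite -{1}(fineK fS) lee_fin; lra.
have SM : forall M, \sum_(k < M | (k : nat) \in J) a k <= fine S by apply/esum_nat_le => //; rewrite fineK.
exists N => M; set T := \sum_(_ < M | _) _.
have T0 : 0 <= T by exact: sumr_ge0.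
pose L := maxn M N.
have TL : T <= \sum_(k < L | ((k : nat) \in J) && (N <= k)%N) a k.
  rewrite /T (big_ord_widen_cond L (fun k => (k \in J) && (N <= k)%N) a) ?leq_maxl//.
  rewrite [leRHS](bigID (fun k : 'I_L => (k < M)%N))/= ler_wpDr//.
  exact: sumr_ge0.
have := SM L.
rewrite (bigID (fun k : 'I_L => (k < N)%N))/=.
rewrite -(big_ord_widen_cond L (fun k => k \in J) a) ?leq_maxr//.
under [X in _ + X]eq_bigl do rewrite -leqNgt.
lra.
Qed.

Lemma esum_sqrt_le (a : nat -> R) c : (forall k, 0 <= a k) -> 0 <= c ->
  ((\esum_(k in J) (a k)%:E) `^ 2^-1 <= c%:E)%E <->
  forall M, \sum_(k < M | (k : nat) \in J) a k <= c ^+ 2.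
Proof.
move=> a0 c0; apply: (iff_trans _ (esum_nat_le _ a0)).
set E := (\esum_(_ in _) _)%E.
have E0 : (0 <= E)%E by apply: esum_ge0 => k _; rewrite lee_fin.
case: E E0 => [x|_|//]; last by rewrite poweRyr// invr_eq0 pnatr_eq0.
rewrite lee_fin => x0; rewrite poweR_EFin !lee_fin powR12_sqrt//.
rewrite -(@ger0_norm _ c c0) -{1}sqrtr_sqr ler_sqrt ?sqr_ge0//.
by rewrite ger0_norm.
Qed.

End esum_nat.

Section completion.
Context {R : realType} (U V : completeNormedModType R).
Context (ipU : {dot U for idfun}) (ipV : {dot V for idfun}) (hV : induces_norm ipV).
Context (sepV : separable V) (J : set nat) (e : nat -> U).
Hypothesis he : orthonormal_basis ipU J e.
Context d (Omega : measurableType d) (P : probability Omega R).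
Context (alpha : R) (K : R -> R -> R) (B : R -> U -> Omega -> R).
Hypotheses (alpha0 : 0 < alpha) (alpha_half : alpha < 2^-1).
Hypothesis hB : cylindrical_volterra P ipU alpha K B.
Local Notation mu := (@lebesgue_measure R).
Local Notation p := (2 / (1 + 2 * alpha)).
Implicit Types (f g h : stepfun V) (F G H : Dspace V K).

Let distE f g : step_dist K f g = (step_dst K f g)%:E :=
  step_distE hV alpha0 alpha_half hB f g.

Let dst_triangle f g h : step_dst K f h <= step_dst K f g + step_dst K g h :=
  step_dst_triangle hV sepV alpha0 alpha_half hB f g h.

Lemma Dseq_cauchy_le F eps : 0 < eps -> exists N, forall m n,
  (N <= m)%N -> (N <= n)%N -> step_dst K (F m) (F n) <= eps.
Proof.
move=> /(Dseq_cauchy F)[N FN]; exists N => m n Nm Nn.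
by rewrite -lee_fin -distE ltW// FN.
Qed.

Lemma is_cvg_step_dst F G : cvgn (fun n => step_dst K (F n) (G n)).
Proof.
apply: R_complete; apply: cauchy_exP => eps eps0.
have [N1 FN] := Dseq_cauchy_le F (divr_gt0 eps0 (ltr0n _ 4)).
have [N2 GN] := Dseq_cauchy_le G (divr_gt0 eps0 (ltr0n _ 4)).
pose N := maxn N1 N2; exists (step_dst K (F N) (G N)).
exists N => // n /= Nn; rewrite /ball/=.
have h1 : (N1 <= n)%N by rewrite (leq_trans _ Nn)// leq_maxl.
have h2 : (N2 <= n)%N by rewrite (leq_trans _ Nn)// leq_maxr.
have F1 := FN N n (leq_maxl _ _) h1; have G1 := GN N n (leq_maxr _ _) h2.
have F2 := FN n N h1 (leq_maxl _ _); have G2 := GN n N h2 (leq_maxr _ _).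
have t1 := dst_triangle (F N) (F n) (G N); have t2 := dst_triangle (F n) (G n) (G N).
have t3 := dst_triangle (F n) (F N) (G n); have t4 := dst_triangle (F N) (G N) (G n).
by rewrite ltr_norml; apply/andP; split; lra.
Qed.

Definition Ddst F G : R := limn (fun n => step_dst K (F n) (G n)).

Lemma DdistE F G : Ddist F G = (Ddst F G)%:E.
Proof.
rewrite /Ddist /Ddst -EFin_lim; last exact: is_cvg_step_dst.
by congr (limn _); apply/funext => n /=; rewrite distE.
Qed.

Lemma Ddst_ge0 F G : 0 <= Ddst F G.
Proof.
by apply: limr_ge; [exact: is_cvg_step_dst|apply: nearW => n; exact: step_dst_ge0].
Qed.

Lemma DdstC F G : Ddst F G = Ddst G F.
Proof. by congr (limn _); apply/funext => n; rewrite step_dstC. Qed.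

Lemma Ddst_triangle F G H : Ddst F H <= Ddst F G + Ddst G H.
Proof.
have cFG := @is_cvg_step_dst F G; have cGH := @is_cvg_step_dst G H.
rewrite /Ddst -limD//; apply: ler_lim; first exact: is_cvg_step_dst.
  exact: is_cvgD.
by apply: nearW => n; exact: dst_triangle.
Qed.

Lemma Ddst_step f g : Ddst (Dstep K f) (Dstep K g) = step_dst K f g.
Proof. by rewrite /Ddst/= lim_cst. Qed.

Lemma Ddst_seq F eps : 0 < eps -> exists N, forall n, (N <= n)%N -> Ddst (Dstep K (F n)) F <= eps.
Proof.
move=> /(Dseq_cauchy_le F)[N FN]; exists N => n Nn.
apply: limr_le; first exact: is_cvg_step_dst.
by exists N => // m /= Nm; exact: FN.
Qed.

Lemma Ddst_approx F eps : 0 < eps -> exists f, Ddst (Dstep K f) F <= eps.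
Proof. by move=> /(Ddst_seq F)[N /(_ N (leqnn N))]; exists (F N). Qed.

Lemma Ddst_refl F : Ddst F F = 0.
Proof.
by rewrite /Ddst (_ : (fun n => _) = cst 0) ?lim_cst//; apply/funext => n; rewrite /step_dst step_distxx.
Qed.

(** The density of step functions is carried as a property of [phi]; it is established below for the
    orbits of the semigroup. *)
Definition step_approximable (phi : R -> V) :=
  inLp mu p phi /\ forall dl : R, 0 < dl ->
    exists h, (Vnorm mu p (fun r => step_val h r - phi r)%R <= dl%:E)%E.

(** All that is known of [D_of_fun] is its membership in the set it is chosen from. The set is
    inhabited because approximations in L^p are Cauchy in D; the bound then holds for any member, by
    passing through the sequence that the membership provides. One constant serves all [phi]. *)
Lemma Ddst_D_of_fun : exists2 C : R, 0 < C & forall phi, step_approximable phi ->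
  forall h (dl : R), 0 < dl -> (Vnorm mu p (fun r => step_val h r - phi r)%R <= dl%:E)%E ->
  Ddst (Dstep K h) (D_of_fun K p phi) <= C * dl.
Proof.
have [C C0 HC] := step_dst_le_Lp hV sepV alpha0 alpha_half hB.
exists C => // phi [[mphi nphi] aphi] h dl dl0 hdl.
have a20 : 0 < 1 + 2 * alpha by have := alpha0; lra.
have p1 : 1 <= p by rewrite ler_pdivlMr// mul1r; have := alpha_half; lra.
have dst_le f g (a b : R) : 0 < a -> 0 < b ->
    (Vnorm mu p (fun r => step_val f r - phi r)%R <= a%:E)%E ->
    (Vnorm mu p (fun r => step_val g r - phi r)%R <= b%:E)%E -> step_dst K f g <= C * (a + b).
  move=> ha hb fa gb; apply: HC; first exact: addr_gt0.
  have mf := measurable_step_val sepV f; have mg := measurable_step_val sepV g.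
  apply: le_trans (@Vnorm_dist_triangle _ _ _ mu V sepV _ (step_val f) phi (step_val g) p1 mf mphi mg) _.
  by rewrite EFinD leeD// Vnorm_sub_sym.
have /choice[g gP] n : exists g, (Vnorm mu p (fun r => step_val g r - phi r)%R <= n.+1%:R^-1%:E)%E.
  by apply: aphi; rewrite invr_gt0 ltr0n.
have cg (eps : R) : 0 < eps -> exists N, forall m n,
    (N <= m)%N -> (N <= n)%N -> (step_dist K (g m) (g n) < eps%:E)%E.
  move=> eps0; have := near_infty_natSinv_lt (PosNum (divr_gt0 eps0 (mulr_gt0 (ltr0n R 2) C0))).
  move=> [N _ NP]; exists N => m n Nm Nn; rewrite distE lte_fin.
  have := dst_le (g m) (g n) _ _ _ _ (gP m) (gP n).
  rewrite !invr_gt0 !ltr0n => /(_ isT isT)/le_lt_trans; apply.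
  have /= := NP m Nm; have /= := NP n Nn; rewrite !ltr_pdivlMr ?mulr_gt0//.
  set x := _^-1; set y := _^-1; nra.
have [_ [h' [h'phi h'D]]] : [set F : Dspace V K | inLp mu p phi /\
    exists h : nat -> stepfun V,
      Vnorm mu p (fun r => step_val (h n) r - phi r) @[n --> \oo] --> 0%E /\
      Ddist (Dstep K (h n)) F @[n --> \oo] --> 0%E] (D_of_fun K p phi).
  (* The class of the sequence [g] witnesses that the choice is made from a nonempty set. *)
  apply: (@xgetI _ _ _ (DSpace cg)); split=> //; exists g; split.
    apply/ecvg0P => [n|eps eps0]; first exact: Vnorm_ge0.
    have [N _ NP] := near_infty_natSinv_lt (PosNum eps0).
    exists N => // n /= Nn; apply: le_trans (gP n) _.
    by rewrite lee_fin; apply: ltW; exact: NP.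
  apply/ecvg0P => [n|eps eps0]; first by rewrite DdistE lee_fin Ddst_ge0.
  have [N NP] := Ddst_seq (DSpace cg) eps0.
  by exists N => // n /= Nn; rewrite DdistE lee_fin; exact: NP.
move/ecvg0P : h'phi => /(_ (fun n => Vnorm_ge0 _ _ _)) h'phi.
move/ecvg0P : h'D => /(_ _)/wrap[n|h'D]; first by rewrite DdistE lee_fin Ddst_ge0.
apply/ler_addgt0Pr => eps eps0.
(* The error [eta] is met twice, once multiplied by [C] through the L^p bound and once directly in
   D. *)
have eta0 : 0 < eps / (C + 1) by rewrite divr_gt0// addr_gt0.
have [n []] := filter_ex (filterI (h'phi _ eta0) (h'D _ eta0)).
rewrite DdistE lee_fin => n1 n2.
apply: le_trans (Ddst_triangle _ (Dstep K (h' n)) _) _; rewrite Ddst_step.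
have := dst_le _ _ _ _ dl0 eta0 hdl n1.
have : (C + 1) * (eps / (C + 1)) = eps by field; rewrite gt_eqF// addr_gt0.
lra.
Qed.

Lemma inLp_step_int k h : J k -> inLp P 2 (step_int (fun t => B t (e k)) h).
Proof.
move=> Jk; split; first exact: (measurable_step_int sepV e hB).
rewrite (_ : step_int _ h = fun w => step_int (fun t => B t (e k)) h w -
    step_int (fun t => B t (e k)) (step0 V) w).
  by rewrite (step_int_isometry1 hV he alpha0 alpha_half hB)// ltry.
by apply/funext => w; rewrite step_int0 subr0.
Qed.

(** The same scheme as for [D_of_fun]: the set of candidates is inhabited because the isometry and
    the completeness of L^2 give a limit, and membership yields the approximation. *)
Lemma wiener_int_approx k F eps : J k -> 0 < eps ->
  inLp P 2 (wiener_int P (fun t => B t (e k)) F) /\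
  exists h, Ddst (Dstep K h) F <= eps /\
    (Vnorm P 2 (fun w => step_int (fun t => B t (e k)) h w -
       wiener_int P (fun t => B t (e k)) F w)%R <= eps%:E)%E.
Proof.
move=> Jk eps0.
have [Y [LY FY]] : exists Y, inLp P 2 Y /\ (forall e', 0 < e' -> exists N, forall n, (N <= n)%N ->
    (Vnorm P 2 (fun w => step_int (fun t => B t (e k)) (F n) w - Y w)%R <= e'%:E)%E).
  apply: (L2_complete sepV) => [n|e' e'0]; first exact: inLp_step_int.
  have [N FN] := Dseq_cauchy_le F e'0; exists N => m n Nm Nn.
  by rewrite (step_int_isometry1 hV he alpha0 alpha_half hB)// lee_fin; exact: FN.
have [LW [h [hF hW]]] : [set X : Omega -> V | inLp P 2 X /\
    exists h : nat -> stepfun V,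
      Ddist (Dstep K (h n)) F @[n --> \oo] --> 0%E /\
      Vnorm P 2 (fun w => step_int (fun t => B t (e k)) (h n) w - X w) @[n --> \oo] --> 0%E]
    (wiener_int P (fun t => B t (e k)) F).
  apply: (@xgetI _ _ _ Y); split => //; exists F; split.
    apply/ecvg0P => [n|e' e'0]; first by rewrite DdistE lee_fin Ddst_ge0.
    have [N NP] := Ddst_seq F e'0.
    by exists N => // n /= Nn; rewrite DdistE lee_fin; exact: NP.
  apply/ecvg0P => [n|e' e'0]; first exact: Vnorm_ge0.
  by have [N NP] := FY _ e'0; exists N => // n /= Nn; exact: NP.
split => //.
move/ecvg0P : hF => /(_ _)/wrap[n|hF]; first by rewrite DdistE lee_fin Ddst_ge0.
move/ecvg0P : hW => /(_ (fun n => Vnorm_ge0 _ _ _)) hW.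
have [n []] := filter_ex (filterI (hF _ eps0) (hW _ eps0)).
by rewrite DdistE lee_fin => n1 n2; exists (h n).
Qed.

(** The integral is defined only up to null sets, so the agreement with [step_int] is expressed by
    an arbitrarily small L^2 distance. *)
Lemma wiener_int_step k h : J k -> forall eps, 0 < eps ->
  (Vnorm P 2 (fun w => step_int (fun t => B t (e k)) h w -
       wiener_int P (fun t => B t (e k)) (Dstep K h) w)%R <= eps%:E)%E.
Proof.
move=> Jk eps eps0; have eps20 : 0 < eps / 2 by rewrite divr_gt0.
have [[mW _] [g [gh gW]]] := wiener_int_approx (Dstep K h) Jk eps20.
have mh f := measurable_step_int sepV e hB k f.
apply: le_trans (Vnorm_dist_triangle P sepV _ (mh h) (mh g) mW) _; first by lra.
rewrite [eps]splitr EFinD leeD// (step_int_isometry1 hV he alpha0 alpha_half hB)// lee_fin.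
by rewrite step_dstC -Ddst_step.
Qed.

Definition truncate N (g : nat -> Dspace V K) k := if (k < N)%N then g k else D0 V K.

Lemma measurable_elem_int N (g : nat -> Dspace V K) : measurable_fun setT (elem_int P J e B N g : Omega -> borel V).
Proof.
apply: (measurable_fun_vector_sum sepV) => k kJ.
by have [[]] := wiener_int_approx (g k) (set_mem kJ) ltr01.
Qed.

Lemma measurable_sum_step_int L (a : nat -> stepfun V) : measurable_fun setT
  (fun w => \sum_(k < L | (k : nat) \in J) step_int (fun t => B t (e k)) (a k) w : borel V).
Proof.
apply: (measurable_fun_vector_sum sepV) => k kJ.
exact: (measurable_step_int sepV e hB).
Qed.

Lemma norm_wiener_step_sum_le N (g : nat -> Dspace V K) (h : nat -> stepfun V) c : 0 <= c ->
  (forall k, (k < N)%N -> J k -> (Vnorm P 2 (fun w => wiener_int P (fun t => B t (e k)) (g k) w -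
    step_int (fun t => B t (e k)) (h k) w)%R <= c%:E)%E) ->
  (Vnorm P 2 (fun w => \sum_(k < N | (k : nat) \in J)
    (wiener_int P (fun t => B t (e k)) (g k) w - step_int (fun t => B t (e k)) (h k) w))%R
   <= (N%:R * c)%:E)%E.
Proof.
move=> c0 ghc; pose D k w := wiener_int P (fun t => B t (e k)) (g k) w -
  step_int (fun t => B t (e k)) (h k) w.
have mD k : k \in J -> measurable_fun setT (D k : Omega -> borel V).
  move=> kJ; apply: (measurable_fun_vectorB sepV); last exact: (measurable_step_int sepV e hB).
  by have [[]] := wiener_int_approx (g k) (set_mem kJ) ltr01.
have p1 : 1 <= 2 :> R by lra.
apply: le_trans (@Vnorm_sum_le _ _ _ P V sepV 2 _ (index_enum 'I_N) (fun k => (k : nat) \in J)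
  (fun k => D k) p1 _) _; first by move=> k; exact: mD.
apply: (@le_trans _ _ (\sum_(k < N) c%:E)%E); last by rewrite sumEFin sumr_const card_ord mulr_natl.
rewrite big_mkcond; apply: lee_sum => k _; case: ifPn => kJ; last by rewrite lee_fin.
by apply: ghc => //; exact: set_mem.
Qed.

(** The approximating sum runs up to a length [L] that may exceed [N], with zero step functions as
    padding, so that elementary operators of different lengths can be compared over one index
    range. *)
Lemma elem_int_approx N L (g : nat -> Dspace V K) eta : (N <= L)%N -> 0 < eta ->
  exists a : nat -> stepfun V, (forall k, Ddst (Dstep K (a k)) (truncate N g k) <= eta) /\
    (Vnorm P 2 (fun w => elem_int P J e B N g w -
      \sum_(k < L | (k : nat) \in J) step_int (fun t => B t (e k)) (a k) w)%R <= (N%:R * eta)%:E)%E.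
Proof.
move=> NL eta0.
have /choice[a aP] k : exists f, [/\ Ddst (Dstep K f) (truncate N g k) <= eta,
    (k < N)%N -> J k -> (Vnorm P 2 (fun w => step_int (fun t => B t (e k)) f w -
       wiener_int P (fun t => B t (e k)) (g k) w)%R <= eta%:E)%E &
    (N <= k)%N -> f = step0 V].
  rewrite /truncate; case: ltnP => kN; last first.
    by exists (step0 V); split => //; rewrite Ddst_refl ltW.
  have [Jk|nJk] := pselect (J k).
    by have [_ [f [f1 f2]]] := wiener_int_approx (g k) Jk eta0; exists f.
  by have [f fP] := Ddst_approx (g k) eta0; exists f.
exists a; split => [k|]; first by have [] := aP k.
rewrite (_ : (fun w => _) = fun w => \sum_(k < N | (k : nat) \in J)
  (wiener_int P (fun t => B t (e k)) (g k) w - step_int (fun t => B t (e k)) (a k) w)); last first.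
  apply/funext => w; rewrite sumrB; congr (_ - _).
  rewrite [in RHS](big_ord_widen_cond L (fun k => k \in J)
    (fun k => step_int (fun t => B t (e k)) (a k) w))//.
  rewrite [LHS](bigID (fun k : 'I_L => (k < N)%N))/= [X in _ + X]big1 ?addr0// => k /andP[_].
  by rewrite -leqNgt => Nk; have [_ _ ->] := aP k; rewrite ?step_int0.
apply: norm_wiener_step_sum_le => [|k kN Jk]; first exact: ltW.
by rewrite Vnorm_sub_sym; have [_ + _] := aP k; exact.
Qed.

(** The isometry for elementary operators with a loss of a factor 3, harmless for limits. It is
    deduced from the exact isometry on step functions. *)
Lemma elem_int_dist N M L (g g' : nat -> Dspace V K) c : 0 < c -> (N <= L)%N -> (M <= L)%N ->
  \sum_(k < L | (k : nat) \in J) Ddst (truncate N g k) (truncate M g' k) ^+ 2 <= c ^+ 2 ->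
  (Vnorm P 2 (fun w => elem_int P J e B N g w - elem_int P J e B M g' w)%R <= (3 * c)%:E)%E.
Proof.
(* With this [eta] each replacement of an elementary integral by step integrals costs at most c / 4,
   and the step integrals are then within 2 c of each other. *)
move=> c0 NL ML gc; pose eta := c / (4 * L.+1%:R).
have L0 : 0 < L.+1%:R :> R by rewrite ltr0n.
have eta0 : 0 < eta by rewrite divr_gt0// mulr_gt0.
have etaL : 4 * (L.+1%:R * eta) = c by rewrite /eta; field; rewrite gt_eqF.
have [a [a1 a2]] := elem_int_approx g NL eta0.
have [b [b1 b2]] := elem_int_approx g' ML eta0.
have mg := measurable_elem_int N g; have mg' := measurable_elem_int M g'.
have ma := measurable_sum_step_int L a; have mb := measurable_sum_step_int L b.
have p1 : 1 <= 2 :> R by lra.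
apply: le_trans (Vnorm_dist_triangle P sepV p1 mg ma mg') _.
rewrite (_ : (3 * c)%:E = ((c / 4) + ((2 * c) + (3 / 4 * c)))%:E); last by congr EFin; lra.
have le4 n : (n <= L)%N -> n%:R * eta <= c / 4.
  move=> nL; have : n%:R * eta <= L.+1%:R * eta by rewrite ler_pM2r// ler_nat leqW.
  lra.
rewrite 2!EFinD leeD//; first by apply: le_trans a2 _; rewrite lee_fin le4.
apply: le_trans (Vnorm_dist_triangle P sepV p1 ma mb mg') _.
rewrite leeD//; last first.
  rewrite Vnorm_sub_sym; apply: le_trans b2 _; rewrite lee_fin; apply: le_trans (le4 _ ML) _; lra.
rewrite (_ : (fun w => _) = fun w => \sum_(k < L | (k : nat) \in J)
  (step_int (fun t => B t (e k)) (a k) w - step_int (fun t => B t (e k)) (b k) w)); last first.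
  by apply/funext => w; rewrite sumrB.
rewrite (step_int_isometry hV he alpha0 alpha_half hB) lee_fin.
rewrite -(@ger0_norm _ (2 * c)) ?mulr_ge0// ?(ltW c0)// -sqrtr_sqr ler_wsqrtr//.
apply: (@le_trans _ _ (2 * \sum_(k < L | (k : nat) \in J)
    Ddst (truncate N g k) (truncate M g' k) ^+ 2 + \sum_(k < L) 8 * eta ^+ 2)).
  rewrite mulr_sumr [X in _ <= _ + X](bigID (fun k : 'I_L => (k : nat) \in J))/= addrA -big_split/=.
  apply: ler_wpDr.
    by apply: sumr_ge0 => k _; rewrite mulr_ge0// sqr_ge0.
  apply: ler_sum => k _; set x := Ddst _ _.
  have x0 : 0 <= x by exact: Ddst_ge0.
  have y0 := step_dst_ge0 K (a k) (b k).
  have : step_dst K (a k) (b k) <= x + 2 * eta.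
    rewrite -Ddst_step.
    have t1 := Ddst_triangle (Dstep K (a k)) (truncate N g k) (Dstep K (b k)).
    have t2 := Ddst_triangle (truncate N g k) (truncate M g' k) (Dstep K (b k)).
    have e1 := a1 k; have e2 := b1 k; rewrite DdstC in e2; rewrite -/x in t2; lra.
  move=> yx; apply: (@le_trans _ _ ((x + 2 * eta) ^+ 2)).
    by rewrite ler_pXn2r// nnegrE ?addr_ge0 ?mulr_ge0// ltW.
  by have := sqr_ge0 (x - 2 * eta); rewrite !expr2; lra.
rewrite sumr_const card_ord -mulr_natl.
have : L%:R * eta <= c / 4 by exact: le4.
have Le0 : 0 <= L%:R * eta by rewrite mulr_ge0// ltW.
have : eta <= c / 4 by have := le4 1%N; nra.
nra.
Qed.

Lemma elem_hs_dist_le N (g : nat -> Dspace V K) (G : U -> Dspace V K) c : 0 <= c ->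
  (elem_hs_dist J e N g G <= c%:E)%E <->
  forall M, \sum_(k < M | (k : nat) \in J) Ddst (truncate N g k) (G (e k)) ^+ 2 <= c ^+ 2.
Proof.
move=> c0; rewrite /elem_hs_dist.
have -> : (\esum_(k in J) (Ddist (if (k < N)%N then g k else D0 V K) (G (e k)) `^ 2) =
    \esum_(k in J) (Ddst (truncate N g k) (G (e k)) ^+ 2)%:E)%E.
  apply: eq_esum => k _; rewrite DdistE poweR_EFin powR_mulrn//; exact: Ddst_ge0.
by apply: esum_sqrt_le => // k; exact: sqr_ge0.
Qed.

(** The only access to [cyl_int] in the sequel. The truncations of [G] have integrals that are
    Cauchy in L^2, so the choice is from a nonempty set. Every large [N] is allowed, which lets two
    integrals be approximated with the same number of coordinates; [eta] may depend on [N]. *)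
Lemma cyl_int_approx (G : U -> Dspace V K) :
  (\esum_(k in J) (Ddst (D0 V K) (G (e k)) ^+ 2)%:E < +oo)%E ->
  inLp P 2 (cyl_int P J e B G) /\
  forall eps, 0 < eps -> exists N1, forall N, (N1 <= N)%N ->
    exists2 eta : R, 0 < eta & forall h : nat -> stepfun V,
    (forall k, (k < N)%N -> J k -> Ddst (Dstep K (h k)) (G (e k)) <= eta) ->
    (Vnorm P 2 (fun w => cyl_int P J e B G w -
      \sum_(k < N | (k : nat) \in J) step_int (fun t => B t (e k)) (h k) w)%R <= eps%:E)%E.
Proof.
move=> Goo; pose D k := G (e k); pose a k := Ddst (D0 V K) (D k) ^+ 2.
have a0 k : 0 <= a k by exact: sqr_ge0.
have tail c : 0 < c -> exists N, forall M, \sum_(k < M | ((k : nat) \in J) && (N <= k)%N) a k <= c ^+ 2.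
  by move=> c0; apply: esum_nat_tail; rewrite ?exprn_gt0.
have truncD N k : Ddst (truncate N D k) (D k) ^+ 2 = if (N <= k)%N then a k else 0.
  by rewrite /truncate; case: ltnP => // _; rewrite Ddst_refl expr0n.
have p1 : 1 <= 2 :> R by lra.
have [Y [LY DY]] : exists Y, inLp P 2 Y /\ (forall c, 0 < c -> exists N, forall n, (N <= n)%N ->
    (Vnorm P 2 (fun w => elem_int P J e B n D w - Y w)%R <= c%:E)%E).
  apply: (L2_complete sepV) => [n|c c0].
    split; first exact: measurable_elem_int.
    have [b [_ b2]] := elem_int_approx D (leqnn n) ltr01.
    have mb := measurable_sum_step_int n b.
    rewrite (_ : elem_int P J e B n D = fun w => (elem_int P J e B n D w -
        \sum_(k < n | (k : nat) \in J) step_int (fun t => B t (e k)) (b k) w) +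
        \sum_(k < n | (k : nat) \in J) step_int (fun t => B t (e k)) (b k) w); last first.
      by apply/funext => w; rewrite subrK.
    apply: le_lt_trans (Vnorm_add_le _ sepV p1 _ mb) _.
      by apply: (measurable_fun_vectorB sepV) => //; exact: measurable_elem_int.
    apply: lte_add_pinfty; first by apply: le_lt_trans b2 _; rewrite ltry.
    rewrite (_ : (fun w => _) = fun w => \sum_(k < n | (k : nat) \in J)
      (step_int (fun t => B t (e k)) (b k) w - step_int (fun t => B t (e k)) (step0 V) w)).
      by rewrite (step_int_isometry hV he alpha0 alpha_half hB n b (fun=> step0 V)) ltry.
    by apply/funext => w; apply: eq_bigr => k _; rewrite step_int0 subr0.
  have c30 : 0 < c / 3 by rewrite divr_gt0.
  have [N NP] := tail _ c30; exists N => m n Nm Nn.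
  rewrite (_ : c = 3 * (c / 3)); last by field.
  apply: (@elem_int_dist _ _ (maxn m n)) => //; rewrite ?leq_maxl ?leq_maxr//.
  apply: le_trans (NP (maxn m n)).
  rewrite [leRHS]big_mkcondr/=; apply: ler_sum => k _.
  rewrite /truncate; case: ltnP => km; case: ltnP => kn; rewrite ?Ddst_refl ?expr0n/=.
  - by case: ifP.
  - by rewrite (leq_trans Nn kn) DdstC.
  - by rewrite (leq_trans Nm km).
  - by case: ifP.
have [LX [Ns [g [gG gX]]]] : [set X : Omega -> V | inLp P 2 X /\
    exists (N : nat -> nat) (g : nat -> nat -> Dspace V K),
      elem_hs_dist J e (N n) (g n) G @[n --> \oo] --> 0%E /\
      Vnorm P 2 (fun w => elem_int P J e B (N n) (g n) w - X w)
        @[n --> \oo] --> 0%E] (cyl_int P J e B G).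
  apply: (@xgetI _ _ _ Y); split=> //; exists id, (fun=> D); split; last first.
    apply/ecvg0P => [n|c c0]; first exact: Vnorm_ge0.
    by have [N NP] := DY _ c0; exists N => // n /= Nn; exact: NP.
  apply/ecvg0P => [n|c c0]; first exact: poweR_ge0.
  have [N NP] := tail _ c0; exists N => // n /= Nn.
  apply/elem_hs_dist_le; first exact: ltW.
  move=> M; apply: le_trans (NP M); rewrite [leRHS]big_mkcondr/=; apply: ler_sum => k _.
  by rewrite -/(truncate n D k) truncD; case: ifP => [nk|_]; [rewrite (leq_trans Nn nk)|case: ifP].
move/ecvg0P : gG => /(_ (fun n => poweR_ge0 _ _)) gG.
move/ecvg0P : gX => /(_ (fun n => Vnorm_ge0 _ _ _)) gX.
(* The error is split as c + 9 c + c: from the integral to an elementary one, from there to the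
   elementary integral of the [h k], and from there to step integrals. The 9 is 3 times the 3 of
   [elem_int_dist]. *)
split=> // eps eps0; pose c := eps / 11; have c0 : 0 < c by rewrite divr_gt0.
have [N1 N1P] := tail _ c0; exists N1 => N N1N.
have [n []] := filter_ex (filterI (gG _ c0) (gX _ c0)) => gc Xc.
have /elem_hs_dist_le {}gc := gc; have {gc} gc := gc (ltW c0).
pose eta := c / N.+1%:R; have N0 : 0 < N.+1%:R :> R by rewrite ltr0n.
have eta0 : 0 < eta by rewrite divr_gt0.
have etaN : N.+1%:R * eta = c by rewrite /eta; field; rewrite gt_eqF.
exists eta => // h hD; pose H k := Dstep K (h k).
have mX := LX.1; have mE := measurable_elem_int (Ns n) (g n).
have mH := measurable_elem_int N H; have mh := measurable_sum_step_int N h.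
rewrite (_ : eps = c + (9 * c + c)); last by rewrite /c; field.
apply: le_trans (Vnorm_dist_triangle P sepV p1 mX mE mh) _.
rewrite 2!EFinD leeD//; first by rewrite Vnorm_sub_sym.
apply: le_trans (Vnorm_dist_triangle P sepV p1 mE mH mh) _; rewrite leeD//.
  rewrite (_ : 9 * c = 3 * (3 * c)); last by lra.
  have NnL := leq_maxl (Ns n) N; have NL := leq_maxr (Ns n) N; set L := maxn _ _ in NnL NL.
  apply: (@elem_int_dist _ _ L) => //; first by rewrite mulr_gt0.
  have e2N : N%:R * eta ^+ 2 <= c ^+ 2.
    have NN : N%:R <= N.+1%:R :> R by rewrite ler_nat.
    have N1' : 1 <= N.+1%:R :> R by rewrite ler1n.
    rewrite -etaN [leRHS]exprMn ler_wpM2r ?sqr_ge0// (le_trans NN)// expr2; nra.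
  (* The three summands are the distance to [G], the error of [h k] for [k < N], and the tail of [G]
     for [k >= N]. Each sums to at most 2 c^2, and 6 c^2 <= (3 c)^2. *)
  apply: (@le_trans _ _ (\sum_(k < L | (k : nat) \in J) (2 * Ddst (truncate (Ns n) (g n) k) (D k) ^+ 2 +
     2 * (if (k < N)%N then eta ^+ 2 else 0) + 2 * (if (N1 <= k)%N then a k else 0)))).
    apply: ler_sum => k kJ; set x := Ddst _ (D k).
    have := Ddst_triangle (truncate (Ns n) (g n) k) (D k) (truncate N H k).
    rewrite -/x (DdstC (D k)); set y := Ddst (truncate N H k) (D k); set z := Ddst _ _ => zxy.
    have x0 : 0 <= x by exact: Ddst_ge0.
    have y0 : 0 <= y by exact: Ddst_ge0.
    have z0 : 0 <= z by exact: Ddst_ge0.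
    have zz : z ^+ 2 <= 2 * x ^+ 2 + 2 * y ^+ 2.
      apply: (@le_trans _ _ ((x + y) ^+ 2)); first by rewrite ler_pXn2r// nnegrE addr_ge0.
      by have := sqr_ge0 (x - y); rewrite !expr2; lra.
    apply: le_trans zz _; rewrite -addrA lerD2l -mulrDr ler_pM2l//.
    rewrite /y /truncate; case: ltnP => kN.
      apply: ler_wpDr; first by case: ifP.
      rewrite ler_pXn2r// ?nnegrE ?Ddst_ge0// ?(ltW eta0)//.
      by apply: hD => //; exact: set_mem.
    by rewrite add0r (leq_trans N1N kN).
  rewrite !big_split/= -!mulr_sumr -!big_mkcondr/=.
  have := gc L; have := N1P L.
  have : \sum_(k < L | ((k : nat) \in J) && (k < N)%N) eta ^+ 2 <= N%:R * eta ^+ 2.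
    rewrite -(big_ord_widen_cond L (fun k => k \in J) (fun=> eta ^+ 2))//.
    rewrite sumr_const -[leLHS]mulr_natl; apply: ler_wpM2r; first exact: sqr_ge0.
    by rewrite ler_nat (leq_trans (max_card _))// card_ord.
  set s1 := \sum_(k < L | _) eta ^+ 2; set s2 := \sum_(k < L | _) a k => q1 q2 q3.
  rewrite (_ : (3 * c) ^+ 2 = 9 * c ^+ 2); last by ring.
  apply: (@le_trans _ _ (2 * c ^+ 2 + 2 * c ^+ 2 + 2 * c ^+ 2)).
    by rewrite !lerD// ler_pM2l// (le_trans q1).
  by have := sqr_ge0 c; lra.
rewrite (_ : (fun w => _) = fun w => \sum_(k < N | (k : nat) \in J)
  (wiener_int P (fun t => B t (e k)) (H k) w - step_int (fun t => B t (e k)) (h k) w)); last first.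
  by apply/funext => w; rewrite sumrB.
apply: le_trans (norm_wiener_step_sum_le (ltW eta0) _) _ => [k kN Jk|].
  by rewrite Vnorm_sub_sym; exact: wiener_int_step.
rewrite lee_fin -etaN ler_pM2r// ler_nat//.
Qed.

End completion.

(** * Time reversal *)

Section same_law.
Context {R : realType} d (Omega : measurableType d) (P : probability Omega R).
Context (V : normedModType R).

Lemma integral_law (f : V -> R) (M : R) (Z : Omega -> V) : continuous f -> (forall v, `|f v| <= M) ->
  measurable_fun setT (Z : Omega -> borel V) ->
  (\int[law P Z]_v (f v)%:E = (\int[P]_w f (Z w))%:E)%E.
Proof.
move=> cf fM mZ.
have mf : measurable_fun [set: borel V] (f : borel V -> R).
  by apply: (measurable_fun_real_comp cf); exact: measurable_id.
have ifZ : P.-integrable setT (fun w => (f (Z w))%:E).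
  apply: (@le_integrable _ _ _ P setT measurableT _ (cst M%:E)).
  - by apply/measurable_EFinP; exact: (measurable_fun_real_comp cf).
  - move=> w _; rewrite lee_fin [leRHS]ger0_norm//.
    exact: le_trans (normr_ge0 _) (fM point).
  - exact: finite_measure_integrable_cst.
rewrite /law (integral_pushforward mZ)//=; last first.
  by apply/measurable_EFinP.
by rewrite /Rintegral fineK//; exact: integrable_fin_num.
Qed.

Lemma law_probability (Y : Omega -> V) : measurable_fun setT (Y : Omega -> borel V) ->
  exists mu : probability (borel V) R, mu = law P Y :> (set (borel V) -> \bar R).
Proof. by move=> mY; exists (distribution P (mfun_Sub (mem_set mY))). Qed.

Lemma weak_cvg_expectation (X : R -> Omega -> V) (Y : Omega -> V) (nu : set (borel V) -> \bar R) :
  (forall t, 0 < t -> measurable_fun setT (X t : Omega -> borel V)) ->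
  measurable_fun setT (Y : Omega -> borel V) ->
  (forall (f : V -> R) (M : R), continuous f -> (forall v, `|f v| <= M) ->
    forall eps : R, 0 < eps -> exists2 T : R, 0 < T &
    forall t, T <= t -> `|\int[P]_w f (X t w) - \int[P]_w f (Y w)| <= eps) ->
  nu = law P Y -> weak_cvg (fun t => law P (X t)) nu.
Proof.
move=> mX mY XY -> f cf [M fM]; rewrite (integral_law cf fM mY).
have IX t : 0 < t -> (\int[law P (X t)]_v (f v)%:E = (\int[P]_w f (X t w))%:E)%E.
  by move=> t0; apply: (integral_law cf fM); exact: mX.
apply/fine_cvgP; split.
  near=> t; have t0 : 0 < t by near: t; exact: nbhs_pinfty_gt.
  by rewrite IX.
apply/cvgrPdist_le => eps eps0; have [T T0 TP] := XY f M cf fM eps eps0.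
near=> t; have Tt : T <= t by near: t; apply: nbhs_pinfty_ge; exact: num_real.
by rewrite /= IX ?(lt_le_trans T0)//= distrC; exact: TP.
Unshelve. all: by end_near. Qed.

Lemma same_law_expectation (f : V -> R) (M : R) (Z Z' : Omega -> V) : continuous f ->
  (forall v, `|f v| <= M) ->
  measurable_fun setT (Z : Omega -> borel V) -> measurable_fun setT (Z' : Omega -> borel V) ->
  same_law P (Z : Omega -> borel V) (Z' : Omega -> borel V) ->
  \int[P]_w f (Z w) = \int[P]_w f (Z' w).
Proof.
move=> cf fM mZ mZ' ZZ'; apply: EFin_inj.
rewrite -(integral_law cf fM mZ) -(integral_law cf fM mZ').
by apply: eq_measure_integral => A mA _; exact: ZZ'.
Qed.

End same_law.

Section reversal.
Context {R : realType} (V : normedModType R).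
Implicit Types h : stepfun V.

Lemma rev_time_incr t h j : (j < step_size h)%N ->
  t - step_time h (step_size h - j) < t - step_time h (step_size h - j.+1).
Proof.
move=> jn; rewrite ltrD2l ltrN2 -(subnSK jn).
by apply: step_incr; rewrite ltn_subrL (leq_ltn_trans _ jn).
Qed.

(** Reflection turns [a, b[ into ]t - b, t - a]; a [stepfun] needs the closed end on the left, so
    the values agree with those of the reflected function off the jump times only. *)
Definition step_rev t h := @StepFun R V (step_size h)
  (fun j => t - step_time h (step_size h - j))
  (fun j => step_coef h (step_size h - j.+1)) (@rev_time_incr t h).

Lemma step_rev_big (F : R -> R -> V -> V) t h :
  \sum_(j < step_size (step_rev t h))
    F (step_time (step_rev t h) j) (step_time (step_rev t h) j.+1) (step_coef (step_rev t h) j) =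
  \sum_(j < step_size h) F (t - step_time h j.+1) (t - step_time h j) (step_coef h j).
Proof.
rewrite [LHS](reindex_inj rev_ord_inj)/=; apply: eq_bigr => j _.
by rewrite subKn// subnSK// subKn// ltnW.
Qed.

Lemma step_val_rev t h r : (forall j, r <> step_time h j) ->
  step_val (step_rev t h) (t - r) = step_val h r.
Proof.
move=> rh; rewrite /step_val (step_rev_big (fun a b v => \1_(`[a, b[%classic) (t - r) *: v)).
apply: eq_bigr => j _; congr (_ *: _); rewrite !indicE; congr ((nat_of_bool _)%:R).
apply/idP/idP; rewrite !inE/= !in_itv/= lerD2l lerN2 ltrD2l ltrN2 => /andP[a b]; apply/andP; split.
- exact: ltW.
- by rewrite lt_neqAle a andbT; apply/eqP.
- by rewrite ltW.
- by rewrite lt_neqAle a andbT; apply/eqP => /esym; exact: rh.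
Qed.

End reversal.

Section reversal_norm.
Context {R : realType} (V : normedModType R) (sepV : separable V).
Local Notation mu := (@lebesgue_measure R).

Let measurable_norm_powR (p : R) f : measurable_fun [set: R] (f : R -> borel V) ->
  measurable_fun [set: R] (fun r => (`|f r| `^ p)%:E).
Proof.
move=> mf; apply/measurable_EFinP; apply: measurable_fun_powR.
exact: measurable_fun_vnorm.
Qed.

Lemma eq_Vnorm_countable (p : R) (D : set R) (f g : R -> V) : 0 < p -> countable D ->
  measurable_fun [set: R] (f : R -> borel V) -> measurable_fun [set: R] (g : R -> borel V) ->
  (forall r, ~ D r -> f r = g r) -> Vnorm mu p f = Vnorm mu p g.
Proof.
move=> p0 cD mf mg fg; have pn0 : p != 0 by rewrite gt_eqF.
have E h : Vnorm mu p h = _ := VnormE mu h pn0.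
rewrite (E _ f) (E _ g); apply: (congr1 (fun x => x `^ p^-1)%E) => {E}.
apply: ae_eq_integral => //; [exact: measurable_norm_powR|exact: measurable_norm_powR|].
exists D; split; [exact: countable_measurable|exact: countable_lebesgue_measure0|].
by move=> r /= nK; apply: contrapT => Dr; apply: nK => _; rewrite fg.
Qed.

Lemma Vnorm_reflection (p t : R) (f : R -> V) : 0 < p ->
  measurable_fun [set: R] (f : R -> borel V) ->
  Vnorm mu p (fun r => f (t - r)) = Vnorm mu p f.
Proof.
move=> p0 mf; have pn0 : p != 0 by rewrite gt_eqF.
have E h : Vnorm mu p h = _ := VnormE mu h pn0.
rewrite (E _ (fun r => f (t - r))) (E _ f); apply: (congr1 (fun x => x `^ p^-1)%E) => {E}.
have F0 r : (0 <= (`|f r| `^ p)%:E)%E by rewrite lee_fin powR_ge0.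
exact: (ge0_integral_reflection t (measurable_norm_powR p mf) F0).
Qed.

Lemma measurable_reflection (t : R) (f : R -> V) : measurable_fun [set: R] (f : R -> borel V) ->
  measurable_fun [set: R] ((fun r => f (t - r)) : R -> borel V).
Proof. by move=> mf; apply: (measurableT_comp mf); apply: measurable_funB. Qed.

(** The L^p norm ignores the countably many jump times and is invariant under reflection. Thus an
    approximation of phi(t - .) becomes, when reversed, an equally good approximation of phi. *)
Lemma Vnorm_step_rev (p t : R) (h : stepfun V) (phi : R -> V) : 0 < p ->
  measurable_fun [set: R] (phi : R -> borel V) ->
  Vnorm mu p (fun r => step_val (step_rev t h) r - phi r) =
  Vnorm mu p (fun r => step_val h r - phi (t - r)).
Proof.
move=> p0 mphi; pose f r := step_val (step_rev t h) r - phi r.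
have mf : measurable_fun [set: R] (f : R -> borel V).
  by apply: (measurable_fun_vectorB sepV) => //; exact: measurable_step_val.
apply: etrans (esym (Vnorm_reflection t p0 mf)) _.
apply: (@eq_Vnorm_countable p (range (step_time h)) (fun r => f (t - r)) (fun r => step_val h r - phi (t - r))) => //.
- by apply: sub_countable (card_image_le _ _) _; exact: countableP.
- exact: measurable_reflection.
- apply: (measurable_fun_vectorB sepV); [exact: measurable_step_val|exact: measurable_reflection].
- move=> r nr; rewrite /f step_val_rev// => j rj; apply: nr; by exists j.
Qed.

End reversal_norm.

Section law_reversal.
Context {R : realType} (U V : completeNormedModType R).
Context (ipU : {dot U for idfun}).
Context (sepV : separable V) (J : set nat) (e : nat -> U).
Context d (Omega : measurableType d) (P : probability Omega R).
Context (alpha : R) (K : R -> R -> R) (B : R -> U -> Omega -> R).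
Hypothesis hB : cylindrical_volterra P ipU alpha K B.
Hypotheses (Bstat : cyl_stationary P B) (Brefl : cyl_reflexive P B).

(** Reflexivity passes from (s, t) to (-t, -s), and stationarity translates by [c]. *)
Lemma increments_reversal n m (u : 'I_m -> U) (s t : 'I_n -> R) (c : R) :
  (forall i, s i < t i) ->
  same_law P (increments (cyl_vec B u) s t)
    (increments (cyl_vec B u) (fun i => c - t i) (fun i => c - s i)).
Proof.
move=> st A mA; rewrite (Brefl u st mA).
have st' i : - t i < - s i by rewrite ltrN2.
rewrite (Bstat u c st' mA); congr (P (_ @^-1` A)).
by congr (increments _ _ _); apply/funext => i; rewrite addrC.
Qed.

(** The joint law over all coordinates and all intervals is required. The pairs of a coordinate and
    an interval are flattened into one list, and both sums become the same measurable function [G]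
    of a vector of increments. *)
Lemma same_law_step_rev N (h : nat -> stepfun V) c :
  same_law P
    (fun w => \sum_(k < N | (k : nat) \in J) step_int (fun t => B t (e k)) (h k) w : borel V)
    (fun w => \sum_(k < N | (k : nat) \in J) step_int (fun t => B t (e k)) (step_rev c (h k)) w : borel V).
Proof.
pose L := [seq (k, j) | k : 'I_N <- [seq k : 'I_N <- index_enum 'I_N | (k : nat) \in J],
  j : nat <- iota 0 (step_size (h k))].
pose T := in_tuple L.
pose s i := step_time (h (tnth T i).1) (tnth T i).2.
pose t i := step_time (h (tnth T i).1) (tnth T i).2.+1.
have TL i : tnth T i \in L by exact: mem_tnth.
have st i : s i < t i.
  apply: step_incr; have /allpairsPdep[k [j [_ jn ->]]] := TL i.
  by move: jn; rewrite mem_iota.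
pose u (k : 'I_N) := e k.
pose G (x : (size L).-tuple (N.-tuple R)) : V :=
  \sum_(i < size L) tnth (tnth x i) (tnth T i).1 *: step_coef (h (tnth T i).1) (tnth T i).2.
have mG : measurable_fun setT (G : _ -> borel V).
  apply: (measurable_fun_vector_sum sepV) => i _; apply: measurable_fun_scaler.
  apply: (@measurableT_comp _ _ _ _ _ _ (fun y : N.-tuple R => tnth y (tnth T i).1)).
    exact: measurable_tnth.
  exact: measurable_tnth.
(* [a] and [b] select the upper and the lower time of each increment, so that one identity serves
   for the original and for the reversed sum. *)
have GE (a b : R -> R -> R) w : 
   \sum_(k < N | (k : nat) \in J) \sum_(j < step_size (h k))
     (B (a (step_time (h k) j) (step_time (h k) j.+1)) (e k) w -
      B (b (step_time (h k) j) (step_time (h k) j.+1)) (e k) w) *: step_coef (h k) j =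
   G (increments (cyl_vec B u) (fun i => b (s i) (t i)) (fun i => a (s i) (t i)) w).
  rewrite /G; under [RHS]eq_bigr do rewrite !tnth_mktuple.
  rewrite -(big_tnth _ _ L xpredT (fun x : 'I_N * nat =>
    (B (a (step_time (h x.1) x.2) (step_time (h x.1) x.2.+1)) (u x.1) w -
     B (b (step_time (h x.1) x.2) (step_time (h x.1) x.2.+1)) (u x.1) w) *: step_coef (h x.1) x.2)).
  rewrite big_allpairs_dep/= big_filter; apply: eq_bigr => k _.
  by rewrite -[X in iota 0 X]subn0 big_mkord.
move=> A mA.
have mGA : measurable (G @^-1` A) by rewrite -[X in measurable X]setTI; exact: mG.
pose I1 := increments (cyl_vec B u) s t.
pose I2 := increments (cyl_vec B u) (fun i => c - t i) (fun i => c - s i).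
have E : P (I1 @^-1` (G @^-1` A)) = P (I2 @^-1` (G @^-1` A)) := increments_reversal u c st mGA.
have E1 w : \sum_(k < N | (k : nat) \in J) step_int (fun t => B t (e k)) (h k) w = G (I1 w).
  by rewrite -(GE (fun _ b => b) (fun a _ => a)).
have E2 w : \sum_(k < N | (k : nat) \in J) step_int (fun t => B t (e k)) (step_rev c (h k)) w = G (I2 w).
  rewrite -(GE (fun a _ => c - a) (fun _ b => c - b)); apply: eq_bigr => k _.
  by rewrite /step_int (step_rev_big (fun a b v => (B b (e k) w - B a (e k) w) *: v)).
rewrite (_ : (fun w => _) = G \o I1); last by apply/funext => w /=; exact: E1.
rewrite (_ : (fun w => _) = G \o I2); last by apply/funext => w /=; exact: E2.
exact: E.
Qed.

Lemma expectation_step_rev (f : V -> R) (M : R) N (h : nat -> stepfun V) c :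
  continuous f -> (forall v, `|f v| <= M) ->
  \int[P]_w f (\sum_(k < N | (k : nat) \in J) step_int (fun t => B t (e k)) (h k) w) =
  \int[P]_w f (\sum_(k < N | (k : nat) \in J) step_int (fun t => B t (e k)) (step_rev c (h k)) w).
Proof.
move=> cf fM; apply: (same_law_expectation cf fM).
- exact: (measurable_sum_step_int sepV J e hB N h).
- exact: (measurable_sum_step_int sepV J e hB N (fun k => step_rev c (h k))).
- exact: same_law_step_rev.
Qed.

End law_reversal.

(** * Reverse Minkowski inequality for exponents below 2 *)

Section Lp_l2.
Context {R : realType}.

Lemma weighted_AMGM (x y th : R) : 0 <= x -> 0 <= y -> 0 < th < 1 ->
  x `^ (1 - th) * y `^ th <= (1 - th) * x + th * y.
Proof.
move=> x0 y0 /andP[th0 th1]; have th10 : 0 < 1 - th by lra.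
have := @conjugate_powR _ (x `^ (1 - th)) (y `^ th) (1 - th)^-1 th^-1 (powR_ge0 _ _) (powR_ge0 _ _).
rewrite !invr_gt0 !invrK -!powRrM !mulfV ?gt_eqF// !powRr1// => /(_ th10 th0).
rewrite subrK => /(_ erefl); lra.
Qed.

Lemma sq_powR (x y : R) : 0 <= x -> (x ^+ 2) `^ y = x `^ (2 * y).
Proof. by move=> x0; rewrite -powR_mulrn// -powRrM. Qed.

(** Hölder's inequality with exponents 2 / (2 - p) and 2 / p. It is obtained from the weighted
    arithmetic-geometric inequality for a_k^2 / A and phi_k^2 / h^2, both of which sum to at most 1;
    hence the separate cases [A = 0] and [h = 0]. *)
Lemma sum_weighted_powR_le (N : nat) (Q : pred 'I_N) (a phi : 'I_N -> R) (h p : R) :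
  0 < p < 2 -> (forall k, 0 <= a k) -> (forall k, 0 <= phi k) -> 0 <= h ->
  \sum_(k | Q k) phi k ^+ 2 <= h ^+ 2 ->
  \sum_(k | Q k) a k `^ (2 - p) * phi k `^ p <=
  (\sum_(k | Q k) a k ^+ 2) `^ (1 - p / 2) * h `^ p.
Proof.
move=> /andP[p0 p2] a0 phi0 h0 phih; set A := \sum_(k | Q k) a k ^+ 2.
have Ak k : Q k -> a k ^+ 2 <= A.
  by move=> Qk; rewrite /A (bigD1 k)//= lerDl sumr_ge0// => i _; exact: sqr_ge0.
have A0 : 0 <= A by apply: sumr_ge0 => k _; exact: sqr_ge0.
have th : 0 < p / 2 < 1 by apply/andP; split; lra.
have [A00|An0] := eqVneq A 0.
  rewrite big1 ?mulr_ge0 ?powR_ge0// => k Qk.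
  have := Ak k Qk; rewrite A00 => ak; have /eqP : a k ^+ 2 = 0 by apply/eqP; rewrite eq_le ak sqr_ge0.
  by rewrite expf_eq0/= => /eqP ->; rewrite powR0 ?mul0r// subr_eq0 gt_eqF.
have [h00|hn0] := eqVneq h 0.
  rewrite big1 ?mulr_ge0 ?powR_ge0// => k Qk.
  have /eqP : phi k ^+ 2 = 0.
    apply/eqP; rewrite eq_le sqr_ge0 andbT; apply: le_trans (_ : _ <= h ^+ 2) _; last by rewrite h00 expr0n.
    apply: le_trans phih; rewrite (bigD1 k)//= lerDl sumr_ge0// => i _; exact: sqr_ge0.
  by rewrite expf_eq0/= => /eqP ->; rewrite powR0 ?mulr0// gt_eqF.
have Ap : 0 < A by rewrite lt_neqAle eq_sym An0.
have hp : 0 < h ^+ 2 by rewrite exprn_gt0// lt_neqAle eq_sym hn0.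
set W := _ * _.
apply: (@le_trans _ _ (\sum_(k | Q k) W * ((1 - p / 2) * (a k ^+ 2 / A) + p / 2 * (phi k ^+ 2 / h ^+ 2)))).
  apply: ler_sum => k _.
  have x0 : 0 <= a k ^+ 2 / A by rewrite divr_ge0 ?sqr_ge0.
  have y0 : 0 <= phi k ^+ 2 / h ^+ 2 by rewrite divr_ge0 ?sqr_ge0.
  apply: le_trans (_ : W * ((a k ^+ 2 / A) `^ (1 - p / 2) * (phi k ^+ 2 / h ^+ 2) `^ (p / 2)) <= _).
    have E1 : a k `^ (2 - p) = A `^ (1 - p / 2) * (a k ^+ 2 / A) `^ (1 - p / 2).
      rewrite -powRM// mulrC divfK ?gt_eqF// sq_powR//; congr (_ `^ _); lra.
    have E2 : phi k `^ p = h `^ p * (phi k ^+ 2 / h ^+ 2) `^ (p / 2).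
      rewrite (_ : h `^ p = (h ^+ 2) `^ (p / 2)); last by rewrite sq_powR//; congr (_ `^ _); lra.
      rewrite -powRM ?sqr_ge0// mulrC divfK ?gt_eqF// sq_powR//; congr (_ `^ _); lra.
    by rewrite E1 E2 /W; lra.
  by rewrite ler_wpM2l ?weighted_AMGM// /W mulr_ge0 ?powR_ge0.
rewrite -mulr_sumr -[leRHS]mulr1 ler_wpM2l ?mulr_ge0 ?powR_ge0//.
rewrite big_split/= -!mulr_sumr -!mulr_suml -/A divff//.
have : (\sum_(i | Q i) phi i ^+ 2) / h ^+ 2 <= 1 by rewrite ler_pdivrMr// mul1r.
move: th => /andP[th0 th1]; nra.
Qed.

(* As [sum_k a_k^2 = int sum_k a_k^(2 - p) phi_k^p], the pointwise bound above gives
   [A <= A^(1 - p / 2) I^p] for [A = sum_k a_k^2]. *)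
Lemma sum_Lp_norm_sq_le d (T : measurableType d) (mu : {measure set T -> \bar R})
    (N : nat) (Q : pred 'I_N) (phi : 'I_N -> T -> R) (h : T -> R) (a : 'I_N -> R) (p I : R) :
  0 < p < 2 -> (forall k, measurable_fun setT (phi k)) -> measurable_fun setT h ->
  (forall k x, 0 <= phi k x) -> (forall x, 0 <= h x) -> (forall k, 0 <= a k) -> 0 <= I ->
  (forall x, \sum_(k | Q k) phi k x ^+ 2 <= h x ^+ 2) ->
  (forall k, Q k -> (\int[mu]_x (phi k x `^ p)%:E = (a k `^ p)%:E)%E) ->
  (\int[mu]_x (h x `^ p)%:E <= (I `^ p)%:E)%E ->
  \sum_(k | Q k) a k ^+ 2 <= I ^+ 2.
Proof.
move=> p02 mphi mh phi0 h0 a0 I0 phih Iphi Ih; have /andP[p0 p2] := p02.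
set A := \sum_(k | Q k) a k ^+ 2.
have A0 : 0 <= A by apply: sumr_ge0 => k _; exact: sqr_ge0.
have [->|An0] := eqVneq A 0; first exact: sqr_ge0.
have Ap : 0 < A by rewrite lt_neqAle eq_sym An0.
have mP k : measurable_fun setT (fun x => (phi k x `^ p)%:E).
  by apply/measurable_EFinP; apply: measurable_fun_powR; exact: mphi.
have AE : (A%:E = \int[mu]_x (\sum_(k | Q k) ((a k `^ (2 - p))%:E * (phi k x `^ p)%:E)))%E.
  under eq_integral do rewrite -big_filter.
  rewrite ge0_integral_sum//; first last.
  - by move=> k x _; rewrite -EFinM lee_fin mulr_ge0 ?powR_ge0.
  - by move=> k; exact: measurable_funeM.
  rewrite big_filter -sumEFin; apply: eq_bigr => k Qk.
  rewrite ge0_integralZl_EFin ?powR_ge0//; first last.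
  - by move=> x _; rewrite lee_fin powR_ge0.
  rewrite Iphi// -EFinM; congr EFin.
  have [->|ak0] := eqVneq (a k) 0; first by rewrite expr0n/= [0 `^ p]powR0 ?mulr0// gt_eqF.
  by rewrite -powRD ?subrK ?powR_mulrn//; apply/implyP => _; rewrite ak0.
have : (A%:E <= (A `^ (1 - p / 2) * I `^ p)%:E)%E.
  rewrite AE; apply: (@le_trans _ _ (\int[mu]_x ((A `^ (1 - p / 2))%:E * (h x `^ p)%:E))%E).
    have mh' : measurable_fun setT (fun x => (h x `^ p)%:E).
      by apply/measurable_EFinP; apply: measurable_fun_powR.
    apply: ge0_le_integral => //.
    - by move=> x _; apply: sume_ge0 => k _; rewrite -EFinM lee_fin mulr_ge0 ?powR_ge0.
    - under eq_fun do rewrite -big_filter.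
      by apply: emeasurable_sum => k; exact: measurable_funeM.
    - exact: measurable_funeM.
    - move=> x _; rewrite -EFinM; under eq_bigr do rewrite -EFinM.
      by rewrite sumEFin lee_fin; apply: sum_weighted_powR_le.
  rewrite ge0_integralZl_EFin ?powR_ge0//; first last.
  - by apply/measurable_EFinP; apply: measurable_fun_powR.
  - by move=> x _; rewrite lee_fin powR_ge0.
  by rewrite EFinM lee_pmul2l// lte_fin powR_gt0.
rewrite lee_fin => AI.
(* As a finite sum [A] is a finite positive number, so A^(1 - p/2) can be cancelled. *)
have {}AI : A `^ (p / 2) <= I `^ p.
  rewrite -(@ler_pM2l _ (A `^ (1 - p / 2))) ?powR_gt0// -powRD ?An0 ?implybT//.
  by rewrite subrK powRr1.
have := ge0_ler_powR (ltW (divr_gt0 (ltr0n R 2) p0)) _ _ AI.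
rewrite !nnegrE !powR_ge0 => /(_ isT isT).
rewrite -!powRrM mulrA [p / 2 * 2]divfK// divff ?gt_eqF// powRr1// mulrC divfK ?gt_eqF//.
by rewrite powR_mulrn.
Qed.

End Lp_l2.

(** * Orbits of the semigroup *)

Section semigroup.
Context {R : realType} (V : completeNormedModType R).
Context (S : R -> {linear V -> V}) (hS : c0_semigroup S).

(** Otherwise there are times s_n <= 1/(n + 1) at which the operator stretches some vector by more
    than n + 1. Strong continuity at 0 makes these operators pointwise bounded, and the
    Banach-Steinhaus theorem then contradicts the growth. *)
Lemma semigroup_locally_bounded : exists2 dl : R, 0 < dl & exists2 M, 1 <= M &
  forall s v, 0 <= s <= dl -> `|S s v| <= M * `|v|.
Proof.
have [cS S0 SD Sr] := hS; apply: contrapT => H.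
have {}H n : exists sv : R * V, 0 <= sv.1 <= n.+1%:R^-1 /\ n.+1%:R * `|sv.2| < `|S sv.1 sv.2|.
  apply: contrapT => nsv; apply: H; exists n.+1%:R^-1; first by rewrite invr_gt0 ltr0n.
  exists n.+1%:R; first by rewrite ler1n.
  move=> s v sn; rewrite leNgt; apply/negP => lt; apply: nsv; by exists (s, v).
have {H}[sv svP] := choice H.
pose F := [set f : V -> V | exists n, f = S (sv n).1].
have linF f : F f -> bounded_fun_norm f /\ linear f.
  move=> [n ->]; split; last exact: linearP.
  have s0 : 0 <= (sv n).1 by have [/andP[]] := svP n.
  have /linear_bounded_continuous/linear_boundedP/pinfty_ex_gt0[r r0 Sb] := cS _ s0.
  by move=> a; exists (r * a) => x xa; apply: le_trans (Sb x) _; rewrite ler_wpM2l// ltW.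
have ptF : pointwise_bounded F.
  move=> x; have /cvgrPdist_lt /(_ 1 ltr01) := Sr x.
  move=> [eta /= eta0 etaP].
  have [N _ NP] := near_infty_natSinv_lt (PosNum eta0).
  (* Past the rank [N] the vector [S s_n x] is within 1 of [x]; the finitely many earlier terms are
     covered by the sum. *)
  exists (`|x| + 1 + \sum_(n < N) `|S (sv n).1 x|) => _ [n ->].
  have sum0 m : 0 <= \sum_(n < m) `|S (sv n).1 x| by exact: sumr_ge0.
  have [nN|Nn] := ltnP n N.
    by rewrite (bigD1 (Ordinal nN))//= addrCA lerDl !addr_ge0// sumr_ge0.
  apply: ler_wpDr => //; have [/andP[s0 sn] _] := svP n.
  move: s0; rewrite le_eqVlt => /predU1P[<-|s0]; first by rewrite S0 lerDl.
  have : `|x - S (sv n).1 x| < 1.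
    apply: etaP => //=; rewrite sub0r normrN gtr0_norm//.
    by apply: le_lt_trans sn _; exact: NP.
  by have := lerB_dist (S (sv n).1 x) x; rewrite distrC; lra.
have [M MP] := Banach_Steinhauss linF ptF 1.
pose n := Num.truncn `|M|.
have Mn : M <= n.+1%:R.
  by apply: le_trans (ler_norm _) _; have /andP[_ /ltW] := truncn_itv (normr_ge0 M).
have [/andP[s0 _] lt] := svP n; move: lt; set v := (sv n).2; set s := (sv n).1.
have [->|v0] := eqVneq v 0; first by rewrite linear0 normr0 mulr0 ltxx.
have vp : 0 < `|v| by rewrite normr_gt0.
have := MP (S s) _ (`|v|^-1 *: v).
rewrite linearZ !normrZ normfV normr_id mulVf ?normr_eq0// lexx => /(_ _ isT).
rewrite ler_pdivrMl// => /(_ _)/wrap[]; first by exists n.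
move=> le1 /lt_le_trans /(_ le1); rewrite mulrC ltr_pM2l// => lt.
by have := lt_le_trans lt Mn; rewrite ltxx.
Qed.

Lemma semigroup_bounded T : exists2 M, 0 < M & forall s v, 0 <= s <= T -> `|S s v| <= M * `|v|.
Proof.
have [dl dl0 [M M1 MP]] := semigroup_locally_bounded.
have [cS S0 SD Sr] := hS.
have Mn n s v : 0 <= s <= n%:R * dl -> `|S s v| <= M ^+ n * `|v|.
  elim: n s v => [|n IH] s v.
    by rewrite mul0r => /andP[s0 s1]; rewrite (_ : s = 0) ?S0 ?expr0 ?mul1r//; apply/eqP; rewrite eq_le s1.
  move=> /andP[s0 sn]; have M0 : 0 <= M by rewrite (le_trans ler01).
  have [sd|ds] := leP s dl.
    apply: le_trans (MP s v _) _; first by rewrite s0.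
    by rewrite ler_wpM2r// exprS ler_peMr// exprn_ege1.
  rewrite -[s](subrK dl) addrC SD ?subr_ge0 ?(ltW dl0) ?(ltW ds)//.
  apply: le_trans (MP _ _ _) _; first by rewrite lexx ltW.
  rewrite exprS -mulrA ler_wpM2l//; apply: IH.
  by rewrite subr_ge0 ltW//= lerBlDr (le_trans sn)// mulrSr mulrDl mul1r.
pose n := (Num.truncn (T / dl)).+1; exists (M ^+ n); first by rewrite exprn_gt0// (lt_le_trans ltr01).
move=> s v /andP[s0 sT]; apply: Mn; rewrite s0/= (le_trans sT)//.
rewrite -ler_pdivrMr//; have [T0|T0] := leP 0 (T / dl).
  by have /andP[_ /ltW] := truncn_itv T0.
by rewrite (le_trans (ltW T0)).
Qed.

Lemma semigroup_right_continuous r x : 0 <= r -> forall eps, 0 < eps ->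
  exists2 eta, 0 < eta & forall s, r < s < r + eta -> `|S s x - S r x| <= eps.
Proof.
have [cS S0 SD Sr] := hS => r0 eps eps0.
have /cvgrPdist_lt /(_ _ eps0) := Sr (S r x).
move=> [eta /= eta0 etaP]; exists eta => // s /andP[rs sr].
have -> : S s x = S (s - r) (S r x) by rewrite -SD ?subrK// subr_ge0 ltW.
rewrite distrC; apply/ltW/etaP => /=; last by rewrite subr_gt0.
by rewrite sub0r normrN gtr0_norm ?subr_gt0// ltrBlDl.
Qed.

End semigroup.

(** * Approximation of right-continuous functions by step functions *)

Section riemann_step.
Context {R : realType} (V : normedModType R).

Lemma riemann_time_incr (T : {posnum R}) n j : (j < n.+1)%N ->
  T%:num * j%:R / n.+1%:R < T%:num * j.+1%:R / n.+1%:R.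
Proof. by move=> _; rewrite ltr_pM2r ?invr_gt0 ?ltr0n// ltr_pM2l// ltr_nat. Qed.

(* The values are sampled at right endpoints, where only right-continuity is needed. *)
Definition riemann_step (f : R -> V) (T : {posnum R}) n := @StepFun R V n.+1
  (fun j => T%:num * j%:R / n.+1%:R) (fun j => f (T%:num * j.+1%:R / n.+1%:R))
  (@riemann_time_incr T n).

Lemma riemann_stepE (f : R -> V) (T : {posnum R}) n r : 0 <= r < T%:num ->
  exists s, [/\ r < s, s <= T%:num, s <= r + T%:num / n.+1%:R & step_val (riemann_step f T n) r = f s].
Proof.
move=> /andP[r0 rT]; have n0 : 0 < n.+1%:R :> R by rewrite ltr0n.
have q0 : 0 <= r * n.+1%:R / T%:num by rewrite divr_ge0// mulr_ge0.
pose j := Num.truncn (r * n.+1%:R / T%:num).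
have /andP[jr rj] := truncn_itv q0; rewrite -/j in jr rj.
have {}jr : T%:num * j%:R / n.+1%:R <= r by rewrite ler_pdivrMr// mulrC -ler_pdivlMr.
have {}rj : r < T%:num * j.+1%:R / n.+1%:R by rewrite ltr_pdivlMr// [ltRHS]mulrC -ltr_pdivrMr.
have jn : (j < n.+1)%N.
  by rewrite -(@ltr_nat R) -(ltr_pM2l (gt0 T)) -ltr_pdivrMr//; exact: le_lt_trans jr rT.
exists (T%:num * j.+1%:R / n.+1%:R); split => //.
- by rewrite ler_pdivrMr// ler_pM2l// ler_nat.
- by rewrite -natr1 mulrDr mulr1 mulrDl lerD2r.
rewrite /step_val/= (bigD1 (Ordinal jn))//= big1 ?addr0.
  by rewrite indicE mem_set ?scale1r//= in_itv/= jr.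
move=> i ij; rewrite indicE memNset ?scale0r//= in_itv/= => /andP[ir ri].
have : (i < j.+1)%N.
  have := le_lt_trans ir rj; by rewrite ltr_pM2r ?invr_gt0// ltr_pM2l// ltr_nat.
have : (j < i.+1)%N.
  have := le_lt_trans jr ri; by rewrite ltr_pM2r ?invr_gt0// ltr_pM2l// ltr_nat.
rewrite !ltnS => ji ij'; move: ij; apply/negP; rewrite negbK; apply/eqP/val_inj/eqP.
by rewrite eqn_leq ij' ji.
Qed.

Lemma riemann_step_out (f : R -> V) (T : {posnum R}) n r : ~~ (0 <= r < T%:num) ->
  step_val (riemann_step f T n) r = 0.
Proof.
move=> rT; have n0 : 0 < n.+1%:R :> R by rewrite ltr0n.
rewrite /step_val/= big1// => i _; rewrite indicE memNset ?scale0r//= in_itv/=.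
move=> /andP[ir ri]; move: rT; apply/negP; rewrite negbK; apply/andP; split.
  by apply: le_trans ir; rewrite divr_ge0// mulr_ge0.
apply: lt_le_trans ri _; rewrite ler_pdivrMr// ler_pM2l// ler_nat; exact: ltn_ord.
Qed.

Lemma cvg_riemann_step (f : R -> V) (T : {posnum R}) r :
  (forall r, 0 <= r -> forall eps, 0 < eps ->
    exists2 eta, 0 < eta & forall s, r < s < r + eta -> `|f s - f r| <= eps) ->
  step_val (riemann_step f T n) r @[n --> \oo] --> (if 0 <= r < T%:num then f r else 0).
Proof.
move=> rcf; case: ifPn => rT; last first.
  rewrite (_ : (fun n => _) = cst 0); first exact: cvg_cst.
  by apply/funext => n; exact: riemann_step_out.
apply/cvgrPdist_le => eps eps0; have /andP[r0 _] := rT.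
have [eta eta0 etaP] := rcf r r0 eps eps0.
have Te : 0 < eta / T%:num by rewrite divr_gt0.
have [N _ NP] := near_infty_natSinv_lt (PosNum Te).
exists N => // n /= Nn; have [s [rs sT sr ->]] := riemann_stepE f n rT.
rewrite distrC; apply: etaP; rewrite rs/= (le_lt_trans sr)// ltrD2l mulrC -ltr_pdivlMr//.
exact: NP.
Qed.

End riemann_step.

Section step_approximation.
Context {R : realType} (V : normedModType R) (sepV : separable V).
Local Notation mu := (@lebesgue_measure R).

Context (f : R -> V).
Hypothesis rcf : forall r, 0 <= r -> forall eps, 0 < eps ->
  exists2 eta, 0 < eta & forall s, r < s < r + eta -> `|f s - f r| <= eps.

Lemma measurable_right_continuous (T : {posnum R}) :
  measurable_fun [set: R] ((fun r => if 0 <= r < T%:num then f r else 0) : R -> borel V).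
Proof.
apply: (measurable_fun_borel_cvg sepV (f_ := fun n => step_val (riemann_step f T n))).
  by move=> n; exact: measurable_step_val.
by move=> r; exact: cvg_riemann_step.
Qed.

(** Right-continuity gives pointwise convergence, and the p-th powers of the errors are dominated by
    (2 M)^p on [0, T[ and by 0 elsewhere. *)
Lemma step_approximation (T : {posnum R}) (p M : R) : 1 <= p ->
  (forall s, 0 <= s <= T%:num -> `|f s| <= M) -> forall dl, 0 < dl ->
  exists h, (Vnorm mu p (fun r => step_val h r - (if 0 <= r < T%:num then f r else 0))%R <= dl%:E)%E.
Proof.
move=> p1 fM dl dl0; have p0 : 0 < p by exact: lt_le_trans p1.
pose g r := if 0 <= r < T%:num then f r else 0.
have mg : measurable_fun [set: R] (g : R -> borel V) := measurable_right_continuous T.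
have M0 : 0 <= M by apply: le_trans (fM 0 _) => //; rewrite lexx/=.
pose D n r := step_val (riemann_step f T n) r - g r.
have mD n : measurable_fun [set: R] (fun r => (`|D n r| `^ p)%:E).
  apply/measurable_EFinP; apply: measurable_fun_powR; apply: measurable_fun_vnorm.
  by apply: (measurable_fun_vectorB sepV) => //; exact: measurable_step_val.
have DM n r : `|D n r| `^ p <= (2 * M) `^ p * \1_(`[0, T%:num[%classic) r.
  rewrite /D /g indicE; have [rT|rT] := boolP (0 <= r < T%:num).
    rewrite mem_set/=; last by rewrite in_itv.
    rewrite mulr1 ge0_ler_powR ?nnegrE// ?(ltW p0)// ?mulr_ge0//.
    have [s [rs sT _ ->]] := riemann_stepE f n rT; have /andP[r0 rT'] := rT.
    apply: le_trans (ler_normB _ _) _; rewrite mulr_natl mulr2n lerD//.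
      by apply: fM; rewrite sT andbT (le_trans r0)// ltW.
    by apply: fM; rewrite r0 ltW.
  by rewrite riemann_step_out// subrr normr0 powR0 ?gt_eqF// memNset ?mulr0//= in_itv/=; exact/negP.
have cvg0 : (\int[mu]_r (`|D n r| `^ p)%:E @[n --> \oo] --> 0)%E.
  have [] // := @dominated_convergence _ _ _ mu setT measurableT
    (fun n r => (`|D n r| `^ p)%:E) (cst 0%E) (fun r => ((2 * M) `^ p * \1_(`[0, T%:num[%classic) r)%:E).
  - apply: aeW => r _; apply/ecvg0P => [n|eps eps0]; first by rewrite lee_fin powR_ge0.
    have := @cvg_riemann_step _ _ f T r rcf => /cvgrPdist_le /(_ (eps `^ p^-1)).
    rewrite powR_gt0// => /(_ isT); apply: filterS => n; rewrite distrC => le1.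
    rewrite lee_fin -[leRHS](@powRr1 _ eps) ?(ltW eps0)// -(mulVf (lt0r_neq0 p0)) powRrM.
    by rewrite ge0_ler_powR ?nnegrE ?powR_ge0// ltW.
  - rewrite (_ : (fun r => _) = fun r => (((2 * M) `^ p)%:E * (\1_(`[0, T%:num[%classic) r)%:E)%E).
      by apply: integrableZl => //; exact: integrable_indic_itv.
    by apply/funext => r; rewrite EFinM.
  - apply: aeW => r n _; rewrite gee0_abs ?lee_fin ?powR_ge0//; exact: DM.
  by rewrite integral_cst// mul0e.
move/ecvg0P : cvg0 => /(_ _ (dl `^ p) _)/wrap[n||].
- by apply: integral_ge0 => r _; rewrite lee_fin powR_ge0.
- by rewrite powR_gt0.
move=> [n _ /(_ n (leqnn n))/= nP]; exists (riemann_step f T n).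
by rewrite Vnorm_le// ltW.
Qed.

End step_approximation.

Section tails.
Context {R : realType}.
Local Notation mu := (@lebesgue_measure R).

(** Dominated convergence along the integers finds [N]; monotonicity in the cut-off extends the
    bound to all real [t] beyond it. *)
Lemma integral_tail (G : R -> \bar R) : measurable_fun [set: R] G -> (forall r, 0 <= G r)%E ->
  (\int[mu]_r G r < +oo)%E -> forall eps : R, 0 < eps -> exists N : nat, forall t : R, N%:R <= t ->
  (\int[mu]_r (if (t <= r)%R then G r else 0) <= eps%:E)%E.
Proof.
move=> mG G0 Goo eps eps0.
have mI t : measurable_fun [set: R] (fun r => if (t <= r)%R then G r else 0%E).
  by apply: measurable_fun_ifT => //; exact: measurable_fun_ler.
have I0 t r : (0 <= if (t <= r)%R then G r else 0)%E by case: ifP.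
have cvg0 : (\int[mu]_r (if (n%:R <= r)%R then G r else 0) @[n --> \oo] --> 0)%E.
  have [] // := @dominated_convergence _ _ _ mu setT measurableT
    (fun n r => if (n%:R <= r)%R then G r else 0%E) (cst 0%E) G.
  - by move=> n; exact: mI.
  - apply: aeW => r _; apply/ecvg0P => [n|c c0]; first exact: I0.
    near=> n; have rn : (r < n%:R :> R)%R by near: n; exact: nbhs_infty_gtr.
    have -> : (n%:R <= r :> R)%R = false by rewrite leNgt rn.
    by rewrite lee_fin ltW.
  - apply/integrableP; split => //.
    by under eq_integral do rewrite gee0_abs//.
  - by apply: aeW => r n _; rewrite gee0_abs//; case: ifP.
  by rewrite integral_cst// mul0e.
move/ecvg0P : cvg0 => /(_ _ _ eps0)/wrap[n|]; first exact: integral_ge0.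
move=> [N _ /(_ N (leqnn N))/= NP]; exists N => t Nt.
apply: le_trans NP; apply: ge0_le_integral => //; [exact: mI|exact: mI|move=> r _].
by case: ifP => [tr|]; [rewrite (le_trans Nt tr)|case: ifP].
Unshelve. all: by end_near. Qed.

End tails.

Section trajectories.
Context {R : realType} (V : completeNormedModType R) (sepV : separable V).
Context (S : R -> {linear V -> V}) (hS : c0_semigroup S).
Local Notation mu := (@lebesgue_measure R).

(** The value at [r = 0] is 0 and not [x], because the Hilbert-Schmidt property is assumed for
    positive times only. *)
Definition traj x r : V := if 0 < r then S r x else 0.

(** The cut includes [t], so that the support ]0, t] is exactly the reflection of [0, t[. *)
Definition traj_upto t x r : V := if r <= t then traj x r else 0.

Definition traj_from t x r : V := if t <= r then traj x r else 0.

Lemma measurable_traj x : measurable_fun [set: R] (traj x : R -> borel V).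
Proof.
pose g r : V := if 0 <= r then S r x else 0.
have mg : measurable_fun [set: R] (g : R -> borel V).
  pose g_ n r : V := if 0 <= r < n.+1%:R then S r x else 0.
  apply: (measurable_fun_borel_cvg sepV (f_ := g_)) => [n|r].
    exact: (measurable_right_continuous sepV (f := fun r => S r x)
      (fun r r0 => semigroup_right_continuous hS x r0) (PosNum (ltr0Sn R n))).
  have [N _ NP] : \forall n \near \oo, r < n%:R by exact: nbhs_infty_gtr.
  apply: cvg_near_cst; exists N => // n /= Nn; rewrite /g_ /g.
  have -> : r < n.+1%:R by apply: lt_le_trans (NP n Nn) _; rewrite ler_nat.
  by rewrite andbT.
rewrite (_ : traj x = fun r => if 0 < r then g r else 0); last first.
  by apply/funext => r; rewrite /traj /g; case: ifP => // /ltW ->.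
apply: measurable_fun_ifT => //; exact: measurable_fun_ltr.
Qed.

Lemma measurable_traj_upto t x : measurable_fun [set: R] (traj_upto t x : R -> borel V).
Proof.
apply: measurable_fun_ifT => //; [exact: measurable_fun_ler|exact: measurable_traj].
Qed.

Lemma measurable_traj_from t x : measurable_fun [set: R] (traj_from t x : R -> borel V).
Proof.
apply: measurable_fun_ifT => //; [exact: measurable_fun_ler|exact: measurable_traj].
Qed.

Lemma traj_from0 x : traj_from 0 x = traj x.
Proof. by apply/funext => r; rewrite /traj_from /traj; case: ltP => [/ltW ->//|]; case: ifP. Qed.

Lemma norm_traj_upto_le t x r : `|traj_upto t x r| <= `|traj x r|.
Proof. by rewrite /traj_upto; case: ifP => // _; rewrite normr0. Qed.

Lemma traj_upto_reflection t x r :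
  \1_(`[0, t[%classic) r *: S (t - r) x = traj_upto t x (t - r).
Proof.
rewrite indicE /traj_upto /traj subr_gt0 gerBl; case: (boolP (r \in _)).
  by rewrite inE/= in_itv/= => /andP[-> ->]; rewrite scale1r.
rewrite notin_setE/= in_itv/= => /negP; rewrite negb_and scale0r => /orP[/negbTE -> //|/negbTE ->].
by case: ifP.
Qed.

Lemma traj_upto_approx (p t : R) x : 1 <= p -> 0 < t -> forall dl : R, 0 < dl ->
  exists h, (Vnorm mu p (fun r => step_val h r - traj_upto t x r)%R <= dl%:E)%E.
Proof.
move=> p1 t0 dl dl0; have p0 : 0 < p by exact: lt_le_trans p1.
have [M M0 MP] := semigroup_bounded hS t.
pose g r : V := if 0 <= r < t then S r x else 0.
have rcS := fun r r0 => @semigroup_right_continuous _ _ _ hS r x r0.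
have mg : measurable_fun [set: R] (g : R -> borel V) :=
  measurable_right_continuous sepV rcS (PosNum t0).
have [h hP] := @step_approximation _ _ sepV (fun r => S r x) rcS (PosNum t0) p (M * `|x|) p1
  (fun s => MP s x) dl dl0.
exists h; apply: le_trans hP; rewrite le_eqVlt; apply/orP; left; apply/eqP.
(* The cut on ]0, t] differs from the one on [0, t[ only at the two endpoints. *)
apply: (@eq_Vnorm_countable _ _ p [set 0; t]) => //.
- by apply: finite_set_countable; rewrite finite_setU.
- by apply: (measurable_fun_vectorB sepV); [exact: measurable_step_val|exact: measurable_traj_upto].
- by apply: (measurable_fun_vectorB sepV); [exact: measurable_step_val|exact: mg].
- move=> r /not_orP[/= r0 rt]; rewrite /traj_upto /traj /=.
  rewrite (lt_neqAle r t) (le_eqVlt 0 r).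
  move/eqP/negPf : r0; rewrite eq_sym => ->; move/eqP : rt => -> /=.
  by case: (0 < r); case: (r <= t).
Qed.

Context (alpha : R) (alpha0 : 0 < alpha) (alpha_half : alpha < 2^-1).
Local Notation p := (2 / (1 + 2 * alpha)).

Lemma exponent_bounds : 1 <= p /\ 0 < p < 2.
Proof.
have a20 : 0 < 1 + 2 * alpha by have := alpha0; lra.
split; first by rewrite ler_pdivlMr// mul1r; have := alpha_half; lra.
by rewrite divr_gt0//= ltr_pdivrMr//; have := alpha0; lra.
Qed.

Let p1 := exponent_bounds.1.
Let p0 : 0 < p. Proof. by have /andP[] := exponent_bounds.2. Qed.

Lemma Vnorm_traj_upto_le t x : (Vnorm mu p (traj_upto t x) <= Vnorm mu p (traj x))%E.
Proof.
apply: le_Vnorm => //; last exact: norm_traj_upto_le.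
- by apply: measurable_fun_vnorm; exact: measurable_traj_upto.
- by apply: measurable_fun_vnorm; exact: measurable_traj.
Qed.

Lemma Vnorm_traj_upto_sub_le t x :
  (Vnorm mu p (fun r => traj_upto t x r - traj x r)%R <= Vnorm mu p (traj_from t x))%E.
Proof.
have m1 := measurable_traj_upto t x; have m2 := measurable_traj x.
apply: le_Vnorm => //.
- by apply: measurable_fun_vnorm; exact: (measurable_fun_vectorB sepV m1 m2).
- by apply: measurable_fun_vnorm; exact: measurable_traj_from.
- move=> r; rewrite /traj_upto /traj_from; case: (leP r t) => [_|/ltW ->].
    by rewrite subrr normr0.
  by rewrite sub0r normrN.
Qed.

(** The integrand of [X_t] is the reflection of [traj_upto t x], so it is approximated by reversed
    step functions. *)
Lemma step_approximable_convolution t x : 0 < t -> (Vnorm mu p (traj x) < +oo)%E ->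
  step_approximable alpha (fun r => \1_(`[0, t[%classic) r *: S (t - r) x).
Proof.
move=> t0 xoo; have -> : (fun r => \1_(`[0, t[%classic) r *: S (t - r) x) = fun r => traj_upto t x (t - r).
  by apply/funext => r; exact: traj_upto_reflection.
have mu' := measurable_traj_upto t x; have mr := measurable_reflection t mu'.
split; [split|] => // [|dl dl0].
  have -> := Vnorm_reflection t p0 mu'.
  exact: le_lt_trans (Vnorm_traj_upto_le t x) xoo.
have [h hP] := traj_upto_approx x p1 t0 dl0; exists (step_rev t h).
have -> := Vnorm_step_rev sepV t h p0 mr.
rewrite (_ : (fun r => _) = fun r => step_val h r - traj_upto t x r)//.
by apply/funext => r; rewrite subKr.
Qed.

(** The orbit is cut at a time after which its L^p norm is small, and the bounded piece is
    approximated; each costs half of [dl]. *)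
Lemma step_approximable_traj x : (Vnorm mu p (traj x) < +oo)%E -> step_approximable alpha (traj x).
Proof.
move=> xoo; split; first by split => //; exact: measurable_traj.
move=> dl dl0; have dl20 : 0 < dl / 2 by rewrite divr_gt0.
pose G r := (`|traj x r| `^ p)%:E.
have mG : measurable_fun [set: R] G.
  apply/measurable_EFinP; apply: measurable_fun_powR.
  by apply: measurable_fun_vnorm; exact: measurable_traj.
have G0 r : (0 <= G r)%E by rewrite lee_fin powR_ge0.
have fin_x : Vnorm mu p (traj x) \is a fin_num by rewrite ge0_fin_numE// Vnorm_ge0.
have Goo : (\int[mu]_r G r < +oo)%E.
  have : (Vnorm mu p (traj x) <= (fine (Vnorm mu p (traj x)))%:E)%E by rewrite fineK.
  by rewrite Vnorm_le ?fine_ge0 ?Vnorm_ge0// => /le_lt_trans; apply; rewrite ltry.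
have dlp : 0 < (dl / 2) `^ p by rewrite powR_gt0.
have [N NP] := integral_tail mG G0 Goo dlp.
have T0 : 0 < N.+1%:R :> R by rewrite ltr0n.
have [h hP] := traj_upto_approx x p1 T0 dl20; exists h.
have mh := measurable_step_val sepV h.
have mu' := measurable_traj_upto N.+1%:R x; have mx := measurable_traj x.
apply: le_trans (@Vnorm_dist_triangle _ _ _ mu V sepV _ (step_val h) (traj_upto N.+1%:R x) (traj x) p1 mh mu' mx) _.
rewrite [dl]splitr EFinD leeD//; apply: le_trans (Vnorm_traj_upto_sub_le _ _) _.
rewrite Vnorm_le// ?(ltW dl20)//.
have NN : N%:R <= N.+1%:R :> R by rewrite ler_nat.
apply: le_trans (NP _ NN); rewrite le_eqVlt; apply/orP; left; apply/eqP.
apply: eq_integral => r _; rewrite /traj_from /G; case: ifP => // _.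
by rewrite normr0 powR0 ?gt_eqF.
Qed.

End trajectories.

Lemma Vnorm_integral {R : realType} d (T : measurableType d) (mu : {measure set T -> \bar R})
    (V : normedModType R) (p : R) (f : T -> V) : 0 < p -> (Vnorm mu p f < +oo)%E ->
  (\int[mu]_x (`|f x| `^ p)%:E = (fine (Vnorm mu p f) `^ p)%:E)%E.
Proof.
move=> p0; have pn0 : p != 0 by rewrite gt_eqF.
rewrite (VnormE mu f pn0); set I := (\int[mu]_x _)%E.
have I0 : (0 <= I)%E by apply: integral_ge0 => x _; rewrite lee_fin powR_ge0.
case: I I0 => [x|_|//]; last by rewrite poweRyr ?invr_eq0.
by rewrite lee_fin => x0 _; rewrite poweR_EFin/= -powRrM mulVf// powRr1.
Qed.

(** * Summability over the basis of the L^p norms of orbits *)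

Section hilbert_schmidt_trajectories.
Context {R : realType} (U V : completeNormedModType R) (sepV : separable V).
Context (J : set nat) (e : nat -> U).
Context (S : R -> {linear V -> V}) (hS : c0_semigroup S) (Phi : {linear U -> V}).
Context (alpha : R) (alpha0 : 0 < alpha) (alpha_half : alpha < 2^-1).
Local Notation mu := (@lebesgue_measure R).
Local Notation p := (2 / (1 + 2 * alpha)).
Hypothesis SPhi_hs : forall u : R, 0 < u -> (hs_norm J e (fun x => S u (Phi x)) < +oo)%E.
Hypothesis SPhi_int : (\int[mu]_(r in `]0%R, +oo[)
  (hs_norm J e (fun x => S r (Phi x)) `^ p) < +oo)%E.

Let p1 : 1 <= p := (exponent_bounds alpha0 alpha_half).1.
Let p02 : 0 < p < 2 := (exponent_bounds alpha0 alpha_half).2.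
Let p0 : 0 < p. Proof. by have /andP[] := p02. Qed.

Definition traj_hs r : \bar R := hs_norm J e (fun x => traj S (Phi x) r).

Lemma traj_hs_fin r : traj_hs r \is a fin_num.
Proof.
rewrite ge0_fin_numE ?poweR_ge0// /traj_hs /traj; have [r0|r0] := boolP (0 < r).
  exact: SPhi_hs.
rewrite /hs_norm (_ : \esum_(k in J) _ = 0)%E ?poweR0r ?ltry ?invr_eq0 ?pnatr_eq0//.
by apply: esum1 => k _; rewrite normr0 expr0n.
Qed.

Definition traj_hsr r : R := fine (traj_hs r).

Lemma traj_hsr_ge0 r : 0 <= traj_hsr r.
Proof. by apply: fine_ge0; exact: poweR_ge0. Qed.

Lemma sum_traj_le N r :
  \sum_(k < N | (k : nat) \in J) `|traj S (Phi (e k)) r| ^+ 2 <= traj_hsr r ^+ 2.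
Proof.
have : (traj_hs r <= (traj_hsr r)%:E)%E by rewrite fineK// traj_hs_fin.
by move/esum_sqrt_le => h; apply: h; [move=> k; exact: sqr_ge0|exact: traj_hsr_ge0].
Qed.

Lemma measurable_traj_hsr : measurable_fun [set: R] traj_hsr.
Proof.
have mE : measurable_fun [set: R] (fun r => \esum_(k in J) (`|traj S (Phi (e k)) r| ^+ 2)%:E)%E.
  rewrite (_ : (fun r => _) = fun r => \sum_(k <oo | k \in J) (`|traj S (Phi (e k)) r| ^+ 2)%:E)%E.
    apply: ge0_emeasurable_sum => [k r _ _|k _]; first by rewrite lee_fin sqr_ge0.
    apply/measurable_EFinP; apply: measurable_funX.
    by apply: measurable_fun_vnorm; exact: measurable_traj.
  apply/funext => r; rewrite nneseries_esum; last by move=> k _; rewrite lee_fin sqr_ge0.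
  by congr esum; apply/seteqP; split=> k /=; rewrite inE.
have mh : measurable_fun [set: R] traj_hs.
  exact: (measurableT_comp (measurable_poweR _) mE).
exact: (measurableT_comp (fine_measurable measurableT) mh).
Qed.

Lemma integral_traj_hsr : (\int[mu]_r (traj_hsr r `^ p)%:E < +oo)%E.
Proof.
apply: le_lt_trans SPhi_int; rewrite [leRHS]integral_mkcond le_eqVlt; apply/orP; left; apply/eqP.
apply: eq_integral => r _; rewrite patchE; case: ifPn.
  rewrite inE/= in_itv/= andbT => r0.
  rewrite -poweR_EFin fineK ?traj_hs_fin// /traj_hs /traj.
  by under eq_fun do rewrite r0.
rewrite notin_setE/= in_itv/= andbT => /negP r0.
rewrite /traj_hsr /traj_hs /hs_norm (_ : \esum_(k in J) _ = 0)%E.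
  by rewrite poweR0r ?invr_eq0 ?pnatr_eq0//= powR0 ?gt_eqF.
by apply: esum1 => k _; rewrite /traj (negPf r0) normr0 expr0n.
Qed.

Let measurable_hs_from t : measurable_fun [set: R] (fun r => if t <= r then traj_hsr r else 0).
Proof. by apply: measurable_fun_ifT => //; [exact: measurable_fun_ler|exact: measurable_traj_hsr]. Qed.

Lemma norm_traj_le k r : J k -> `|traj S (Phi (e k)) r| <= traj_hsr r.
Proof.
move=> Jk; rewrite -(@ler_pXn2r _ 2)// ?nnegrE ?traj_hsr_ge0//.
apply: le_trans (sum_traj_le k.+1 r).
rewrite (bigD1 ord_max)/=; last exact: mem_set.
by rewrite lerDl sumr_ge0// => i _; exact: sqr_ge0.
Qed.

Lemma Vnorm_traj_fin k : J k -> (Vnorm mu p (traj S (Phi (e k))) < +oo)%E.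
Proof.
move=> Jk; have I0 : (0 <= \int[mu]_r (traj_hsr r `^ p)%:E)%E.
  by apply: integral_ge0 => r _; rewrite lee_fin powR_ge0.
pose c := fine (\int[mu]_r (traj_hsr r `^ p)%:E)%E `^ p^-1.
have c0 : 0 <= c by exact: powR_ge0.
suff : (Vnorm mu p (traj S (Phi (e k))) <= c%:E)%E by move/le_lt_trans; apply; rewrite ltry.
rewrite Vnorm_le// /c -powRrM mulVf ?gt_eqF// powRr1 ?fine_ge0// fineK ?ge0_fin_numE ?integral_traj_hsr//.
have mx := measurable_traj sepV hS (Phi (e k)).
apply: ge0_le_integral => //.
- by apply/measurable_EFinP; apply: measurable_fun_powR; exact: measurable_fun_vnorm.
- by apply/measurable_EFinP; apply: measurable_fun_powR; exact: measurable_traj_hsr.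
- move=> r _; rewrite lee_fin ge0_ler_powR ?nnegrE ?traj_hsr_ge0 ?(ltW p0)//.
  exact: norm_traj_le.
Qed.

Lemma Vnorm_traj_from_fin t k : J k -> (Vnorm mu p (traj_from S t (Phi (e k))) < +oo)%E.
Proof.
move=> Jk; apply: le_lt_trans (Vnorm_traj_fin Jk).
apply: le_Vnorm => //.
- by apply: measurable_fun_vnorm; exact: measurable_traj_from.
- by apply: measurable_fun_vnorm; exact: measurable_traj.
- by move=> r; rewrite /traj_from; case: ifP => // _; rewrite normr0.
Qed.

(** The reverse Minkowski inequality with [h] the Hilbert-Schmidt norm cut off before [t]. The bound
    is the same for all [N]. *)
Lemma sum_Vnorm_traj_from_le t tau N : 0 <= tau ->
  (\int[mu]_r (if (t <= r)%R then (traj_hsr r `^ p)%:E else 0) <= (tau `^ p)%:E)%E ->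
  \sum_(k < N | (k : nat) \in J) fine (Vnorm mu p (traj_from S t (Phi (e k)))) ^+ 2 <= tau ^+ 2.
Proof.
move=> tau0 htau.
apply: (@sum_Lp_norm_sq_le _ _ _ mu N _ (fun k r => `|traj_from S t (Phi (e k)) r|)
  (fun r => if t <= r then traj_hsr r else 0) _ p) => //.
- by move=> k; apply: measurable_fun_vnorm; exact: measurable_traj_from.
- exact: measurable_hs_from.
- by move=> r; case: ifP => // _; exact: traj_hsr_ge0.
- by move=> k; apply: fine_ge0; exact: Vnorm_ge0.
- move=> r; rewrite /traj_from; case: ifP => _; first exact: sum_traj_le.
  by rewrite big1 ?sqr_ge0// => k _; rewrite normr0 expr0n.
- by move=> k kJ; apply: Vnorm_integral => //; apply: Vnorm_traj_from_fin; exact: set_mem.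
- apply: le_trans htau; rewrite le_eqVlt; apply/orP; left; apply/eqP.
  by apply: eq_integral => r _; case: ifP => // _; rewrite powR0 ?gt_eqF.
Qed.

Lemma traj_from_tail eps : 0 < eps -> exists T : nat, forall (t : R) N, T%:R <= t ->
  \sum_(k < N | (k : nat) \in J) fine (Vnorm mu p (traj_from S t (Phi (e k)))) ^+ 2 <= eps ^+ 2.
Proof.
move=> eps0; have mG : measurable_fun [set: R] (fun r => (traj_hsr r `^ p)%:E).
  by apply/measurable_EFinP; apply: measurable_fun_powR; exact: measurable_traj_hsr.
have G0 r : (0 <= (traj_hsr r `^ p)%:E)%E by rewrite lee_fin powR_ge0.
have ep : 0 < eps `^ p by rewrite powR_gt0.
have [T TP] := integral_tail mG G0 integral_traj_hsr ep.
by exists T => t N Tt; apply: sum_Vnorm_traj_from_le; [exact: ltW|exact: TP].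
Qed.

(** The case [t = 0] of the preceding bound; it is what makes the integrands Hilbert-Schmidt
    operators into D. *)
Lemma sum_Vnorm_traj_bounded : exists M : R, forall N,
  \sum_(k < N | (k : nat) \in J) fine (Vnorm mu p (traj S (Phi (e k)))) ^+ 2 <= M.
Proof.
have I0 : (0 <= \int[mu]_r (traj_hsr r `^ p)%:E)%E.
  by apply: integral_ge0 => r _; rewrite lee_fin powR_ge0.
pose c := fine (\int[mu]_r (traj_hsr r `^ p)%:E)%E `^ p^-1.
exists (c ^+ 2) => N.
have := @sum_Vnorm_traj_from_le 0 c N (powR_ge0 _ _).
rewrite {1}/c -powRrM mulVf ?gt_eqF// powRr1 ?fine_ge0// fineK ?ge0_fin_numE ?integral_traj_hsr//.
under eq_bigr do rewrite traj_from0.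
apply; apply: ge0_le_integral => //.
- by move=> r _; case: ifP => //; rewrite lee_fin powR_ge0.
- have := measurable_hs_from 0 => m0.
  rewrite (_ : (fun r => _) = fun r => ((if 0 <= r then traj_hsr r else 0) `^ p)%:E).
    by apply/measurable_EFinP; apply: measurable_fun_powR.
  by apply/funext => r; case: ifP => // _; rewrite powR0 ?gt_eqF.
- by apply/measurable_EFinP; apply: measurable_fun_powR; exact: measurable_traj_hsr.
- by move=> r _; case: ifP => // _; rewrite lee_fin powR_ge0.
Qed.

End hilbert_schmidt_trajectories.

(** * Convergence in law *)

Theorem proposition3p4 (R : realType)
    (U V : completeNormedModType R)
    (ipU : {dot U for idfun}) (ipV : {dot V for idfun})
    (hU : induces_norm ipU) (hV : induces_norm ipV)
    (sepU : separable U) (sepV : separable V)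
    (J : set nat) (e : nat -> U) (he : orthonormal_basis ipU J e)
    (alpha : R) (alpha0 : 0 < alpha) (alpha_half : alpha < 2^-1)
    (d : measure_display) (Omega : measurableType d) (P : probability Omega R)
    (K : R -> R -> R) (B : R -> U -> Omega -> R)
    (hB : cylindrical_volterra P ipU alpha K B)
    (S : R -> {linear V -> V}) (hS : c0_semigroup S)
    (domA : set V) (A : V -> V) (hA : is_generator S domA A)
    (Phi : {linear U -> V}) (cPhi : continuous Phi)
    (Bstat : cyl_stationary P B) (Brefl : cyl_reflexive P B)
    (SPhi_hs : forall u : R, 0 < u ->
       (hs_norm J e (fun x => S u (Phi x)) < +oo)%E)
    (SPhi_int : (\int[lebesgue_measure]_(r in `]0%R, +oo[)
       (hs_norm J e (fun x => S r (Phi x)) `^ (2 / (1 + 2 * alpha))) < +oo)%E) :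
  exists mu : probability (borel V) R,
    weak_cvg (fun t : R => law P
      (stoch_int alpha K P J e B 0 t (fun r u => S (t - r) (Phi u)))) mu.

Proof.
set mu := @lebesgue_measure R.
set p := 2 / (1 + 2 * alpha) in SPhi_int *.
have p0 : 0 < p by have /andP[] := (exponent_bounds alpha0 alpha_half).2.
have p1 : 1 <= p := (exponent_bounds alpha0 alpha_half).1.
have p12 : 1 <= 2 :> R by lra.
have [C C0 HC] := Ddst_D_of_fun hV sepV alpha0 alpha_half hB.
pose x k := Phi (e k).
pose phi t y r : V := \1_(`[0, t[%classic) r *: S (t - r) y.
pose Ginf u := D_of_fun K p (traj S (Phi u)).
pose Gt t u := D_of_fun K p (phi t (Phi u)).
have mtraj k := measurable_traj sepV hS (x k).
have mupto t k := measurable_traj_upto sepV hS t (x k).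
have phiE t k : phi t (x k) = fun r => traj_upto S t (x k) (t - r).
  by apply/funext => r; exact: traj_upto_reflection.
have traj_fin k : J k -> (Vnorm mu p (traj S (x k)) < +oo)%E.
  by move=> Jk; exact: (Vnorm_traj_fin sepV hS alpha0 alpha_half SPhi_hs SPhi_int Jk).
have from_fin t k : J k -> (Vnorm mu p (traj_from S t (x k)) < +oo)%E.
  by move=> Jk; exact: (Vnorm_traj_from_fin sepV hS alpha0 alpha_half SPhi_hs SPhi_int t Jk).
have ap_inf k : J k -> step_approximable alpha (traj S (x k)).
  by move=> /traj_fin; exact: step_approximable_traj.
have ap_t t k : 0 < t -> J k -> step_approximable alpha (phi t (x k)).
  by move=> t0 /traj_fin; exact: step_approximable_convolution.
have norm_phi t k : (Vnorm mu p (phi t (x k)) <= Vnorm mu p (traj S (x k)))%E.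
  rewrite phiE; have -> := Vnorm_reflection t p0 (mupto t k).
  exact: Vnorm_traj_upto_le.
have [M MP] := sum_Vnorm_traj_bounded sepV hS alpha0 alpha_half SPhi_hs SPhi_int.
(* The zero step function approximates [psi] with error its L^p norm. Since [HC] asks for a positive
   error, the norm is enlarged by eps / C. *)
have Ddst0_le (psi : R -> V) : step_approximable alpha psi ->
    Ddst (D0 V K) (D_of_fun K p psi) <= C * fine (Vnorm mu p psi).
  move=> apsi; have psi_fin : Vnorm mu p psi \is a fin_num.
    by rewrite ge0_fin_numE ?Vnorm_ge0//; exact: apsi.1.2.
  apply/ler_addgt0Pr => eps eps0.
  have -> : C * fine (Vnorm mu p psi) + eps = C * (fine (Vnorm mu p psi) + eps / C).
    by field; rewrite gt_eqF.
  have eC : 0 < eps / C by rewrite divr_gt0.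
  apply: (HC psi apsi (step0 V)); first by rewrite ltr_wpDl// fine_ge0// Vnorm_ge0.
  rewrite EFinD fineK// -[leLHS]adde0 leeD ?lee_fin ?(ltW eC)//.
  rewrite le_eqVlt; apply/orP; left; apply/eqP; apply: eq_Vnorm => r.
  by rewrite /step_val big_ord0 sub0r normrN.
(* The Hilbert-Schmidt condition of [cyl_int_approx], proved at once for the integrands of [X_t] and
   for the limiting one, as the norms of both are bounded by those of the full orbits. *)
have esum_fin (psi : nat -> R -> V) : (forall k, J k -> step_approximable alpha (psi k) /\
    (Vnorm mu p (psi k) <= Vnorm mu p (traj S (x k)))%E) ->
    (\esum_(k in J) (Ddst (D0 V K) (D_of_fun K p (psi k)) ^+ 2)%:E < +oo)%E.
  move=> psiP; apply: (@le_lt_trans _ _ (C ^+ 2 * M)%:E); last by rewrite ltry.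
  apply/esum_nat_le => [k|N]; first exact: sqr_ge0.
  apply: (@le_trans _ _ (C ^+ 2 * \sum_(k < N | (k : nat) \in J) fine (Vnorm mu p (traj S (x k))) ^+ 2)).
    rewrite mulr_sumr; apply: ler_sum => k /set_mem Jk; have [apk nk] := psiP k Jk.
    have f1 := traj_fin k Jk; have f2 := le_lt_trans nk f1.
    have v0 : 0 <= fine (Vnorm mu p (psi k)) by rewrite fine_ge0 ?Vnorm_ge0.
    rewrite -exprMn ler_pXn2r// ?nnegrE ?(Ddst_ge0 hV sepV alpha0 alpha_half hB)//; last first.
      by rewrite mulr_ge0 ?(ltW C0)// fine_ge0 ?Vnorm_ge0.
    apply: le_trans (Ddst0_le _ apk) _; rewrite ler_pM2l//.
    by rewrite fine_le// ge0_fin_numE ?Vnorm_ge0.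
  by rewrite ler_pM2l ?exprn_gt0//; exact: MP.
have [LY HY] := cyl_int_approx hV sepV he alpha0 alpha_half hB (G := Ginf)
  (esum_fin (fun k => traj S (x k)) (fun k Jk => conj (ap_inf k Jk) (lexx _))).
have HX t (t0 : 0 < t) := cyl_int_approx hV sepV he alpha0 alpha_half hB (G := Gt t)
  (esum_fin (fun k => phi t (x k)) (fun k Jk => conj (ap_t t k t0 Jk) (norm_phi t k))).
set Y := cyl_int P J e B Ginf in LY HY.
pose X t := cyl_int P J e B (Gt t).
have key (f : V -> R) (Mf : R) : continuous f -> (forall v, `|f v| <= Mf) ->
    forall eps : R, 0 < eps -> exists2 T : R, 0 < T &
    forall t, T <= t -> `|\int[P]_w (f (X t w)) - \int[P]_w (f (Y w))| <= eps.
  move=> cf fM eps eps0; have eps20 : 0 < eps / 2 by rewrite divr_gt0.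
  have [dl dl0 dlP] := L2_cvg_expectation P sepV cf fM LY.1 eps20.
  have dl20 : 0 < dl / 2 by rewrite divr_gt0.
  have [N1 N1P] := HY _ dl20.
  (* Chosen so that 2 C^2 tau^2 = dl^2 / 8, half of the squared budget (dl / 2)^2. *)
  have tau0 : 0 < dl / (4 * C) by rewrite divr_gt0// mulr_gt0.
  have [T TP] := traj_from_tail sepV hS alpha0 alpha_half SPhi_hs SPhi_int tau0.
  (* The successor guarantees a positive time even if [T] is 0. *)
  exists T.+1%:R => [|t Tt]; first by rewrite ltr0n.
  have t0 : 0 < t by rewrite (lt_le_trans _ Tt)// ltr0n.
  have TTS : T%:R <= T.+1%:R :> R by rewrite ler_nat.
  have {}TP N := TP t N (le_trans TTS Tt).
  have [LX HXt] := HX t t0; rewrite -/(X t) in LX HXt.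
  have [dl' dl'0 dl'P] := L2_cvg_expectation P sepV cf fM LX.1 eps20.
  have [N2 N2P] := HXt _ dl'0.
  pose N := maxn N1 N2.
  have [eta1 eta10 h1P] := N1P N (leq_maxl _ _); have [eta2 eta20 h2P] := N2P N (leq_maxr _ _).
  have Np : 0 < N.+1%:R :> R by rewrite ltr0n.
  (* Chosen so that [N] errors 2 rho^2 use at most the other half, dl^2 / 8. *)
  pose rho := dl / (4 * N.+1%:R).
  have rho0 : 0 < rho by rewrite divr_gt0// mulr_gt0.
  have /choice[a aP] k : exists f, Ddst (Dstep K f) (Ginf (e k)) <= Num.min eta1 (rho / 2).
    by apply: (Ddst_approx hV sepV alpha0 alpha_half hB); rewrite lt_min eta10 divr_gt0.
  (* The same [h k] must do for both integrals: the first bound serves for [X t], the second, after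
     reversal, for [Y]. *)
  pose del := Num.min (eta2 / C) (rho / (2 * C)).
  have del0 : 0 < del by rewrite lt_min !divr_gt0// mulr_gt0.
  have /choice[h hP] k : exists f, J k ->
      (Vnorm mu p (fun r => step_val f r - phi t (x k) r)%R <= del%:E)%E.
    have [Jk|nJk] := pselect (J k); last by exists (step0 V).
    by have [g gP] := (ap_t t k t0 Jk).2 del del0; exists g.
  pose Z w := \sum_(k < N | (k : nat) \in J) step_int (fun s => B s (e k)) (h k) w.
  pose Z' w := \sum_(k < N | (k : nat) \in J) step_int (fun s => B s (e k)) (step_rev t (h k)) w.
  (* [h1P] cannot be applied to the reversed functions directly: the missing tail after [t] is small
     only in the l^2 sum over [k], while [eta1] depends on [N], hence on [t]. The sum [W] is close
     to [Y] by [h1P], and the isometry compares it with [Z']. *)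
  pose W w := \sum_(k < N | (k : nat) \in J) step_int (fun s => B s (e k)) (a k) w.
  have mZ := measurable_sum_step_int sepV J e hB N h : measurable_fun setT (Z : Omega -> borel V).
  have mZ' := measurable_sum_step_int sepV J e hB N (fun k => step_rev t (h k)) :
    measurable_fun setT (Z' : Omega -> borel V).
  have mW := measurable_sum_step_int sepV J e hB N a : measurable_fun setT (W : Omega -> borel V).
  have ZX : `|\int[P]_w (f (Z w)) - \int[P]_w (f (X t w))| <= eps / 2.
    apply: (dl'P Z mZ); rewrite Vnorm_sub_sym; apply: h2P => k kN Jk.
    apply: le_trans (HC _ (ap_t t k t0 Jk) (h k) del del0 (hP k Jk)) _.
    by rewrite mulrC -ler_pdivlMr// ge_min lexx.
  have ZZ' : \int[P]_w (f (Z w)) = \int[P]_w (f (Z' w)).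
    exact: (expectation_step_rev sepV J e hB Bstat Brefl N h t cf fM).
  have Z'Y : `|\int[P]_w (f (Z' w)) - \int[P]_w (f (Y w))| <= eps / 2.
    apply: (dlP Z' mZ'); have mY := LY.1.
    apply: le_trans (Vnorm_dist_triangle P sepV p12 mZ' mW mY) _.
    rewrite [dl]splitr EFinD leeD//; last first.
      rewrite Vnorm_sub_sym; apply: h1P => k kN Jk.
      by apply: le_trans (aP k) _; rewrite ge_min lexx.
    rewrite (_ : (fun w => _) = fun w => \sum_(k < N | (k : nat) \in J)
      (step_int (fun s => B s (e k)) (step_rev t (h k)) w - step_int (fun s => B s (e k)) (a k) w)); last first.
      by apply/funext => w; rewrite sumrB.
    rewrite (step_int_isometry hV he alpha0 alpha_half hB N (fun k => step_rev t (h k)) a) lee_fin.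
    rewrite -[leRHS]ger0_norm ?(ltW dl20)// -sqrtr_sqr ler_wsqrtr//.
    pose tl k := fine (Vnorm mu p (traj_from S t (x k))).
    have tl0 k : 0 <= tl k by rewrite fine_ge0 ?Vnorm_ge0.
    have dstk k : J k -> step_dst K (step_rev t (h k)) (a k) <= C * tl k + rho.
      move=> Jk; rewrite -Ddst_step.
      apply: le_trans (Ddst_triangle hV sepV alpha0 alpha_half hB _ (Ginf (e k)) _) _.
      rewrite (DdstC (Ginf (e k))).
      have le_a : Ddst (Dstep K (a k)) (Ginf (e k)) <= rho / 2.
        by apply: le_trans (aP k) _; rewrite ge_min lexx orbT.
      have Cdel : C * del <= rho / 2.
        apply: (@le_trans _ _ (C * (rho / (2 * C)))).
          by rewrite ler_pM2l// ge_min lexx orbT.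
        by rewrite le_eqVlt; apply/orP; left; apply/eqP; field; rewrite gt_eqF.
      suff : Ddst (Dstep K (step_rev t (h k))) (Ginf (e k)) <= C * (del + tl k).
        by rewrite mulrDr; lra.
      apply: (HC _ (ap_inf k Jk)); first by rewrite ltr_wpDr.
      have mh := measurable_step_val sepV (step_rev t (h k)).
      apply: le_trans (@Vnorm_dist_triangle _ _ _ mu V sepV _ (step_val (step_rev t (h k)))
        (traj_upto S t (x k)) (traj S (x k)) p1 mh (mupto t k) (mtraj k)) _.
      rewrite EFinD leeD//.
        have -> := Vnorm_step_rev sepV t (h k) p0 (mupto t k).
        by have := hP k Jk; rewrite phiE.
      rewrite /tl fineK ?ge0_fin_numE ?Vnorm_ge0 ?from_fin//.
      exact: Vnorm_traj_upto_sub_le.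
    (* The tails and the approximation errors are separated by (x + y)^2 <= 2 x^2 + 2 y^2: the
       former are summed by [TP], the latter are merely counted. *)
    apply: (@le_trans _ _ (\sum_(k < N | (k : nat) \in J) (2 * C ^+ 2 * tl k ^+ 2) +
        \sum_(k < N) 2 * rho ^+ 2)).
      rewrite [X in _ <= _ + X](bigID (fun k : 'I_N => (k : nat) \in J))/= addrA -big_split/=.
      apply: ler_wpDr; first by apply: sumr_ge0 => k _; rewrite mulr_ge0// sqr_ge0.
      apply: ler_sum => k /set_mem Jk.
      apply: (@le_trans _ _ ((C * tl k + rho) ^+ 2)).
        have nn : 0 <= C * tl k + rho by rewrite addr_ge0 ?mulr_ge0 ?(ltW C0)// ltW.
        by rewrite ler_pXn2r ?nnegrE ?step_dst_ge0//; exact: dstk.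
      by have := sqr_ge0 (C * tl k - rho); rewrite !expr2; lra.
    rewrite -mulr_sumr sumr_const card_ord -[_ *+ N]mulr_natl.
    have := TP N; rewrite -/tl; set s := \sum_(k < N | _) _ => sle.
    have s1 : 2 * C ^+ 2 * s <= dl ^+ 2 / 8.
      apply: (@le_trans _ _ (2 * C ^+ 2 * (dl / (4 * C)) ^+ 2)).
        by rewrite ler_pM2l// mulr_gt0// exprn_gt0.
      by rewrite le_eqVlt; apply/orP; left; apply/eqP; field; rewrite gt_eqF.
    have s2 : N%:R * (2 * rho ^+ 2) <= dl ^+ 2 / 8.
      apply: (@le_trans _ _ (N.+1%:R ^+ 2 * (2 * rho ^+ 2))).
        apply: ler_wpM2r; first by rewrite mulr_ge0// sqr_ge0.
        rewrite expr2.
        have NN : N%:R <= N.+1%:R :> R by rewrite ler_nat.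
        by rewrite (le_trans NN)// ler_peMr ?ler1n// ltW.
      by rewrite le_eqVlt; apply/orP; left; apply/eqP; rewrite /rho; field; rewrite gt_eqF.
    rewrite (_ : (dl / 2) ^+ 2 = dl ^+ 2 / 4); last by field.
    lra.
  rewrite -ZZ' in Z'Y; rewrite distrC in ZX.
  have := ler_distD (\int[P]_w (f (Z w))) (\int[P]_w (f (X t w))) (\int[P]_w (f (Y w))).
  lra.
have [nu nuE] := law_probability P LY.1.
exists nu; apply: (@weak_cvg_expectation _ _ _ P V X Y) => //.
- by move=> t t0; exact: (HX t t0).1.1.
- exact: LY.1.
Qed.
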